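(* Let $X$ be a totally disconnected compact metrizable space, $T\colon X\to X$ a homeomorphism, $K$ a field, and $\mathcal A=C_K(X)\rtimes_T\mathbb Z$. Then every Sylvester matrix rank function on $\mathcal A$ is regular, i.e. $\mathbb P(\mathcal A)=\mathbb P_{\mathrm{reg}}(\mathcal A)$.
   Context: $C_K(X)$ is the algebra of locally constant functions $X\to K$, and $\mathcal A=C_K(X)\rtimes_T\mathbb Z$ is the algebraic crossed product: finite formal sums $\sum_{i\in\mathbb Z}f_it^i$ with $f_i\in C_K(X)$, multiplication determined by $tf=(f\circ T^{-1})t$, $t$ invertible. A Sylvester matrix rank function on a unital ring $R$ assigns to each matrix $M$ over $R$ a number $\mathrm{rk}(M)\ge0$ with: $\mathrm{rk}(0)=0$, $\mathrm{rk}(1)=1$; $\mathrm{rk}(M_1M_2)\le\min(\mathrm{rk}(M_1),\mathrm{rk}(M_2))$; $\mathrm{rk}(M_1\oplus M_2)=\mathrm{rk}(M_1)+\mathrm{rk}(M_2)$; $\mathrm{rk}\begin{pmatrix}M_1&M_3\\0&M_2\end{pmatrix}\ge\mathrm{rk}(M_1)+\mathrm{rk}(M_2)$. $\mathbb P(R)$ denotes the set of all Sylvester matrix rank functions on $R$, and $\mathbb P_{\mathrm{reg}}(R)$ the subset of those $\mathrm{rk}$ for which there exist a von Neumann regular ring $S$ with a Sylvester matrix rank function $\mathrm{rk}_S$ and a unital ring homomorphism $\varphi\colon R\to S$ with $\mathrm{rk}(M)=\mathrm{rk}_S(\varphi(M))$ for every matrix $M$ over $R$. *)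

(* Defs.v *)
From Stdlib Require Import Rdefinitions Raxioms RIneq Rbasic_fun List.
From HB Require Import structures.
From mathcomp Require Import all_boot all_order all_algebra.

Set Implicit Arguments.
Unset Strict Implicit.
Unset Printing Implicit Defensive.

Import GRing.Theory.
Local Open Scope ring_scope.

Notation real := Rdefinitions.R.

Definition is_metric (X : Type) (d : X -> X -> real) : Prop :=
  (forall x y, Rle R0 (d x y)) /\
  (forall x y, d x y = R0 <-> x = y) /\
  (forall x y, d x y = d y x) /\
  (forall x y z, Rle (d x z) (Rplus (d x y) (d y z))).

Definition mopen (X : Type) (d : X -> X -> real) (U : X -> Prop) : Prop :=
  forall x, U x -> exists eps, Rlt R0 eps /\ (forall y, Rlt (d x y) eps -> U y).

Definition mcompact (X : Type) (d : X -> X -> real) : Prop :=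
  forall (I : Type) (U : I -> X -> Prop),
    (forall i, mopen d (U i)) -> (forall x, exists i, U i x) ->
    exists l : list I, forall x, exists i, In i l /\ U i x.

Definition mconnected (X : Type) (d : X -> X -> real) (S : X -> Prop) : Prop :=
  ~ (exists U V : X -> Prop, mopen d U /\ mopen d V /\
       (forall x, S x -> U x \/ V x) /\
       (forall x, S x -> U x -> V x -> False) /\
       (exists x, S x /\ U x) /\ (exists x, S x /\ V x)).

Definition totally_disconnected (X : Type) (d : X -> X -> real) : Prop :=
  forall S : X -> Prop, mconnected d S -> forall x y, S x -> S y -> x = y.

Definition mcontinuous (X : Type) (d : X -> X -> real) (f : X -> X) : Prop :=
  forall x eps, Rlt R0 eps ->
    exists delta, Rlt R0 delta /\ (forall y, Rlt (d x y) delta -> Rlt (d (f x) (f y)) eps).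

Definition homeomorphism (X : Type) (d : X -> X -> real) (T Tinv : X -> X) : Prop :=
  mcontinuous d T /\ mcontinuous d Tinv /\
  (forall x, T (Tinv x) = x) /\ (forall x, Tinv (T x) = x).

(* f : X -> K is locally constant; C_K(X) is the set of such functions *)
Definition locally_constant (X : Type) (d : X -> X -> real) (K : Type) (f : X -> K) : Prop :=
  forall x, exists eps, Rlt R0 eps /\ (forall y, Rlt (d x y) eps -> f y = f x).

(* The algebraic crossed product C_K(X) \rtimes_T Z, characterised (up to ring
   isomorphism) as a ring A together with an embedding iota of C_K(X) and an
   invertible element t (inverse tinv) such that t f = (f o T^{-1}) t and
   every element of A is uniquely a finite sum  \sum_i iota(f_i) t^i. *)

Definition zpow (A : pzRingType) (t tinv : A) (z : int) : A :=
  match z with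
  | Posz n => t ^+ n
  | Negz n => tinv ^+ n.+1
  end.

Definition is_crossed_product (X : Type) (d : X -> X -> real) (T Tinv : X -> X)
    (K : fieldType) (A : pzRingType) (iota : (X -> K) -> A) (t tinv : A) : Prop :=
  (forall f g, locally_constant d f -> locally_constant d g ->
     iota (fun x => f x + g x) = iota f + iota g) /\
  (forall f g, locally_constant d f -> locally_constant d g ->
     iota (fun x => f x * g x) = iota f * iota g) /\
  iota (fun _ => 1) = 1 /\
  t * tinv = 1 /\ tinv * t = 1 /\
  (forall f, locally_constant d f -> t * iota f = iota (fun x => f (Tinv x)) * t) /\
  (forall a : A, exists (N : nat) (f : 'I_(N + N).+1 -> X -> K),
     (forall i, locally_constant d (f i)) /\
     a = \sum_(i < (N + N).+1) iota (f i) * zpow t tinv (i%:Z - N%:Z)) /\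
  (forall (N : nat) (f : 'I_(N + N).+1 -> X -> K),
     (forall i, locally_constant d (f i)) ->
     \sum_(i < (N + N).+1) iota (f i) * zpow t tinv (i%:Z - N%:Z) = 0 ->
     forall i x, f i x = 0).

Definition rank_fun (A : pzRingType) := forall m n : nat, 'M[A]_(m, n) -> real.

Definition sylvester (A : pzRingType) (rk : rank_fun A) : Prop :=
  (forall m n (M : 'M[A]_(m, n)), Rle R0 (rk m n M)) /\
  rk 1%N 1%N 0 = R0 /\
  rk 1%N 1%N 1%:M = R1 /\
  (forall m n p (M1 : 'M[A]_(m, n)) (M2 : 'M[A]_(n, p)),
     Rle (rk m p (M1 *m M2)) (Rmin (rk m n M1) (rk n p M2))) /\
  (forall m1 n1 m2 n2 (M1 : 'M[A]_(m1, n1)) (M2 : 'M[A]_(m2, n2)),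
     rk (m1 + m2)%N (n1 + n2)%N (block_mx M1 0 0 M2) = Rplus (rk m1 n1 M1) (rk m2 n2 M2)) /\
  (forall m1 n1 m2 n2 (M1 : 'M[A]_(m1, n1)) (M2 : 'M[A]_(m2, n2)) (M3 : 'M[A]_(m1, n2)),
     Rle (Rplus (rk m1 n1 M1) (rk m2 n2 M2)) (rk (m1 + m2)%N (n1 + n2)%N (block_mx M1 M3 0 M2))).

Definition von_neumann_regular (S : pzRingType) : Prop :=
  forall x : S, exists y : S, x * y * x = x.

Definition regular_rank (A : pzRingType) (rk : rank_fun A) : Prop :=
  exists (S : pzRingType) (rkS : rank_fun S) (phi : {rmorphism A -> S}),
    von_neumann_regular S /\ sylvester rkS /\
    forall m n (M : 'M[A]_(m, n)), rk m n M = rkS m n (map_mx phi M).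

(* Main.v *)
(* A rank function rk on A restricts to a finitely additive T-invariant measure E |-> rk(1_E)
   on clopen sets. By an ultraproduct argument it is enough to approximate rk, on finitely
   many matrices and up to a small error, by rank functions pulled back from regular rings
   along almost homomorphisms. Finitely many matrices only see a locally constant labelling c
   of X, and rk is the sum of its restrictions to the finitely many c-itineraries of period
   at most N and of a remainder rk'.

   On a periodic itinerary of period p, A acts through M_p(K[s, s^-1]); diagonalising matrices
   over K[s] reduces rank functions of K[s] to their values on powers of irreducibles, where
   convexity exhibits them as combinations of ranks over K(s) and over the finite-dimensional
   quotients K[s]/(q^j).

   For the remainder, Krieger's marker lemma gives a clopen E meeting every orbit within bounded
   time with rk'(1_E) about 1/N. Cutting the orbits at E gives Rokhlin towers of bounded height;
   the elements of A preserving the towers form a regular subring, as a corner of a matrix ring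
   over C_K(X), and this subring contains all of C_K(X) and approximates t up to rank rk'(1_E). *)
Require Import Defs.
From Stdlib Require Import Rdefinitions.
From Stdlib Require RIneq Rbasic_fun.
From HB Require Import structures.
From mathcomp Require Import all_boot all_order all_algebra.
From mathcomp Require Import generic_quotient perm.
From mathcomp Require Import boolp classical_sets filter reals Rstruct.
From mathcomp Require Import zify ring lra.

Set Implicit Arguments.
Unset Strict Implicit.
Unset Printing Implicit Defensive.

Import Order.TTheory GRing.Theory Num.Theory.
Local Open Scope ring_scope.
(* Stdlib binds [R_scope] to [R]: without this, 0 and + at type [real] would be Stdlib's. *)
Bind Scope ring_scope with Rdefinitions.R.

(** Markers alone cannot work. A marker set must meet every orbit, and on orbits of period p it
    takes at least a share 1/p of the mass, so its rank stays large where short periods carry mass.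
    On such a part the rank is also not determined by the measure, since it records the ranks of
    polynomials in t^p. Short periods therefore have to be removed exactly before towers are built.
    Itineraries make this a finite task: X may contain infinitely many points of period p, but a
    labelling with finitely many values has only finitely many itineraries of each period. The price
    is that a periodic itinerary gives a representation only of the elements whose coefficients are
    functions of the itinerary, which is why approximants have to respect the ring operations on a
    finite set only. The removal is possible because elements of A move points by a bounded time:
    shrinking clopen neighbourhoods of the periodic part are invariant up to a change of index, so
    the ranks cut down to them converge to a rank function. The tolerance is fixed first, then the
    bound N on the periods, then the neighbourhoods. *)

(** * Unnormalised rank functions *)

(* The normalisation rk(1) = 1 is dropped, so that these can be added, restricted to
   corners and passed to the limit. *)
Definition prank (A : pzRingType) (rk : rank_fun A) : Prop :=
  [/\ (forall m n (M : 'M[A]_(m, n)), 0 <= rk m n M),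
      rk 1%N 1%N 0 = 0,
      (forall m n p (M1 : 'M[A]_(m, n)) (M2 : 'M[A]_(n, p)),
        rk m p (M1 *m M2) <= rk m n M1 /\ rk m p (M1 *m M2) <= rk n p M2),
      (forall m1 n1 m2 n2 (M1 : 'M[A]_(m1, n1)) (M2 : 'M[A]_(m2, n2)),
        rk _ _ (block_mx M1 0 0 M2) = rk _ _ M1 + rk _ _ M2)
    & (forall m1 n1 m2 n2 (M1 : 'M[A]_(m1, n1)) (M2 : 'M[A]_(m2, n2))
         (M3 : 'M[A]_(m1, n2)),
        rk _ _ M1 + rk _ _ M2 <= rk _ _ (block_mx M1 M3 0 M2))].

Lemma sylvester_prank (A : pzRingType) (rk : rank_fun A) :
  sylvester rk <-> prank rk /\ rk 1%N 1%N 1%:M = 1.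
Proof.
split.
  move=> [h0 [hz [h1 [hm [hd ht]]]]]; split=> //; split=> //.
  - by move=> m n M; apply/RleP; exact: h0.
  - move=> m n p M1 M2; have h := hm _ _ _ M1 M2.
    by split; apply/RleP; apply: RIneq.Rle_trans h _; [exact: Rbasic_fun.Rmin_l | exact: Rbasic_fun.Rmin_r].
  - by move=> *; apply/RleP; exact: ht.
move=> [[h0 hz hm hd ht] h1]; split; first by move=> *; apply/RleP.
split=> //; split=> //; split.
  by move=> m n p M1 M2; apply: Rbasic_fun.Rmin_glb; apply/RleP; have [] := hm _ _ _ M1 M2.
by split=> // *; apply/RleP.
Qed.

Section PrankTheory.
Variables (A : pzRingType) (rk : rank_fun A).
Hypothesis rkP : prank rk.

Definition rk1 (a : A) : real := rk (a%:M : 'M_1).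

Lemma prk_ge0 m n (M : 'M[A]_(m, n)) : 0 <= rk M.
Proof. by case: rkP => h *. Qed.

Lemma prk_mull m n p (M : 'M[A]_(m, n)) (N : 'M[A]_(n, p)) : rk (M *m N) <= rk M.
Proof. by case: rkP => _ _ h *; have [] := h _ _ _ M N. Qed.

Lemma prk_mulr m n p (M : 'M[A]_(m, n)) (N : 'M[A]_(n, p)) : rk (M *m N) <= rk N.
Proof. by case: rkP => _ _ h *; have [] := h _ _ _ M N. Qed.

Lemma prk_mul3 m n p q (P : 'M[A]_(m, n)) (M : 'M[A]_(n, p)) (Q : 'M[A]_(p, q)) :
  rk (P *m M *m Q) <= rk M.
Proof. exact: le_trans (prk_mull _ _) (prk_mulr _ _). Qed.

Lemma prk_diag m1 n1 m2 n2 (M : 'M[A]_(m1, n1)) (N : 'M[A]_(m2, n2)) :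
  rk (block_mx M 0 0 N) = rk M + rk N.
Proof. by case: rkP. Qed.

Lemma prk_trig m1 n1 m2 n2 (M : 'M[A]_(m1, n1)) (N : 'M[A]_(m2, n2))
    (L : 'M[A]_(m1, n2)) : rk M + rk N <= rk (block_mx M L 0 N).
Proof. by case: rkP. Qed.

Lemma prk0 m n : rk (0 : 'M[A]_(m, n)) = 0.
Proof.
have rk0 : rk (0 : 'M[A]_1) = 0 by case: rkP.
apply/eqP; rewrite eq_le prk_ge0 andbT -[leRHS]rk0.
have -> : 0 = (0 : 'M[A]_(m, 1)) *m (0 : 'M[A]_1) *m (0 : 'M[A]_(1, n)) :> 'M_(m, n).
  by rewrite !mulmx0.
exact: prk_mul3.
Qed.

Lemma prkD m n (M N : 'M[A]_(m, n)) : rk (M + N) <= rk M + rk N.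
Proof.
have -> : M + N = row_mx 1%:M 1%:M *m block_mx M 0 0 N *m col_mx 1%:M 1%:M.
  by rewrite mul_row_block mul_row_col !mul1mx addr0 add0r !mulmx1.
by rewrite -prk_diag; exact: prk_mul3.
Qed.

Lemma prkN m n (M : 'M[A]_(m, n)) : rk (- M) = rk M.
Proof.
have h (L : 'M[A]_(m, n)) : rk (- L) <= rk L.
  by rewrite -[- L]mul1mx mulmxN -mulNmx; exact: prk_mulr.
by apply/eqP; rewrite eq_le h -{1}[M]opprK h.
Qed.

Lemma prk_sum m n I (r : seq I) (P : pred I) (F : I -> 'M[A]_(m, n)) :
  rk (\sum_(i <- r | P i) F i) <= \sum_(i <- r | P i) rk (F i).
Proof.
elim/big_rec2: _ => [|i x M _ h]; first by rewrite prk0.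
by apply: le_trans (prkD _ _) _; rewrite lerD2l.
Qed.

Lemma prk_entries m n (M : 'M[A]_(m, n)) : rk M <= \sum_i \sum_j rk1 (M i j).
Proof.
rewrite {1}[M]matrix_sum_delta.
apply: le_trans (prk_sum _ _ _) _; apply: ler_sum => i _.
apply: le_trans (prk_sum _ _ _) _; apply: ler_sum => j _.
have -> : M i j *: delta_mx i j =
   delta_mx i 0 *m ((M i j)%:M : 'M_1) *m delta_mx 0 j :> 'M_(m, n).
  apply/matrixP => k l; rewrite !mxE big_ord1 !mxE big_ord1 !mxE.
  rewrite eqxx /= mulr1n ?andbT.
  by case: (k == i); case: (l == j); rewrite /= ?mul1r ?mulr1 ?mul0r ?mulr0.
exact: prk_mul3.
Qed.

Lemma rk1_ge0 a : 0 <= rk1 a.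
Proof. exact: prk_ge0. Qed.

Lemma rk1_0 : rk1 0 = 0.
Proof. by rewrite /rk1 raddf0 prk0. Qed.

Lemma rk1D a b : rk1 (a + b) <= rk1 a + rk1 b.
Proof. by rewrite /rk1 raddfD; exact: prkD. Qed.

Lemma rk1N a : rk1 (- a) = rk1 a.
Proof. by rewrite /rk1 raddfN prkN. Qed.

Lemma rk1B a b : rk1 (a - b) <= rk1 a + rk1 b.
Proof. by rewrite -(rk1N b); exact: rk1D. Qed.

Lemma rk1_sum I (r : seq I) (P : pred I) (F : I -> A) :
  rk1 (\sum_(i <- r | P i) F i) <= \sum_(i <- r | P i) rk1 (F i).
Proof. by rewrite /rk1 raddf_sum; exact: prk_sum. Qed.

Lemma rk1_mull a b : rk1 (a * b) <= rk1 a.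
Proof. by rewrite /rk1 scalar_mxM; exact: prk_mull. Qed.

Lemma rk1_mulr a b : rk1 (a * b) <= rk1 b.
Proof. by rewrite /rk1 scalar_mxM; exact: prk_mulr. Qed.

Lemma rk1_mulr_0 a b : rk1 b = 0 -> rk1 (a * b) = 0.
Proof. by move=> h; apply/eqP; rewrite eq_le rk1_ge0 -h rk1_mulr. Qed.

Lemma rk1_mull_0 a b : rk1 a = 0 -> rk1 (a * b) = 0.
Proof. by move=> h; apply/eqP; rewrite eq_le rk1_ge0 -h rk1_mull. Qed.

Lemma rk1D_0 a b : rk1 a = 0 -> rk1 b = 0 -> rk1 (a + b) = 0.
Proof.
by move=> ha hb; apply/eqP; rewrite eq_le rk1_ge0 andbT (le_trans (rk1D _ _)) // ha hb addr0.
Qed.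

Lemma prk_dist m n (M N : 'M[A]_(m, n)) : `|rk M - rk N| <= rk (M - N).
Proof.
rewrite ler_norml; apply/andP; split.
  by rewrite lerNl opprB lerBlDr -(prkN (M - N)) opprB -{1}[N](subrK M) prkD.
by rewrite lerBlDr -{1}[M](subrK N) prkD.
Qed.

Lemma prk_null m n (M : 'M[A]_(m, n)) : (forall i j, rk1 (M i j) = 0) -> rk M = 0.
Proof.
move=> h; apply/eqP; rewrite eq_le prk_ge0 andbT.
apply: le_trans (prk_entries _) _; rewrite big1 // => i _.
by rewrite big1.
Qed.

Lemma prk_close m n (M N : 'M[A]_(m, n)) :
  (forall i j, rk1 (M i j - N i j) = 0) -> rk M = rk N.
Proof.
move=> h; apply/eqP; rewrite -subr_eq0 -normr_le0.
by apply: le_trans (prk_dist _ _) _; rewrite prk_null // => i j; rewrite !mxE.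
Qed.

Lemma prk_sub_le m' n' m n (f : 'I_m' -> 'I_m) (g : 'I_n' -> 'I_n) (M : 'M[A]_(m, n)) :
  rk (mxsub f g M) <= rk M.
Proof.
have -> : mxsub f g M = rowsub f 1%:M *m M *m colsub g 1%:M.
  by rewrite -{1}[M]mulmx1 mxsub_mul -{1}[M]mul1mx mxsub_mul mxsub_id.
exact: prk_mul3.
Qed.

(** Each matrix is a submatrix of the other, so the index maps need not be mutually inverse. This
    compares matrices whose index types differ only by bracketing, such as [(m1 + m2) * p] and
    [m1 * p + m2 * p], without casts. *)
Lemma prk_reindex m' n' m n (f : 'I_m' -> 'I_m) (g : 'I_n' -> 'I_n)
    (f' : 'I_m -> 'I_m') (g' : 'I_n -> 'I_n') (M : 'M[A]_(m, n)) (N : 'M[A]_(m', n')) :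
  (forall i j, N i j = M (f i) (g j)) -> (forall i j, M i j = N (f' i) (g' j)) ->
  rk N = rk M.
Proof.
move=> h1 h2; apply/eqP; rewrite eq_le.
have -> : N = mxsub f g M by apply/matrixP => i j; rewrite !mxE.
rewrite prk_sub_le /=.
have {1}-> : M = mxsub f' g' (mxsub f g M).
  by apply/matrixP => i j; rewrite !mxE -h1 -h2.
exact: prk_sub_le.
Qed.

Lemma prk_diagC m1 n1 m2 n2 (M : 'M[A]_(m1, n1)) (N : 'M[A]_(m2, n2)) :
  rk (block_mx 0 M N 0) = rk M + rk N.
Proof.
rewrite -prk_diag; apply/eqP; rewrite eq_le; apply/andP; split.
  have -> : block_mx 0 M N 0 = block_mx M 0 0 N *m block_mx 0 1%:M 1%:M 0.
    by rewrite mulmx_block !(mulmx0, mulmx1, mul0mx, addr0, add0r).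
  exact: prk_mull.
have -> : block_mx M 0 0 N = block_mx 0 M N 0 *m block_mx 0 1%:M 1%:M 0.
  by rewrite mulmx_block !(mulmx0, mulmx1, mul0mx, addr0, add0r).
exact: prk_mull.
Qed.

Lemma prk_scalar n a : rk (a%:M : 'M_n) = n%:R * rk1 a.
Proof.
elim: n => [|n IH]; first by rewrite mul0r [a%:M]flatmx0 prk0.
have -> : rk (a%:M : 'M_n.+1) = rk (a%:M : 'M_(1 + n)) by [].
by rewrite scalar_mx_block prk_diag IH -natr1 mulrDl mul1r addrC.
Qed.

Lemma prk_lerow m n (M : 'M[A]_(m, n)) : rk M <= m%:R * rk1 1.
Proof. by rewrite -prk_scalar -{1}[M]mul1mx; exact: prk_mull. Qed.

(** Elementary operations turn the antidiagonal matrix with blocks N and - M N L into a triangular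
    one with diagonal blocks N L and M N. *)
Lemma frobenius m n p q (M : 'M[A]_(m, n)) (N : 'M[A]_(n, p)) (L : 'M[A]_(p, q)) :
  rk (M *m N) + rk (N *m L) <= rk N + rk (M *m N *m L).
Proof.
rewrite addrC; apply: le_trans (prk_trig _ _ N) _.
rewrite -(prkN (M *m N *m L)) -prk_diagC.
have -> : block_mx (N *m L) N 0 (M *m N) =
   block_mx 1%:M 0 M 1%:M *m block_mx 0 N (- (M *m N *m L)) 0 *m
   block_mx 1%:M 0 L 1%:M.
  rewrite !mulmx_block !(mulmx0, mul0mx, mulmx1, mul1mx, addr0, add0r).
  by rewrite addNr.
exact: prk_mul3.
Qed.

End PrankTheory.


(** * Quotient by the elements of rank zero *)

Lemma map_mx_surj (P Q : Type) (f : P -> Q) m n (M : 'M[Q]_(m, n)) :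
  (forall y, exists x, f x = y) -> exists N, M = map_mx f N.
Proof.
move=> /choice [g gK]; exists (map_mx g M).
by apply/matrixP => i j; rewrite !mxE gK.
Qed.

Lemma prank_surj (P Q : pzRingType) (f : {rmorphism P -> Q}) (rk : rank_fun P)
    (rq : rank_fun Q) :
  prank rk -> (forall y, exists x, f x = y) ->
  (forall m n (M : 'M_(m, n)), rq _ _ (map_mx f M) = rk _ _ M) -> prank rq.
Proof.
move=> rkP fs rqE; split.
- by move=> m n M; have [N ->] := map_mx_surj M fs; rewrite rqE prk_ge0.
- by rewrite -(map_mx0 f) rqE; case: rkP.
- move=> m n p M1 M2; have [N1 ->] := map_mx_surj M1 fs.
  have [N2 ->] := map_mx_surj M2 fs; rewrite -map_mxM !rqE.
  by split; [exact: prk_mull | exact: prk_mulr].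
- move=> m1 n1 m2 n2 M1 M2; have [N1 ->] := map_mx_surj M1 fs.
  have [N2 ->] := map_mx_surj M2 fs.
  by rewrite -(map_mx0 f) -[0 in X in block_mx _ _ X](map_mx0 f) -map_block_mx !rqE prk_diag.
- move=> m1 n1 m2 n2 M1 M2 M3; have [N1 ->] := map_mx_surj M1 fs.
  have [N2 ->] := map_mx_surj M2 fs; have [N3 ->] := map_mx_surj M3 fs.
  by rewrite -(map_mx0 f) -map_block_mx !rqE prk_trig.
Qed.

Section NullQuotient.
Variables (P : pzRingType) (rk : rank_fun P).
Hypothesis rkP : prank rk.

Definition null_equiv (x y : P) : bool := rk1 rk (x - y) == 0.

Lemma null_equiv_refl : reflexive null_equiv.
Proof. by move=> x; rewrite /null_equiv subrr rk1_0. Qed.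

Lemma null_equiv_sym : symmetric null_equiv.
Proof. by move=> x y; rewrite /null_equiv -opprB rk1N. Qed.

Lemma null_equiv_trans : transitive null_equiv.
Proof.
move=> y x z /eqP h1 /eqP h2; apply/eqP.
by rewrite -(subrK y x) -addrA rk1D_0.
Qed.

Canonical null_equiv_rel :=
  EquivRel null_equiv null_equiv_refl null_equiv_sym null_equiv_trans.

Definition null_quot := {eq_quot null_equiv}%qT.

HB.instance Definition _ := EqQuotient.on null_quot.
HB.instance Definition _ := Choice.on null_quot.

Local Notation pi := (\pi_null_quot)%qT.

Lemma null_piP x y : pi x = pi y <-> rk1 rk (x - y) = 0.
Proof.
split=> [/eqP|h]; first by rewrite eqmodE /= => /eqP.
by apply/eqP; rewrite eqmodE /=; apply/eqP.
Qed.

Lemma null_reprP x : rk1 rk (repr (pi x) - x) = 0.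
Proof. by apply/null_piP; rewrite reprK. Qed.

Definition nq_add (x y : null_quot) := pi (repr x + repr y).
Definition nq_opp (x : null_quot) := pi (- repr x).
Definition nq_mul (x y : null_quot) := pi (repr x * repr y).

Lemma nq_addE x y : nq_add (pi x) (pi y) = pi (x + y).
Proof.
apply/null_piP; rewrite opprD addrACA.
by apply: rk1D_0 => //; apply: null_reprP.
Qed.

Lemma nq_oppE x : nq_opp (pi x) = pi (- x).
Proof. by apply/null_piP; rewrite -opprD rk1N ?null_reprP. Qed.

Lemma nq_mulE x y : nq_mul (pi x) (pi y) = pi (x * y).
Proof.
apply/null_piP; set x' := repr _; set y' := repr _.
have -> : x' * y' - x * y = (x' - x) * y' + x * (y' - y).
  by rewrite mulrBl mulrBr addrA subrK.
by apply: rk1D_0 => //; [apply: rk1_mull_0 | apply: rk1_mulr_0] => //; apply: null_reprP.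
Qed.

Lemma nq_ind (p : null_quot -> Prop) : (forall x, p (pi x)) -> forall x, p x.
Proof. by move=> h x; rewrite -[x]reprK. Qed.

Fact nq_addA : associative nq_add.
Proof. by do 3!elim/nq_ind=> ?; rewrite !nq_addE addrA. Qed.
Fact nq_addC : commutative nq_add.
Proof. by do 2!elim/nq_ind=> ?; rewrite !nq_addE addrC. Qed.
Fact nq_add0 : left_id (pi 0) nq_add.
Proof. by elim/nq_ind=> ?; rewrite !nq_addE add0r. Qed.
Fact nq_addN : left_inverse (pi 0) nq_opp nq_add.
Proof. by elim/nq_ind=> ?; rewrite nq_oppE !nq_addE addNr. Qed.
Fact nq_mulA : associative nq_mul.
Proof. by do 3!elim/nq_ind=> ?; rewrite !nq_mulE mulrA. Qed.
Fact nq_mul1 : left_id (pi 1) nq_mul.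
Proof. by elim/nq_ind=> ?; rewrite !nq_mulE mul1r. Qed.
Fact nq_1mul : right_id (pi 1) nq_mul.
Proof. by elim/nq_ind=> ?; rewrite !nq_mulE mulr1. Qed.
Fact nq_mulDl : left_distributive nq_mul nq_add.
Proof. by do 3!elim/nq_ind=> ?; rewrite !(nq_addE, nq_mulE) mulrDl. Qed.
Fact nq_mulDr : right_distributive nq_mul nq_add.
Proof. by do 3!elim/nq_ind=> ?; rewrite !(nq_addE, nq_mulE) mulrDr. Qed.

HB.instance Definition _ := GRing.isPzRing.Build null_quot
  nq_addA nq_addC nq_add0 nq_addN nq_mulA nq_mul1 nq_1mul nq_mulDl nq_mulDr.

Definition null_pi (x : P) : null_quot := pi x.

Fact null_pi_zmod : zmod_morphism null_pi.
Proof. by move=> x y; rewrite -[RHS]/(nq_add _ (nq_opp _)) nq_oppE nq_addE. Qed.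
Fact null_pi_monoid : monoid_morphism null_pi.
Proof. by split=> // x y; rewrite -[RHS]/(nq_mul _ _) nq_mulE. Qed.
HB.instance Definition _ := GRing.isZmodMorphism.Build _ _ null_pi null_pi_zmod.
HB.instance Definition _ := GRing.isMonoidMorphism.Build _ _ null_pi null_pi_monoid.

(** Serves twice: in the ultraproduct it turns almost homomorphisms into homomorphisms, and at a
    periodic itinerary it kills the functions that vanish along the orbit. *)
Lemma null_quotient : exists (Q : pzRingType) (f : {rmorphism P -> Q}) (rq : rank_fun Q),
  [/\ prank rq, (forall y, exists x, f x = y),
      (forall m n (M : 'M_(m, n)), rq _ _ (map_mx f M) = rk M)
    & (forall x, rk1 rk x = 0 -> f x = 0)].
Proof.
(* Any representatives will do: by [prk_close], changing entries by elements of rank zero does not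
   change the rank. *)
pose rq : rank_fun null_quot := fun m n M => rk (map_mx (fun y : null_quot => repr y) M).
have fs (y : null_quot) : exists x, null_pi x = y by exists (repr y); exact: reprK.
have rqE m n (M : 'M_(m, n)) : rq _ _ (map_mx null_pi M) = rk M.
  by apply: (prk_close rkP) => i j; rewrite !mxE null_reprP.
exists null_quot, null_pi, rq; split=> //; first exact: (@prank_surj _ _ null_pi rk).
by move=> x hx; rewrite -(rmorph0 null_pi); apply/null_piP; rewrite subr0.
Qed.

End NullQuotient.

Lemma vnr_surj (P Q : pzRingType) (f : {rmorphism P -> Q}) :
  (forall y, exists x, f x = y) -> von_neumann_regular P -> von_neumann_regular Q.
Proof.
move=> fs hP y; have [x <-] := fs y; have [z hz] := hP x.
by exists (f z); rewrite -!rmorphM hz.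
Qed.

Section DepProduct.
Variables (I : Type) (S : I -> pzRingType).

Definition dprod := forall i, S i.
HB.instance Definition _ := gen_eqMixin dprod.
HB.instance Definition _ := gen_choiceMixin dprod.

Fact dprod_addA : associative (fun (x y : dprod) i => x i + y i).
Proof. by move=> x y z; apply: functional_extensionality_dep => i; rewrite addrA. Qed.
Fact dprod_addC : commutative (fun (x y : dprod) i => x i + y i).
Proof. by move=> x y; apply: functional_extensionality_dep => i; rewrite addrC. Qed.
Fact dprod_add0 : left_id ((fun i => 0) : dprod) (fun (x y : dprod) i => x i + y i).
Proof. by move=> x; apply: functional_extensionality_dep => i; rewrite add0r. Qed.
Fact dprod_addN : left_inverse ((fun i => 0) : dprod) (fun (x : dprod) i => - x i)
  (fun (x y : dprod) i => x i + y i).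
Proof. by move=> x; apply: functional_extensionality_dep => i; rewrite addNr. Qed.
Fact dprod_mulA : associative (fun (x y : dprod) i => x i * y i).
Proof. by move=> x y z; apply: functional_extensionality_dep => i; rewrite mulrA. Qed.
Fact dprod_mul1 : left_id ((fun i => 1) : dprod) (fun (x y : dprod) i => x i * y i).
Proof. by move=> x; apply: functional_extensionality_dep => i; rewrite mul1r. Qed.
Fact dprod_1mul : right_id ((fun i => 1) : dprod) (fun (x y : dprod) i => x i * y i).
Proof. by move=> x; apply: functional_extensionality_dep => i; rewrite mulr1. Qed.
Fact dprod_mulDl : left_distributive (fun (x y : dprod) i => x i * y i)
  (fun (x y : dprod) i => x i + y i).
Proof. by move=> x y z; apply: functional_extensionality_dep => i; rewrite mulrDl. Qed.
Fact dprod_mulDr : right_distributive (fun (x y : dprod) i => x i * y i)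
  (fun (x y : dprod) i => x i + y i).
Proof. by move=> x y z; apply: functional_extensionality_dep => i; rewrite mulrDr. Qed.

HB.instance Definition _ := GRing.isPzRing.Build dprod dprod_addA dprod_addC
  dprod_add0 dprod_addN dprod_mulA dprod_mul1 dprod_1mul dprod_mulDl dprod_mulDr.

Definition dproj i (x : dprod) : S i := x i.
Fact dproj_zmod i : zmod_morphism (dproj i). Proof. by []. Qed.
Fact dproj_monoid i : monoid_morphism (dproj i). Proof. by []. Qed.
HB.instance Definition _ i := GRing.isZmodMorphism.Build _ _ (dproj i) (dproj_zmod i).
HB.instance Definition _ i := GRing.isMonoidMorphism.Build _ _ (dproj i) (dproj_monoid i).

Lemma vnr_dprod : (forall i, von_neumann_regular (S i)) -> von_neumann_regular dprod.
Proof.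
move=> h x; exists (fun i => sval (cid (h i (x i)))).
by apply: functional_extensionality_dep => i; exact: (svalP (cid (h i (x i)))).
Qed.

End DepProduct.


(** * Ultraproducts *)

Local Open Scope classical_set_scope.

Section Ultralimit.
Variables (I : Type) (U : set_system I).
Hypothesis UU : UltraFilter U.
Implicit Types f g : I -> real.

Definition ulim_of f (l : real) := forall e, 0 < e -> U [set i | `|f i - l| <= e].
Definition ulim f : real := xget 0 (ulim_of f).
Definition bounded_fam f := exists B : real, forall i, `|f i| <= B.

Lemma ultra_mono (P Q : set I) : U P -> (forall i, P i -> Q i) -> U Q.
Proof. by move=> UP PQ; apply: filterS UP. Qed.

Lemma ultra_ex (P : set I) : U P -> exists i, P i.
Proof. by move=> /filter_ex. Qed.

Lemma ulim_unique f l l' : ulim_of f l -> ulim_of f l' -> l = l'.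
Proof.
move=> h h'; apply/eqP; rewrite -subr_eq0 -normr_le0.
apply/ler_addgt0Pl => e e0; rewrite addr0.
have e2 : 0 < e / 2 by lra.
have [i /= [/ler_normlP[? ?] /ler_normlP[? ?]]] := ultra_ex (filterI (h _ e2) (h' _ e2)).
by apply/ler_normlP; split; lra.
Qed.

Lemma ulim_eq f l : ulim_of f l -> ulim f = l.
Proof. by move=> h; rewrite /ulim; case: xgetP => [x _ /ulim_unique/(_ h)|/(_ l)]. Qed.

(** The limit is the supremum of the r with [r <= f i] for almost all i; since U is an ultrafilter,
    a bound that does not hold almost everywhere fails almost everywhere. *)
Lemma ulimP f : bounded_fam f -> ulim_of f (ulim f).
Proof.
case=> B hB; suff [l hl] : exists l, ulim_of f l by rewrite (ulim_eq hl).
pose E : set real := [set r | U [set i | r <= f i]].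
have EB : E (- B).
  by apply: ultra_mono (@filterT _ U _) _ => i _ /=; have /ler_normlP[] := hB i; lra.
have uE : ubound E B.
  move=> r /ultra_ex [i /= hi]; apply: le_trans hi _.
  by have /ler_normlP[] := hB i; lra.
have sE : has_sup E by split; [exists (- B) | exists B].
exists (sup E) => e e0.
have [r Er hr] := sup_adherent e0 sE.
have h2 : U (~` [set i | sup E + e <= f i]).
  have [h|//] := in_ultra_setVsetC [set i | sup E + e <= f i] UU.
  have : sup E + e <= sup E by apply: ub_le_sup => //; exists B.
  by lra.
apply: ultra_mono (filterI Er h2) _ => i /= [h3 /negP]; rewrite -ltNge => h4.
by apply/ler_normlP; split; lra.
Qed.

Lemma ulim_cst c : ulim (fun=> c) = c.
Proof.
apply: ulim_eq => e e0; apply: ultra_mono (@filterT _ U _) _ => i _ /=.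
by rewrite subrr normr0 ltW.
Qed.

Lemma ulimD f g : bounded_fam f -> bounded_fam g ->
  ulim (fun i => f i + g i) = ulim f + ulim g.
Proof.
move=> /ulimP hf /ulimP hg; apply: ulim_eq => e e0.
have e2 : 0 < e / 2 by lra.
apply: ultra_mono (filterI (hf _ e2) (hg _ e2)) _.
move=> i /= [/ler_normlP[? ?] /ler_normlP[? ?]].
by apply/ler_normlP; split; lra.
Qed.

Lemma ulim_le f g : bounded_fam f -> bounded_fam g ->
  (forall i, f i <= g i) -> ulim f <= ulim g.
Proof.
move=> /ulimP hf /ulimP hg fg; apply/ler_addgt0Pl => e e0.
have e2 : 0 < e / 2 by lra.
have [i /= [/ler_normlP[? ?] /ler_normlP[? ?]]] := ultra_ex (filterI (hf _ e2) (hg _ e2)).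
by have := fg i; lra.
Qed.

End Ultralimit.

Section UltraRank.
Variables (I : Type) (U : set_system I).
Hypothesis UU : UltraFilter U.
Variables (S : I -> pzRingType) (r : forall i, rank_fun (S i)) (B : real).
Hypotheses (rP : forall i, prank (@r i)) (rB : forall i, rk1 (@r i) 1 <= B).

(** The ultraproduct is the full product modulo the elements of rank zero for this function, so no
    separate quotient by the ultrafilter is formed. *)
Definition ultra_rank : rank_fun (dprod S) :=
  fun m n M => ulim U (fun i => r (map_mx (dproj i) M)).

Lemma ultra_rank_bounded m n (M : 'M[dprod S]_(m, n)) :
  bounded_fam (fun i => r (map_mx (dproj i) M)).
Proof.
exists (m%:R * B) => i; rewrite ger0_norm ?(prk_ge0 (rP i)) //.
by apply: le_trans (prk_lerow (rP i) _) _; rewrite ler_wpM2l ?ler0n.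
Qed.

Lemma ultra_rank_prank : prank ultra_rank.
Proof.
have b := ultra_rank_bounded.
have blk i m1 n1 m2 n2 (M : 'M[dprod S]_(m1, n1)) (N : 'M[dprod S]_(m2, n2)) L :
   map_mx (dproj i) (block_mx M L 0 N) =
   block_mx (map_mx (dproj i) M) (map_mx (dproj i) L) 0 (map_mx (dproj i) N).
  by rewrite map_block_mx map_mx0.
have bD m1 n1 m2 n2 (M : 'M[dprod S]_(m1, n1)) (N : 'M[dprod S]_(m2, n2)) :
   bounded_fam (fun i => r (map_mx (dproj i) M) + r (map_mx (dproj i) N)).
  have [B1 h1] := b _ _ M; have [B2 h2] := b _ _ N; exists (B1 + B2) => i.
  by apply: le_trans (ler_normD _ _) _; apply: lerD.
split.
- move=> m n M; rewrite -(ulim_cst UU 0%R); apply: ulim_le => // [|i].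
    by exists 0 => i; rewrite normr0.
  exact: (prk_ge0 (rP i)).
- rewrite -[RHS](ulim_cst UU 0%R) /ultra_rank; congr (ulim U _).
  by apply: functional_extensionality_dep => i; rewrite map_mx0 (prk0 (rP i)).
- move=> m n p M1 M2; split; apply: ulim_le => // i; rewrite map_mxM.
    exact: (prk_mull (rP i)).
  exact: (prk_mulr (rP i)).
- move=> m1 n1 m2 n2 M1 M2; rewrite /ultra_rank -ulimD //; congr (ulim U _).
  by apply: functional_extensionality_dep => i; rewrite blk map_mx0 (prk_diag (rP i)).
- move=> m1 n1 m2 n2 M1 M2 M3; rewrite /ultra_rank -ulimD //.
  by apply: ulim_le => // i; rewrite blk (prk_trig (rP i)).
Qed.

End UltraRank.

Local Close Scope classical_set_scope.

Lemma inv_nat_lt (e : real) : 0 < e -> exists k : nat, k.+1%:R^-1 < e.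
Proof.
move=> e0; exists (Num.bound e^-1); rewrite invf_plt ?posrE ?ltr0n //.
by rewrite (lt_trans (archi_boundP _)) ?ltr_nat ?invr_ge0 ?ltW.
Qed.

(** The size is packed with the matrix so that one list can hold matrices of different formats. *)
Definition matr (A : Type) := {mn : nat * nat & 'M[A]_(mn.1, mn.2)}.
Definition to_matr (A : Type) m n (M : 'M[A]_(m, n)) : matr A :=
  @existT _ (fun mn : nat * nat => 'M[A]_(mn.1, mn.2)) (m, n) M.
Definition matr_mx (A : Type) (M : matr A) : 'M[A]_((projT1 M).1, (projT1 M).2) := projT2 M.
Definition rk_matr (A : pzRingType) (rk : rank_fun A) (M : matr A) : real := rk _ _ (matr_mx M).
Definition map_matr (A B : Type) (f : A -> B) (M : matr A) : matr B :=
  to_matr (map_mx f (matr_mx M)).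

Record model (A : Type) := Model
  { mring : pzRingType; mrank : rank_fun mring; mmap : A -> mring }.

(* [mmap w] is an arbitrary function: only on the finite set D, and only up to rank e,
   does it have to respect the ring operations. *)
Definition approx_by (A : pzRingType) (rk : rank_fun A) (D : seq A) (Ms : seq (matr A))
    (e : real) (w : model A) : Prop :=
  [/\ von_neumann_regular (mring w), prank (@mrank A w), rk1 (@mrank A w) (mmap w 1 - 1) <= e,
     (forall a b, a \in D -> b \in D ->
        rk1 (@mrank A w) (mmap w (a - b) - (mmap w a - mmap w b)) <= e /\
        rk1 (@mrank A w) (mmap w (a * b) - mmap w a * mmap w b) <= e)
   & (forall M, List.In M Ms ->
        `|rk_matr rk M - rk_matr (@mrank A w) (map_matr (mmap w) M)| <= e)].

Definition approx (A : pzRingType) (rk : rank_fun A) D Ms e : Prop :=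
  exists w, approx_by rk D Ms e w.

Section ApproxRegular.
Variables (A : pzRingType) (rk : rank_fun A).
Hypotheses (rkP : prank rk) (rk_1 : rk1 rk 1 = 1).
Hypothesis happ : forall D Ms (e : real), 0 < e -> approx rk D Ms e.

(** The index set consists of the requirements themselves: finitely many elements, finitely many
    matrices and a precision. The ultrafilter contains, for each requirement, the set [tail] of all
    stricter ones. *)
Let I := (seq A * seq (matr A) * nat)%type.
Let eps (i : I) : real := i.2.+1%:R^-1.

Lemma eps_gt0 i : 0 < eps i. Proof. by rewrite invr_gt0 ltr0n. Qed.
Lemma eps_le1 i : eps i <= 1.
Proof. by rewrite invf_le1 ?ltr0n // ler1n. Qed.

Local Open Scope classical_set_scope.

Definition tail (j : I) : set I :=
  [set i : I | {subset j.1.1 <= i.1.1} /\ (forall M, List.In M j.1.2 -> List.In M i.1.2)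
           /\ (j.2 <= i.2)%N].

Lemma tail_filter : ProperFilter [set P : set I | exists j, tail j `<=` P].
Proof.
split.
  by move=> [j /(_ j)]; apply; split=> //; split.
split.
- by exists ([::], [::], 0%N).
- move=> P Q [j hj] [k hk]; exists (j.1.1 ++ k.1.1, j.1.2 ++ k.1.2, maxn j.2 k.2).
  move=> i [h1 [h2 h3]]; split.
    apply: hj; split=> [a ha|]; first by apply: h1; rewrite mem_cat ha.
    split=> [M hM|]; last exact: leq_trans (leq_maxl _ _) h3.
    by apply: h2; apply/List.in_or_app; left.
  apply: hk; split=> [a ha|]; first by apply: h1; rewrite mem_cat ha orbT.
  split=> [M hM|]; last exact: leq_trans (leq_maxr _ _) h3.
  by apply: h2; apply/List.in_or_app; right.
- by move=> P Q PQ [j hj]; exists j; apply: subset_trans hj PQ.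
Qed.

Lemma approx_regular : regular_rank rk.
Proof.
have [U [UU hU]] := ultraFilterLemma tail_filter.
(* The identity matrix is always among the tested matrices, to bound the rank of 1 in the models
   uniformly. *)
have /choice [w phiP] : forall i : I, exists w, approx_by rk i.1.1
    (to_matr (1%:M : 'M[A]_1) :: i.1.2) (eps i) w.
  by move=> i; apply: happ; exact: eps_gt0.
pose S i := mring (w i).
pose r i : rank_fun (S i) := @mrank A (w i).
pose phi i : A -> S i := mmap (w i).
have rP i : prank (r i) by case: (phiP i).
have phi1 i : rk1 (@r i) (phi i 1 - 1) <= eps i by case: (phiP i).
(* The rank of [phi i 1] is at most 1 + eps and that of [phi i 1 - 1] at most eps, with eps at most
   1. *)
have rB i : rk1 (@r i) 1 <= 3.
  have [_ _ _ _ /(_ (to_matr 1%:M) (or_introl erefl))] := phiP i.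
  rewrite /rk_matr /= => /ler_normlP[h _].
  have {h} : rk1 (@r i) (phi i 1) <= 1 + eps i.
    rewrite -lerBlDl; apply: le_trans h; rewrite -rk_1 opprB lerB //.
    rewrite le_eqVlt; apply/orP; left; apply/eqP; congr (r i _ _ _).
    by apply/matrixP => k l; rewrite !mxE !ord1.
  have := rk1D (rP i) (phi i 1) (- (phi i 1 - 1)); rewrite opprB addrC subrK.
  by rewrite -opprB (rk1N (rP i)); have := phi1 i; have := eps_le1 i; lra.
have [Q [f [rq [rqP fs rqE f0]]]] := null_quotient (ultra_rank_prank UU rP rB).
pose PP := dprod S.
pose ph (a : A) : PP := fun i => phi i a.
(* Precision is part of the index, so a defect bounded by [eps] on a tail has limit rank zero. Every
   failure of the homomorphism laws is of this kind. *)
have eps0 (x : PP) (j : I) : (forall i, tail j i -> rk1 (@r i) (x i) <= eps i) -> f x = 0.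
  move=> hx; apply: f0; apply: ulim_eq => e e0.
  have [k hk] := inv_nat_lt e0.
  apply: hU; exists (j.1, maxn j.2 k) => i [h1 [h2 h3]] /=.
  rewrite subr0 ger0_norm ?(prk_ge0 (rP i)) //.
  have -> : map_mx (dproj i) x%:M = (x i)%:M :> 'M_1 by apply/matrixP => ? ?; rewrite !mxE !ord1.
  apply: le_trans (hx i _) _; first by split=> //; split=> //; apply: leq_trans h3; exact: leq_maxl.
  apply/ltW; apply: le_lt_trans hk; rewrite lef_pV2 ?posrE ?ltr0n // ler_nat ltnS.
  by apply: leq_trans h3; exact: leq_maxr.
pose psi (a : A) : Q := f (ph a).
have psiB : zmod_morphism psi.
  move=> a b; apply/eqP; rewrite -subr_eq0 /psi -!rmorphB /=; apply/eqP.
  apply: (eps0 _ ([:: a; b], [::], 0%N)) => i [h1 _].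
  have [_ _ _ h _] := phiP i.
  by have [] := h a b; rewrite ?h1 ?inE ?eqxx ?orbT.
have psiM : monoid_morphism psi.
  split=> [|a b].
    apply/eqP; rewrite -subr_eq0 /psi -(rmorph1 f) -!rmorphB /=; apply/eqP.
    by apply: (eps0 _ ([::], [::], 0%N)) => i _; exact: phi1.
  apply/eqP; rewrite -subr_eq0 /psi -rmorphM -!rmorphB /=; apply/eqP.
  apply: (eps0 _ ([:: a; b], [::], 0%N)) => i [h1 _].
  have [_ _ _ h _] := phiP i.
  by have [] := h a b; rewrite ?h1 ?inE ?eqxx ?orbT.
pose F1 := GRing.isZmodMorphism.Build A Q psi psiB.
pose F2 := GRing.isMonoidMorphism.Build A Q psi psiM.
pose F : {rmorphism A -> Q} := HB.pack psi F1 F2.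
have rE m n (M : 'M[A]_(m, n)) : rk M = rq _ _ (map_mx F M).
  have -> : map_mx F M = map_mx f (map_mx ph M) by apply/matrixP => ? ?; rewrite !mxE.
  rewrite rqE; symmetry; apply: ulim_eq => e e0.
  have [k hk] := inv_nat_lt e0.
  apply: hU; exists ([::], [:: to_matr M], k) => i [_ [h2 h3]] /=.
  have [_ _ _ _ h] := phiP i.
  have {}h := h (to_matr M) (or_intror (h2 _ (or_introl erefl))).
  rewrite distrC; apply: le_trans (_ : eps i <= e).
    move: h; rewrite /rk_matr /=; congr (`|_ - _| <= _); congr (r i _ _ _).
    by apply/matrixP => ? ?; rewrite !mxE.
  by apply/ltW; apply: le_lt_trans hk; rewrite lef_pV2 ?posrE ?ltr0n // ler_nat ltnS.
exists Q, rq, F; split; last split=> //.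
  apply: (vnr_surj fs); apply: vnr_dprod => i; by case: (phiP i).
apply/sylvester_prank; split=> //.
by rewrite -(map_mx1 F) -rE.
Qed.

End ApproxRegular.


(** * Constructions of rank functions *)

Lemma prank_pull (A B : pzRingType) (f : {rmorphism A -> B}) (r : rank_fun B) :
  prank r -> prank (fun m n (M : 'M[A]_(m, n)) => r _ _ (map_mx f M)).
Proof.
move=> rP; split.
- by move=> *; exact: prk_ge0.
- by rewrite map_mx0 prk0.
- by move=> *; rewrite map_mxM; split; [exact: prk_mull | exact: prk_mulr].
- by move=> *; rewrite map_block_mx !map_mx0 prk_diag.
- by move=> *; rewrite map_block_mx !map_mx0 prk_trig.
Qed.

Lemma prank_add (A : pzRingType) (r s : rank_fun A) :
  prank r -> prank s -> prank (fun m n M => r m n M + s m n M).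
Proof.
move=> rP sP; split.
- by move=> *; rewrite addr_ge0 ?prk_ge0.
- by rewrite !prk0 // addr0.
- by move=> *; split; apply: lerD; rewrite ?(prk_mull rP) ?(prk_mull sP) ?(prk_mulr rP) ?(prk_mulr sP).
- by move=> *; rewrite !prk_diag // addrACA.
- by move=> *; rewrite addrACA lerD ?(prk_trig rP) ?(prk_trig sP).
Qed.

Lemma prank_scale (A : pzRingType) (c : real) (r : rank_fun A) :
  0 <= c -> prank r -> prank (fun m n M => c * r m n M).
Proof.
move=> c0 rP; split.
- by move=> *; rewrite mulr_ge0 ?prk_ge0.
- by rewrite !prk0 // mulr0.
- by move=> *; split; apply: ler_wpM2l => //; rewrite ?(prk_mull rP) ?(prk_mulr rP).
- by move=> *; rewrite !prk_diag // mulrDr.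
- by move=> *; rewrite -mulrDr; apply: ler_wpM2l => //; rewrite ?(prk_trig rP).
Qed.

Lemma prank_zero (A : pzRingType) : prank (fun m n (M : 'M[A]_(m, n)) => 0).
Proof. by split=> *; rewrite ?addr0. Qed.

Section Flatten.
Variable p : nat.

Definition unidx m (k : 'I_(m * p)) : 'I_m * 'I_p :=
  enum_val (cast_ord (esym (mxvec_cast m p)) k).

Lemma mxvec_indexK m (i : 'I_m) (a : 'I_p) : unidx (mxvec_index i a) = (i, a).
Proof. by rewrite /unidx /mxvec_index cast_ordK enum_rankK. Qed.

Definition flat (A : Type) m n (M : 'M['M[A]_p]_(m, n)) : 'M[A]_(m * p, n * p) :=
  \matrix_(k, l) M (unidx k).1 (unidx l).1 (unidx k).2 (unidx l).2.

Lemma flatE (A : Type) m n (M : 'M['M[A]_p]_(m, n)) i a j b :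
  flat M (mxvec_index i a) (mxvec_index j b) = M i j a b.
Proof. by rewrite mxE !mxvec_indexK. Qed.

Definition unflat (A : Type) m n (M : 'M[A]_(m * p, n * p)) : 'M['M[A]_p]_(m, n) :=
  \matrix_(i, j) \matrix_(a, b) M (mxvec_index i a) (mxvec_index j b).

Lemma unflatK (A : Type) m n (M : 'M[A]_(m * p, n * p)) : flat (unflat M) = M.
Proof.
apply/matrixP => k l; case/mxvec_indexP: k => i a; case/mxvec_indexP: l => j b.
by rewrite flatE !mxE.
Qed.

Lemma flatK (A : Type) m n (M : 'M['M[A]_p]_(m, n)) : unflat (flat M) = M.
Proof. by apply/matrixP => i j; apply/matrixP => a b; rewrite !mxE !mxvec_indexK. Qed.

Lemma sum_mxvec_index (V : nmodType) n (F : 'I_(n * p) -> V) :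
  \sum_k F k = \sum_i \sum_a F (mxvec_index i a).
Proof.
rewrite (reindex _ (curry_mxvec_bij n p)) pair_big /=.
by apply: eq_bigr => -[i a].
Qed.

Variable A : pzRingType.

Lemma flatM m n q (M : 'M['M[A]_p]_(m, n)) (N : 'M['M[A]_p]_(n, q)) :
  flat (M *m N) = flat M *m flat N.
Proof.
apply/matrixP => k l; case/mxvec_indexP: k => i a; case/mxvec_indexP: l => j b.
rewrite flatE !mxE summxE sum_mxvec_index; apply: eq_bigr => c _.
by rewrite mxE; apply: eq_bigr => d _; rewrite !flatE.
Qed.

Lemma flat0 m n : flat (0 : 'M['M[A]_p]_(m, n)) = 0.
Proof. by apply/matrixP => k l; rewrite !mxE. Qed.

Variable rk : rank_fun A.
Hypothesis rkP : prank rk.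

Let blk_in m1 m2 (k : 'I_((m1 + m2) * p)) : 'I_(m1 * p + m2 * p) :=
  match split (unidx k).1 with
  | inl i => lshift _ (mxvec_index i (unidx k).2)
  | inr i => rshift _ (mxvec_index i (unidx k).2)
  end.
Let blk_out m1 m2 (k : 'I_(m1 * p + m2 * p)) : 'I_((m1 + m2) * p) :=
  match split k with
  | inl i => mxvec_index (lshift _ (unidx i).1) (unidx i).2
  | inr i => mxvec_index (rshift _ (unidx i).1) (unidx i).2
  end.

Lemma flat_block m1 m2 n1 n2 (M1 : 'M['M[A]_p]_(m1, n1)) (M2 : 'M_(m1, n2))
   (M3 : 'M_(m2, n1)) (M4 : 'M_(m2, n2)) :
  rk (flat (block_mx M1 M2 M3 M4)) =
  rk (block_mx (flat M1) (flat M2) (flat M3) (flat M4)).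
Proof.
apply: (prk_reindex rkP (f := @blk_in _ _) (g := @blk_in _ _)
  (f' := @blk_out _ _) (g' := @blk_out _ _)) => k l.
  case/mxvec_indexP: k => i a; case/mxvec_indexP: l => j b.
  rewrite flatE /blk_in !mxvec_indexK /=.
  case: (split_ordP i) => i' ->; case: (split_ordP j) => j' ->.
  - by rewrite !block_mxEul flatE.
  - by rewrite !block_mxEur flatE.
  - by rewrite !block_mxEdl flatE.
  - by rewrite !block_mxEdr flatE.
rewrite /blk_out.
case: (split_ordP k) => k' ->; case: (split_ordP l) => l' ->; rewrite flatE;
  case/mxvec_indexP: k' => i a; case/mxvec_indexP: l' => j b; rewrite !mxvec_indexK.
- by rewrite !block_mxEul flatE.
- by rewrite !block_mxEur flatE.
- by rewrite !block_mxEdl flatE.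
- by rewrite !block_mxEdr flatE.
Qed.

Lemma prank_matrix : prank (fun m n (M : 'M['M[A]_p]_(m, n)) => rk (flat M)).
Proof.
split.
- by move=> *; exact: prk_ge0.
- by rewrite flat0 prk0.
- by move=> *; rewrite flatM; split; [exact: prk_mull | exact: prk_mulr].
- by move=> *; rewrite flat_block !flat0 prk_diag.
- by move=> *; rewrite flat_block !flat0 prk_trig.
Qed.

End Flatten.

Definition field_rank (F : fieldType) : rank_fun F := fun m n M => (\rank M)%:R.

(** For the triangular axiom, both diagonal blocks are compressed to identity matrices of the size
    of their ranks; the whole matrix then becomes unitriangular, hence of full rank. *)
Lemma field_rank_prank (F : fieldType) : prank (@field_rank F).
Proof.
rewrite /field_rank; split.
- by move=> *; rewrite ler0n.
- by rewrite mxrank0.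
- by move=> *; rewrite !ler_nat mxrankM_maxl mxrankM_maxr.
- by move=> *; rewrite rank_diag_block_mx natrD.
move=> m1 n1 m2 n2 M1 M2 M3; rewrite -natrD ler_nat.
have ex m n (M : 'M[F]_(m, n)) : exists (P : 'M_(\rank M, m)) (Q : 'M_(n, \rank M)),
    P *m M *m Q = 1%:M.
  exists (pid_mx (\rank M) *m invmx (col_ebase M)).
  exists (invmx (row_ebase M) *m pid_mx (\rank M)).
  have h L : col_ebase M *m pid_mx (\rank M) *m row_ebase M = L ->
      invmx (col_ebase M) *m L *m invmx (row_ebase M) = pid_mx (\rank M).
    by move=> <-; rewrite -!mulmxA mulKmx ?col_ebase_unit // mulmxV ?row_ebase_unit // mulmx1.
  rewrite -!mulmxA [M *m _]mulmxA [invmx _ *m (M *m _ *m _)]mulmxA [invmx _ *m _]mulmxA.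
  rewrite (h _ (mulmx_ebase M)).
  by rewrite mulmxA !pid_mx_id ?pid_mx_1 ?rank_leq_row ?rank_leq_col.
have [P1 [Q1 h1]] := ex _ _ M1; have [P2 [Q2 h2]] := ex _ _ M2.
set B := block_mx M1 M3 0 M2.
have e : block_mx P1 0 0 P2 *m B *m block_mx Q1 0 0 Q2 =
   block_mx 1%:M (P1 *m M3 *m Q2) 0 1%:M.
  by rewrite !mulmx_block !(mulmx0, mul0mx, addr0, add0r) h1 h2.
have u : block_mx 1%:M (P1 *m M3 *m Q2) 0 1%:M \in unitmx.
  by rewrite unitmxE det_ublock !det1 mulr1 unitr1.
rewrite -[leqLHS](mxrank_unit u) -e.
by apply: leq_trans (mxrankM_maxl _ _) (mxrankM_maxr _ _).
Qed.

Lemma vnr_matrix (F : fieldType) n : von_neumann_regular 'M[F]_n.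
Proof. by move=> M; exists (pinvmx M); rewrite -!mulmxE mulmxKpV. Qed.

Lemma vnr_matrix2 (F : fieldType) n p : von_neumann_regular 'M['M[F]_n]_p.
Proof.
move=> M; have [N hN] := @vnr_matrix F (p * n) (flat M).
exists (unflat N); apply: (can_inj (@flatK n F p p)).
by rewrite -!mulmxE !flatM unflatK.
Qed.

Lemma vnr_prod (S T : pzRingType) :
  von_neumann_regular S -> von_neumann_regular T -> von_neumann_regular (S * T)%type.
Proof.
move=> hS hT [x y]; have [x' hx] := hS x; have [y' hy] := hT y.
by exists (x', y'); congr (_, _).
Qed.

Section ApproxClosure.
Variable A : pzRingType.
Implicit Types (rk : rank_fun A) (D : seq A) (Ms : seq (matr A)) (e : real).

(** The two models run side by side on the product ring, and the errors add. *)
Lemma approx_add ra rb D Ms e1 e2 :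
  approx ra D Ms e1 -> approx rb D Ms e2 ->
  approx (fun m n M => ra m n M + rb m n M) D Ms (e1 + e2).
Proof.
move=> [[S r f] [/= hS rP f1 fD fM]] [[T s g] [/= hT sP g1 gD gM]].
pose rs : rank_fun (S * T)%type := fun m n M => r _ _ (map_mx fst M) + s _ _ (map_mx snd M).
have rs1 x : rk1 rs x = rk1 r x.1 + rk1 s x.2.
  by rewrite /rk1 /rs !map_scalar_mx.
exists (Model rs (fun a => (f a, g a))); split=> /=.
- exact: vnr_prod.
- by apply: prank_add; apply: prank_pull.
- by rewrite rs1 lerD.
- move=> a b Da Db; have [h1 h2] := fD a b Da Db; have [h3 h4] := gD a b Da Db.
  by rewrite !rs1 //= !lerD.
- move=> M hM; have h1 := fM M hM; have h2 := gM M hM.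
  have -> : rk_matr rs (map_matr (fun a => (f a, g a)) M) =
     rk_matr r (map_matr f M) + rk_matr s (map_matr g M).
    rewrite /rk_matr /rs /= -!map_mx_comp; congr (_ + _);
      by [congr (r _ _ _) | congr (s _ _ _)].
  by rewrite /rk_matr opprD addrACA; apply: le_trans (ler_normD _ _) (lerD h1 h2).
Qed.

Lemma approx_eq rk rk' D Ms e :
  (forall M, List.In M Ms -> rk_matr rk M = rk_matr rk' M) ->
  approx rk D Ms e -> approx rk' D Ms e.
Proof.
move=> h [w [h1 h2 h3 h4 h5]]; exists w; split=> // M hM.
by rewrite -h //; exact: h5.
Qed.

Lemma approx_zero D Ms : approx (fun m n M => 0) D Ms 0.
Proof.
(* The model is the zero ring, realised as 0 x 0 matrices. *)
exists (Model (fun m n (M : 'M['M[rat]_0]_(m, n)) => 0) (fun=> 0)); split=> //=.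
- exact: vnr_matrix.
- exact: prank_zero.
- by move=> M hM; rewrite /rk_matr subrr normr0.
Qed.

End ApproxClosure.


(** * Rank functions on polynomial rings *)

Section Diagonalisation.
Variable K : fieldType.
Local Notation R := {poly K}.

Definition eqrank m n m' n' (M : 'M[R]_(m, n)) (N : 'M[R]_(m', n')) :=
  forall s : rank_fun R, prank s -> s _ _ M = s _ _ N.

(* Says that M is equivalent to a diagonal matrix, without the casts. *)
Definition diag_rank m n (M : 'M[R]_(m, n)) := exists ds : seq R,
  forall s : rank_fun R, prank s -> s _ _ M = \sum_(d <- ds) rk1 s d.

Lemma eqrank_mul m n (M N : 'M[R]_(m, n)) P Q P' Q' :
  N = P *m M *m Q -> M = P' *m N *m Q' -> eqrank M N.
Proof.
move=> e1 e2 s sP; apply/eqP; rewrite eq_le; apply/andP.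
by split; [rewrite {1}e2 | rewrite {1}e1]; exact: prk_mul3.
Qed.

Lemma eqrank_diag m n m' n' (M : 'M[R]_(m, n)) (N : 'M[R]_(m', n')) :
  eqrank M N -> diag_rank N -> diag_rank M.
Proof. by move=> e [ds h]; exists ds => s sP; rewrite e // h. Qed.

Lemma eqrank_tperm m n (M : 'M[R]_(m, n)) i i' j j' :
  eqrank M (mxsub (tperm i i') (tperm j j') M).
Proof.
move=> s sP; apply: (prk_reindex sP (f := tperm i i') (g := tperm j j')
  (f' := tperm i i') (g' := tperm j j')) => k l; rewrite ?mxE //.
by rewrite !tpermK.
Qed.

Lemma elementaryK n (E : 'M[R]_n) q : E *m E = 0 ->
  (1%:M - q *: E) *m (1%:M + q *: E) = 1%:M /\ (1%:M + q *: E) *m (1%:M - q *: E) = 1%:M.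
Proof.
move=> EE; split.
  rewrite mulmxDr mulmx1 mulmxBl mul1mx -scalemxAr -scalemxAl EE !scaler0 subr0.
  by rewrite subrK.
rewrite mulmxBr mulmx1 mulmxDl mul1mx -scalemxAr -scalemxAl EE !scaler0 addr0.
by rewrite addrK.
Qed.

(** Euclidean division by the corner entry: an entry of the first row or column not divisible by it
    leaves a nonzero remainder of smaller size, which is swapped into the corner. Once all are
    divisible, the first row and column are cleared. *)
Lemma diag_rank_step m n : (forall N : 'M[R]_(m, n), diag_rank N) ->
  forall k (M : 'M[R]_(1 + m, 1 + n)), M 0 0 != 0 -> (size (M 0%R 0%R) <= k)%N ->
  diag_rank M.
Proof.
move=> IH; elim=> [|k IHk] M nz sz.
  by move: nz; rewrite -size_poly_eq0 -leqn0 sz.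
have small (r : R) : (size r < size (M 0%R 0%R))%N -> (size r <= k)%N.
  by move=> h; rewrite -ltnS (leq_trans h).
have [/forallP hr|/forallPn [j hj]] := boolP [forall j, M 0 0 %| M 0 j]; last first.
  pose q := M 0 j %/ M 0 0; pose E := delta_mx 0 j : 'M[R]_(1 + n).
  have j0 : j != 0 by apply: contraNneq hj => ->; rewrite dvdpp.
  have EE : E *m E = 0 by rewrite mul_delta_mx_0.
  pose N := M *m (1%:M - q *: E).
  have Nj : N 0 j = M 0 j %% M 0 0.
    rewrite /N mulmxBr mulmx1 -scalemxAr !mxE (bigD1 0) //= big1 => [|i i0].
      by rewrite !mxE !eqxx mulr1 addr0 {1}(divp_eq (M 0 j) (M 0 0)) -/q addrC addKr.
    by rewrite !mxE (negPf i0) mulr0.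
  apply: (@eqrank_diag _ _ _ _ _ N).
    apply: (@eqrank_mul _ _ _ _ 1%:M (1%:M - q *: E) 1%:M (1%:M + q *: E)).
      by rewrite mul1mx.
    by rewrite mul1mx -mulmxA (elementaryK q EE).1 mulmx1.
  apply: (eqrank_diag (@eqrank_tperm _ _ N 0 0 0 j)).
  by apply: IHk; rewrite mxE !tpermL Nj; [exact: hj | apply: small; rewrite ltn_modp].
have [/forallP hc|/forallPn [i hi]] := boolP [forall i, M 0 0 %| M i 0]; last first.
  pose q := M i 0 %/ M 0 0; pose E := delta_mx i 0 : 'M[R]_(1 + m).
  have i0 : i != 0 by apply: contraNneq hi => ->; rewrite dvdpp.
  have EE : E *m E = 0 by rewrite mul_delta_mx_0 // eq_sym.
  pose N := (1%:M - q *: E) *m M.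
  have Nj : N i 0 = M i 0 %% M 0 0.
    rewrite /N mulmxBl mul1mx -scalemxAl !mxE (bigD1 0) //= big1 => [|j j0].
      by rewrite !mxE !eqxx mul1r addr0 {1}(divp_eq (M i 0) (M 0 0)) -/q addrC addKr.
    by rewrite !mxE (negPf j0) andbF mul0r.
  apply: (@eqrank_diag _ _ _ _ _ N).
    apply: (@eqrank_mul _ _ _ _ (1%:M - q *: E) 1%:M (1%:M + q *: E) 1%:M).
      by rewrite mulmx1.
    by rewrite mulmx1 mulmxA (elementaryK q EE).2 mul1mx.
  apply: (eqrank_diag (@eqrank_tperm _ _ N 0 i 0 0)).
  by apply: IHk; rewrite mxE !tpermL Nj; [exact: hi | apply: small; rewrite ltn_modp].
pose a := M 0 0; pose u := \row_j (ursubmx M 0 j %/ a); pose v := \col_i (dlsubmx M i 0 %/ a).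
have Eur : ursubmx M = a *: u.
  apply/rowP => j; rewrite !mxE mulrC divpK //.
  suff -> : M (lshift m 0) (rshift 1 j) = M 0 (rshift 1 j) by exact: hr.
  by congr (M _ _); apply: val_inj.
have Edl : dlsubmx M = a *: v.
  apply/colP => i; rewrite !mxE mulrC divpK //.
  suff -> : M (rshift 1 i) (lshift n 0) = M (rshift 1 i) 0 by exact: hc.
  by congr (M _ _); apply: val_inj.
have Eul : ulsubmx M = a%:M.
  apply/matrixP => i j; rewrite !mxE !ord1 eqxx mulr1n.
  by congr (M _ _); apply: val_inj.
have [ds hds] := IH (drsubmx M - a *: (v *m u)).
exists (a :: ds) => s sP; rewrite big_cons -hds // -prk_diag //.
rewrite -[M in LHS]submxK Eul Eur Edl; set B := drsubmx M.
apply: (@eqrank_mul _ _ _ _ (block_mx 1%:M 0 (- v) 1%:M) (block_mx 1%:M (- u) 0 1%:M)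
  (block_mx 1%:M 0 v 1%:M) (block_mx 1%:M u 0 1%:M)) => //;
rewrite !mulmx_block !(mulmx0, mul0mx, mulmx1, mul1mx, addr0, add0r).
  rewrite mul_scalar_mx mul_mx_scalar scalerN addNr scalerN addNr mul0mx add0r.
  by rewrite mulNmx -scalemxAr addrC.
by rewrite mul_scalar_mx mul_mx_scalar -scalemxAl addrC subrK.
Qed.

Lemma diag_rank_all m n (M : 'M[R]_(m, n)) : diag_rank M.
Proof.
elim: m n M => [|m IH] n M.
  by exists [::] => s sP; rewrite big_nil [M]flatmx0 prk0.
case: n M => [|n] M.
  by exists [::] => s sP; rewrite big_nil [M]thinmx0 prk0.
have [->|/eqP/matrix0Pn [i [j nz]]] := pselect (M = 0).
  by exists [::] => s sP; rewrite big_nil prk0.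
apply: (eqrank_diag (@eqrank_tperm _ _ M 0 i 0 j)).
by apply: (diag_rank_step (IH n) _ (leqnn _)); rewrite mxE !tpermL.
Qed.

End Diagonalisation.

Section PolyRank.
Variables (K : fieldType) (s : rank_fun {poly K}).
Hypothesis sP : prank s.
Implicit Types a b c : {poly K}.

(** The rank of the module K[X]/(a); unlike [rk1] it is additive on coprime products. *)
Definition corank a : real := rk1 s 1 - rk1 s a.

(** Bezout writes diag(1, a b) as P diag(a, b) Q, a matrix form of the Chinese remainder theorem.
    The other inequality is Frobenius with middle factor 1. *)
Lemma corank_coprime a b : coprimep a b -> corank (a * b) = corank a + corank b.
Proof.
move=> /Bezout_eq1_coprimepP [[u v] /= e].
have le1 : rk1 s a + rk1 s b <= rk1 s 1 + rk1 s (a * b).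
  have := frobenius sP (a%:M : 'M_1) 1%:M (b%:M : 'M_1).
  by rewrite mulmx1 mul1mx -scalar_mxM.
have le2 : rk1 s 1 + rk1 s (a * b) <= rk1 s a + rk1 s b.
  rewrite /rk1 -!prk_diag //.
  have -> : block_mx 1%:M 0 0 (a * b)%:M =
     block_mx 1%:M 1%:M (- (v * b))%:M (u * a)%:M *m
     block_mx (a%:M : 'M_1) 0 0 (b%:M : 'M_1) *m
     block_mx u%:M (- b)%:M v%:M (a%:M : 'M_1).
    rewrite !mulmx_block !(mulmx0, mul0mx, mulmx1, mul1mx, addr0, add0r).
    rewrite -!scalar_mxM -!raddfD /=; congr block_mx.
    - by rewrite mulrC [b * v]mulrC e.
    - by rewrite -(raddf0 (@scalar_mx {poly K} 1)); congr (_%:M); ring.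
    - by rewrite -(raddf0 (@scalar_mx {poly K} 1)); congr (_%:M); ring.
    - congr (_%:M); transitivity ((u * a + v * b) * (a * b)); last by ring.
      by rewrite e mul1r.
  exact: prk_mul3.
by rewrite /corank; lra.
Qed.

Lemma corank1 : corank 1 = 0. Proof. exact: subrr. Qed.

Lemma corank_le a b : corank a <= corank (a * b).
Proof. by rewrite lerD2l lerN2 rk1_mull. Qed.

(** Frobenius for the product a b a. With a = p and b = p^k it makes the corank of p^k concave in
    k. *)
Lemma corank_convex a b : corank b + corank (a * a * b) <= corank (a * b) *+ 2.
Proof.
have := frobenius sP (a%:M : 'M_1) b%:M (a%:M : 'M_1).
rewrite -!scalar_mxM -/(rk1 s _) -/(rk1 s b) -/(rk1 s (b * a)) -/(rk1 s (a * b * a)).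
have -> : a * b * a = a * a * b by ring.
by rewrite [b * a]mulrC /corank mulr2n; lra.
Qed.

Lemma corank_const (k : K) a : k != 0 -> corank (k%:P * a) = corank a.
Proof.
move=> k0; apply/eqP; rewrite eq_le mulrC corank_le andbT.
rewrite -{2}[a]mulr1 -(@polyC1 K) -(divff k0) polyCM mulrA; exact: corank_le.
Qed.

Lemma corank_unit a b : corank a = 0 -> corank (a * b) = corank b.
Proof.
move=> a0; apply/eqP; rewrite eq_le [in X in _ && X]mulrC corank_le andbT.
have := frobenius sP (a%:M : 'M_1) 1%:M (b%:M : 'M_1).
rewrite mulmx1 mul1mx -scalar_mxM -/(rk1 s _) -/(rk1 s b) -/(rk1 s 1) -/(rk1 s (a * b)).
by move: a0; rewrite /corank; lra.
Qed.

Lemma corank_exp_unit a k : corank a = 0 -> corank (a ^+ k) = 0.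
Proof.
by move=> a0; elim: k => [|k IH]; rewrite ?expr0 ?corank1 // exprS corank_unit.
Qed.

End PolyRank.

Section RepSum.
Variable K : fieldType.

(** The field [F] varies because one term lives over the fraction field of K[X], the others on
    quotients K[X]/(p^j). The variable stands for t^p, so [psi 'X] must be invertible for a
    representation to extend to negative powers of t. *)
Inductive rep_sum : rank_fun {poly K} -> Prop :=
| RepSum0 : rep_sum (fun m n M => 0)
| RepSumS (F : fieldType) (j : nat) (psi : {rmorphism {poly K} -> 'M[F]_j}) (c : real) s :
    psi 'X \in unitmx -> 0 <= c -> rep_sum s ->
    rep_sum (fun m n M => c * field_rank (flat (map_mx psi M)) + s m n M).

Lemma rep_sum_prank s : rep_sum s -> prank s.
Proof.
elim=> [|F j psi c {}s _ c0 _ IH]; first exact: prank_zero.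
apply: prank_add IH; apply: prank_scale => //.
exact: (prank_pull psi (prank_matrix j (@field_rank_prank F))).
Qed.

Lemma rep_sumD s1 s2 : rep_sum s1 -> rep_sum s2 ->
  exists2 s, rep_sum s & forall m n (M : 'M_(m, n)), s _ _ M = s1 _ _ M + s2 _ _ M.
Proof.
move=> h1 h2; elim: h1 => [|F j psi c s psiX c0 _ [s' hs' es']].
  by exists s2 => // *; rewrite add0r.
eexists; first by apply: (RepSumS psiX c0 hs').
by move=> * /=; rewrite es' addrA.
Qed.

Lemma flat_scalar (A : pzRingType) (rk : rank_fun A) p (a : 'M[A]_p) : prank rk ->
  rk _ _ (flat (a%:M : 'M_1)) = rk _ _ a.
Proof.
move=> rkP; apply: (prk_reindex rkP (f := fun k => (unidx k).2) (g := fun k => (unidx k).2)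
  (f' := mxvec_index 0) (g' := mxvec_index 0)) => i j.
  by rewrite !mxE !ord1.
by rewrite flatE !mxE.
Qed.

End RepSum.


(** * The action of K[X] on the quotient K[X]/(m) *)

Section CyclicRep.
Variables (K : fieldType) (m : {poly K}) (n' : nat).
Hypothesis size_m : size m = n'.+2.
Local Notation n := n'.+1.

Definition mulX_mod (u : 'rV[K]_n) : 'rV[K]_n := poly_rV ((rVpoly u * 'X) %% m).

Fact mulX_mod_linear : linear mulX_mod.
Proof.
by move=> c u v; rewrite /mulX_mod !linearP /= mulrDl -scalerAl modpD modpZl linearP.
Qed.
HB.instance Definition _ :=
  GRing.isLinear.Build K 'rV[K]_n 'rV[K]_n *:%R mulX_mod mulX_mod_linear.

Definition cyclic_mx : 'M[K]_n := lin1_mx mulX_mod.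

Lemma mod_poly_rV g : rVpoly (poly_rV (g %% m) : 'rV[K]_n) = g %% m.
Proof.
by rewrite poly_rV_K // -ltnS -size_m ltn_modp -size_poly_eq0 size_m.
Qed.

Lemma mul_cyclic_mx g u : u *m horner_mx cyclic_mx g = poly_rV ((rVpoly u * g) %% m).
Proof.
elim/poly_ind: g => [|g c IH]; first by rewrite rmorph0 !mulr0 mulmx0 mod0p linear0.
rewrite rmorphD rmorphM /= horner_mx_X horner_mx_C mulmxDr -mulmxE mulmxA IH.
rewrite mul_rV_lin1 /= /mulX_mod mod_poly_rV mul_mx_scalar mulrDr modpD linearD /=.
congr (_ + _); first by congr poly_rV; rewrite mulrC modp_mul mulrA [_ * (_ * g)]mulrC.
rewrite mulrC mul_polyC modpZl linearZ /= modp_small ?rVpolyK //.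
by rewrite size_m ltnS size_poly.
Qed.

(** Multiplication by g is injective on polynomials of degree less than n - deg g, the image of [Z],
    because the products have degree below deg m and are not reduced. *)
Lemma rank_cyclic_ge g : g %| m -> (n - (size g).-1 <= \rank (horner_mx cyclic_mx g))%N.
Proof.
move=> gm; set k := (n - _)%N.
have g0 : g != 0 by apply: contraTneq gm => ->; rewrite dvd0p -size_poly_eq0 size_m.
have lekn : (k <= n)%N by exact: leq_subr.
pose Z : 'M[K]_(k, n) := pid_mx k.
have rZ (v : 'rV_k) : rVpoly (v *m Z) = rVpoly v.
  apply/polyP => i; rewrite !coef_rVpoly.
  case: insubP => [i' _ ei|ni]; case: insubP => [i2 _ ei2|ni2] //.
  - rewrite mxE (bigD1 i2) //= mxE ei ei2 eqxx -ei2 ltn_ord mulr1 big1 ?addr0 // => l li.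
    by rewrite mxE ei -ei2 val_eqE (negPf li) mulr0.
  - rewrite mxE big1 // => l _; rewrite mxE; case: eqP => [el|]; last by rewrite mulr0.
    by move: ni2; rewrite -ei /= -el ltn_ord.
  - by move: ni; rewrite -ei2 (leq_trans (ltn_ord i2)).
have rf : row_free (Z *m horner_mx cyclic_mx g).
  apply/row_freeP/row_freeP/inj_row_free => v.
  rewrite mulmxA mul_cyclic_mx rZ => h.
  have sz : (size (rVpoly v * g)%R < size m)%N.
    rewrite size_m ltnS; apply: leq_trans (size_polyMleq _ _) _.
    have sv : (size (rVpoly v) <= k)%N by exact: size_poly.
    have gt0 : (0 < size g)%N by rewrite size_poly_gt0.
    have gle : (size g <= n.+1)%N by rewrite -size_m dvdp_leq // -size_poly_eq0 size_m.
    have kE : k = (n - (size g).-1)%N by [].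
    by move: sv gt0 gle kE; move: (size g) (size (rVpoly v)) => a b; lia.
  have := mod_poly_rV (rVpoly v * g); rewrite h linear0 modp_small // => /esym/eqP.
  by rewrite mulf_eq0 (negPf g0) orbF => /eqP e; rewrite -[v]rVpolyK e linear0.
by rewrite -(eqP rf); exact: mxrankM_maxr.
Qed.

Lemma horner_cyclic0 : horner_mx cyclic_mx m = 0.
Proof.
apply/row_matrixP => i; rewrite rowE mul_cyclic_mx modp_mull linear0.
by rewrite row0.
Qed.

(** With m = g' g acting as zero, Sylvester's inequality bounds the ranks of g and g' together by n,
    which is already the sum of the two lower bounds. *)
Lemma rank_cyclic g : g %| m -> \rank (horner_mx cyclic_mx g) = (n - (size g).-1)%N.
Proof.
move=> gm; apply/eqP; rewrite eqn_leq rank_cyclic_ge // andbT.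
have e := divpK gm; set g' := m %/ g in e.
have nz : g' * g != 0 by rewrite e -size_poly_eq0 size_m.
have := nz; rewrite mulf_eq0 negb_or => /andP[g'0 g0].
have := rank_cyclic_ge (_ : g' %| m); rewrite divp_dvd // => /(_ isT) h.
have := mxrank_mul_min (horner_mx cyclic_mx g') (horner_mx cyclic_mx g).
rewrite mulmxE -rmorphM /= e horner_cyclic0 mxrank0 leqn0 subn_eq0.
have := size_mul g'0 g0; rewrite e size_m.
move: h; have : (0 < size g)%N by rewrite size_poly_gt0.
have : (0 < size g')%N by rewrite size_poly_gt0.
by move: (\rank _) (\rank _) (size g) (size g') => a b c d; lia.
Qed.

Lemma unit_cyclic g : coprimep g m -> horner_mx cyclic_mx g \in unitmx.
Proof.
move=> /Bezout_eq1_coprimepP [[u v] /= e].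
have : horner_mx cyclic_mx (u * g + v * m) = 1 by rewrite e rmorph1.
rewrite rmorphD !rmorphM /= horner_cyclic0 mulr0 addr0.
by move=> /mulmx1_unit [].
Qed.

End CyclicRep.

(** * Factorisation into monic irreducible polynomials *)

Section Factor.
Variable K : fieldType.
Implicit Types d p : {poly K}.

Definition prime_poly p := irreducible_poly p /\ p \is monic.

Lemma prime_factorisation d : d != 0 -> exists (c : K) (s : seq {poly K}),
  [/\ c != 0, (forall p, p \in s -> prime_poly p) & d = c%:P * \prod_(p <- s) p].
Proof.
have [k] := ubnP (size d); elim: k d => // k IH d; rewrite ltnS => sz d0.
have lc0 : lead_coef d != 0 by rewrite lead_coef_eq0.
have [d1|d1] := leqP (size d) 1.
  exists d`_0, [::]; split=> //; last by rewrite big_nil mulr1 {1}(size1_polyC d1).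
  by apply: contraNneq d0 => e; rewrite (size1_polyC d1) e.
have [dirr|] := pselect (forall q : {poly K}, size q != 1 -> q %| d -> q %= d).
  exists (lead_coef d), [:: (lead_coef d)^-1 *: d]; split=> //.
    move=> p; rewrite inE => /eqP ->.
    have eqd : (lead_coef d)^-1 *: d %= d by apply: eqp_scale; rewrite invr_eq0.
    split; last by rewrite monicE lead_coefZ mulVf.
    split; first by rewrite (eqp_size eqd).
    move=> q q1; rewrite (eqp_dvdr _ eqd) => qd.
    by rewrite (eqp_rtrans eqd); exact: dirr.
  by rewrite big_seq1 -mul_polyC mulrA -polyCM divff // mul1r.
move=> /existsNP [q /not_implyP [q1 /not_implyP [qd /negP nq]]].
have e := divpK qd; set q' := d %/ q in e.
have := d0; rewrite -e mulf_eq0 negb_or => /andP[q'0 q0].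
have sm := size_mul q'0 q0; rewrite e in sm.
have q'1 : size q' != 1%N.
  apply: contra nq => /eqP q'1; rewrite -e eqp_sym.
  have /size_poly1P[c c0 ->] : size q' == 1%N by rewrite q'1.
  by rewrite mul_polyC eqp_scale.
have : (0 < size q)%N by rewrite size_poly_gt0.
have : (0 < size q')%N by rewrite size_poly_gt0.
move: q1 q'1 => /eqP q1 /eqP q'1 gt1 gt2.
have [lt1 lt2] : (size q < k)%N /\ (size q' < k)%N.
  move: q1 q'1 gt1 gt2 sm sz; move: (size q) (size q') (size d) => a b c.
  by clear; lia.
have [//|//|c1 [s1 [c10 h1 e1]]] := IH q.
have [//|//|c2 [s2 [c20 h2 e2]]] := IH q'.
exists (c2 * c1), (s2 ++ s1); split.
- by rewrite mulf_neq0.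
- by move=> p; rewrite mem_cat => /orP[/h2|/h1].
- by rewrite big_cat /= polyCM mulrACA -e1 -e2.
Qed.

Lemma prime_poly_coprime p q : prime_poly p -> prime_poly q -> p != q -> coprimep p q.
Proof.
move=> [[_ pirr] pm] [[_ qirr] qm] pq; apply: contraNT pq => nc.
rewrite -eqp_monic //.
have gp := pirr _ nc (dvdp_gcdl p q); have gq := qirr _ nc (dvdp_gcdr p q).
by rewrite (eqp_trans _ gq) // eqp_sym.
Qed.

End Factor.


(** * Rank functions of K[X] as combinations of representations *)

Section Decomposition.
Variable K : fieldType.
Implicit Types p g : {poly K}.

Lemma rk1_rep (F : fieldType) j (psi : {rmorphism {poly K} -> 'M[F]_j}) c s g :
  rk1 (fun m n M => c * field_rank (flat (map_mx psi M)) + s m n M) g =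
  c * (\rank (psi g))%:R + rk1 s g.
Proof.
by rewrite /rk1 map_scalar_mx /= flat_scalar //; exact: field_rank_prank.
Qed.

(* A concave h on [0, L] is a nonnegative combination of the functions k |-> min(k, j) with
   1 <= j <= L, and k |-> min(k, j) is, up to the factor deg p, the corank of p^k acting
   on K[X]/(p^j). The induction splits off the slope of h at L. *)
Lemma prime_part p L (h : nat -> real) : prime_poly p -> coprimep p 'X -> h 0%N = 0 ->
  (forall k, (k < L)%N -> h k <= h k.+1) ->
  (forall k, (k.+1 < L)%N -> h k + h k.+2 <= h k.+1 *+ 2) ->
  exists2 s, rep_sum s &
    [/\ rk1 s 1 = h L, (forall k, (k <= L)%N -> corank s (p ^+ k) = h k)
      & (forall g, coprimep g p -> corank s g = 0)].
Proof.
move=> [[p1 _] pm] pX; elim: L h => [|L IH] h h0 hinc hconc.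
  exists (fun m n M => 0); first exact: RepSum0.
  rewrite /corank /rk1; split=> [|k|g _]; rewrite ?subrr //.
  by rewrite leqn0 => /eqP ->.
pose a := h L.+1 - h L.
have a0 : 0 <= a by rewrite subr_ge0 hinc.
have slope j : (j <= L)%N -> a <= h (L - j).+1 - h (L - j)%N.
  elim: j => [|j IHj] hj; first by rewrite subn0.
  apply: le_trans (IHj (ltnW hj)) _.
  have e : (L - j)%N = (L - j.+1).+1 by rewrite subnSK.
  rewrite e; have := hconc (L - j.+1)%N; rewrite -e ltnS leq_subr => /(_ isT).
  by rewrite e mulr2n; lra.
pose h' k := h k - a * k%:R.
have [||| s' hs' [s1 s2 s3]] := IH h'.
- by rewrite /h' h0 mulr0 subr0.
- move=> k kL; have := slope (L - k)%N (leq_subr _ _); rewrite subKn ?(ltnW kL) //.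
  by rewrite /h' -natr1; lra.
- move=> k kL; have := hconc k (ltnW kL).
  by rewrite /h' -!natr1 !mulr2n; lra.
have s'P := rep_sum_prank hs'.
have hL' : h' L.+1 = h' L by rewrite /h' /a -natr1; lra.
have pn0 : p != 0 by rewrite monic_neq0.
pose dp := (size p).-1.
have dp0 : (0 < dp)%N by rewrite /dp -subn1 subn_gt0.
have szp k : size (p ^+ k) = (dp * k).+1.
  by rewrite -[LHS]prednK ?size_poly_gt0 ?expf_neq0 // size_exp.
have [n' n'E] : exists n', (dp * L.+1)%N = n'.+1.
  by exists (dp * L.+1).-1; rewrite prednK // muln_gt0 dp0.
have szm : size (p ^+ L.+1) = n'.+2 by rewrite szp n'E.
pose psi : {rmorphism {poly K} -> 'M[K]_n'.+1} := horner_mx (cyclic_mx (p ^+ L.+1) n').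
have psiU g : coprimep g p -> psi g \in unitmx.
  by move=> gp; apply: (unit_cyclic szm); apply: coprimep_expr.
have psiR k : (k <= L.+1)%N -> (\rank (psi (p ^+ k)))%:R = dp%:R * (L.+1%:R - k%:R) :> real.
  move=> kL; rewrite (rank_cyclic szm) ?dvdp_exp2l // szp -n'E -mulnBr natrM natrB //.
have dpR : dp%:R != 0 :> real by rewrite pnatr_eq0 -lt0n.
eexists; first apply: (@RepSumS K K n'.+1 psi (a / dp%:R) s' _ _ hs').
- by apply: psiU; rewrite coprimep_sym.
- by rewrite divr_ge0 ?ler0n.
have rk_p k : (k <= L.+1)%N ->
    a / dp%:R * (\rank (psi (p ^+ k)))%:R = a * (L.+1%:R - k%:R).
  by move=> kL; rewrite psiR // mulrA divfK.
have rk_1 : a / dp%:R * (\rank (psi 1))%:R = a * L.+1%:R.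
  by rewrite -(expr0 p) rk_p // subr0.
split.
- by rewrite rk1_rep rk_1 s1 /h' /a -natr1; lra.
- move=> k kL; rewrite /corank !rk1_rep rk_1 rk_p // opprD addrACA -/(corank s' (p ^+ k)).
  suff -> : corank s' (p ^+ k) = h' k by rewrite /h'; lra.
  move: kL; rewrite leq_eqVlt => /orP[/eqP ->|kL]; last by rewrite s2.
  (* At k = L + 1: the rank of p^L under s' is already zero, hence so is that of p^(L+1), which
     agrees with h' being flat between L and L + 1. *)
  rewrite hL' /corank s1.
  suff -> : rk1 s' (p ^+ L.+1) = 0 by rewrite subr0.
  rewrite exprS; apply: rk1_mulr_0 => //.
  by have := s2 L (leqnn _); rewrite /corank s1; lra.
- move=> g gp; rewrite /corank !rk1_rep rk_1 opprD addrACA -/(corank s' g) s3 // addr0.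
  rewrite mxrank_unit ?psiU // -n'E natrM mulrA divfK //.
  by rewrite subrr.
Qed.

Variable s : rank_fun {poly K}.
Hypotheses (sP : prank s) (sX : rk1 s 'X = rk1 s 1).

(** The prime X is treated apart: its powers have corank zero by [sX], so the empty combination
    serves, whereas X is not invertible on K[X]/(X^j). *)
Lemma prime_part_of p L : prime_poly p ->
  exists2 t, rep_sum t &
    [/\ rk1 t 1 = corank s (p ^+ L),
        (forall k, (k <= L)%N -> corank t (p ^+ k) = corank s (p ^+ k))
      & (forall g, coprimep g p -> corank t g = 0)].
Proof.
move=> pp; have [pX|pX] := boolP (coprimep p 'X).
  apply: prime_part => //.
  - by rewrite expr0 corank1.
  - by move=> k _; rewrite exprSr corank_le.
  - by move=> k _; rewrite [p ^+ k.+2]exprS [p ^+ k.+1]exprS mulrA; exact: corank_convex.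
have Xpp : prime_poly ('X : {poly K}).
  by split; [have := irredp_XsubC (0 : K); rewrite subr0 | exact: monicX].
have -> : p = 'X by apply/eqP; apply: contraNT pX => ne; apply: prime_poly_coprime.
have h0 : corank s 'X = 0 by rewrite /corank sX subrr.
exists (fun m n M => 0); first exact: RepSum0.
rewrite /rk1 /corank /rk1; split=> [|k _|g _]; rewrite ?subrr //.
  by rewrite -[RHS]/(corank s ('X ^+ L)) corank_exp_unit.
by rewrite -[RHS]/(corank s ('X ^+ k)) corank_exp_unit.
Qed.

Lemma corankD t t1 t2 g : (forall m n (M : 'M[{poly K}]_(m, n)), t _ _ M = t1 _ _ M + t2 _ _ M) ->
  corank t g = corank t1 g + corank t2 g.
Proof. by move=> e; rewrite /corank /rk1 !e; lra. Qed.

(** Different primes do not interact: in the part belonging to p, anything coprime to p has corank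
    zero, and coranks are additive over coprime prime powers. *)
Lemma prime_parts (ps : seq {poly K}) L : uniq ps -> (forall p, p \in ps -> prime_poly p) ->
  exists2 t, rep_sum t &
    [/\ rk1 t 1 = \sum_(p <- ps) corank s (p ^+ L),
        (forall k : {poly K} -> nat, (forall p, (k p <= L)%N) ->
           corank t (\prod_(p <- ps) p ^+ k p) = corank s (\prod_(p <- ps) p ^+ k p) /\
           corank s (\prod_(p <- ps) p ^+ k p) = \sum_(p <- ps) corank s (p ^+ k p))
      & (forall g, (forall p, p \in ps -> coprimep g p) -> corank t g = 0)].
Proof.
elim: ps => [|p ps IH] /=.
  move=> _ _; exists (fun m n M => 0); first exact: RepSum0.
  split=> [|k _|g _]; rewrite ?big_nil /corank /rk1 ?subrr //.
move=> /andP[pps ups] pp.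
have [||t ht [t1 t2 t3]] := IH; rewrite //.
  by move=> q qps; apply: pp; rewrite inE qps orbT.
have ppp : prime_poly p by apply: pp; rewrite inE eqxx.
have [u hu [u1 u2 u3]] := prime_part_of L ppp.
have [v hv ev] := rep_sumD hu ht.
exists v => //; have vP := rep_sum_prank hv.
have cop (q : {poly K}) : q \in ps -> coprimep p q.
  move=> qps; apply: prime_poly_coprime => //; first by apply: pp; rewrite inE qps orbT.
  by apply: contraNneq pps => ->.
have copD (k : {poly K} -> nat) : coprimep p (\prod_(q <- ps) q ^+ k q).
  rewrite big_seq; elim/big_rec: _ => [|q x /cop hq hx]; first exact: coprimep1.
  by rewrite coprimepMr hx coprimep_expr.
split.
- by rewrite /rk1 ev -/(rk1 u 1) -/(rk1 t 1) u1 t1 big_cons.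
- move=> k kL; rewrite !big_cons.
  have c1 : coprimep (p ^+ k p) (\prod_(q <- ps) q ^+ k q) by apply: coprimep_expl.
  rewrite !corank_coprime //.
  rewrite !(corankD _ ev) u2 // u3; last by rewrite coprimep_sym.
  rewrite t3; last by move=> q hq; apply/coprimep_expl/cop.
  by have [-> ->] := t2 k kL; rewrite addr0 add0r.
- move=> g hg; rewrite (corankD _ ev) u3 ?t3 ?addr0 //.
    by move=> q hq; apply: hg; rewrite inE hq orbT.
  by apply: hg; rewrite inE eqxx.
Qed.

Lemma prod_count (ps r : seq {poly K}) : uniq ps -> {subset r <= ps} ->
  \prod_(p <- r) p = \prod_(p <- ps) p ^+ count_mem p r.
Proof.
move=> ups; elim: r => [|x r IH] sub; first by rewrite big_nil big1.
rewrite big_cons IH => [|y yr]; last by apply: sub; rewrite inE yr orbT.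
have xps : x \in ps by apply: sub; rewrite inE eqxx.
rewrite !(bigD1_seq x) //= eqxx exprS mulrA; congr (_ * _).
by apply: eq_bigr => q qx; rewrite [x == q]eq_sym (negPf qx).
Qed.

Lemma decomposition_elements (ds : seq {poly K}) : exists2 t, rep_sum t &
  forall d, d \in ds -> rk1 t d = rk1 s d.
Proof.
have /choice [fac facP] : forall d : {poly K}, exists w : K * seq {poly K}, d != 0 ->
    [/\ w.1 != 0, (forall p, p \in w.2 -> prime_poly p) & d = w.1%:P * \prod_(p <- w.2) p].
  move=> d.
  have [->|d0] := eqVneq d 0; first by exists (0, [::]).
  by have [c [r h]] := prime_factorisation d0; exists (c, r).
pose es := [seq d <- ds | d != 0].
pose ps := undup (flatten [seq (fac d).2 | d <- es]).
pose L := \max_(d <- es) size (fac d).2.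
have pps p : p \in ps -> prime_poly p.
  rewrite mem_undup => /flatten_mapP [d]; rewrite mem_filter => /andP[d0 _].
  by have [_ h _] := facP d d0; exact: h.
have [t ht [t1 t2 t3]] := prime_parts L (undup_uniq _) pps.
pose psi : {rmorphism {poly K} -> 'M[{fraction {poly K}}]_1} :=
  (@scalar_mx {fraction {poly K}} 1) \o (@FracField.tofrac {poly K}).
have psiE d : \rank (psi d) = (d != 0).
  have [->|d0] := eqVneq d 0; first by rewrite rmorph0 mxrank0.
  by rewrite mxrank_unit // unitmxE /= det_scalar1 unitfE tofrac_eq0.
(* The mass of 1 left over by the prime parts goes to the rank over the fraction field, where every
   nonzero d has corank zero. It is nonnegative because the prime parts together have the mass of
   the corank of one product, the product of all p^L. *)
pose c := rk1 s 1 - rk1 t 1.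
have c0 : 0 <= c.
  rewrite /c subr_ge0 t1.
  have [_ <-] := t2 (fun=> L) (fun=> leqnn _).
  by rewrite lerBlDr lerDl rk1_ge0.
have uX : psi 'X \in unitmx.
  by rewrite unitmxE /= det_scalar1 unitfE tofrac_eq0 polyX_eq0.
exists (fun m n M => c * field_rank (flat (map_mx psi M)) + t m n M).
  exact: RepSumS.
have tP := rep_sum_prank ht.
move=> d dds; rewrite rk1_rep psiE.
have [->|d0] := eqVneq d 0; first by rewrite !rk1_0 // mulr0 add0r.
rewrite mulr1.
have des : d \in es by rewrite mem_filter d0.
have [f1 f2 f3] := facP d d0.
suff : corank t d = corank s d by rewrite /corank /c; lra.
rewrite f3 !corank_const // (@prod_count ps) ?undup_uniq //.
  pose k p := if p \in ps then count_mem p (fac d).2 else 0%N.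
  have e : \prod_(p <- ps) p ^+ count_mem p (fac d).2 = \prod_(p <- ps) p ^+ k p.
    by apply: eq_big_seq => p hp; rewrite /k hp.
  rewrite e; have [] // := t2 k.
  move=> p; rewrite /k; case: ifP => // _.
  apply: leq_trans (count_size _ _) _; rewrite /L.
  by apply: (@leq_bigmax_seq _ es xpredT (fun d => size (fac d).2)).
by move=> p hp; rewrite mem_undup; apply/flatten_mapP; exists d.
Qed.

Lemma decomposition (Ms : seq (matr {poly K})) : exists2 t, rep_sum t &
  forall M, List.In M Ms -> rk_matr s M = rk_matr t M.
Proof.
have [D hD] : exists D : seq {poly K}, forall M, List.In M Ms -> exists2 ds, {subset ds <= D} &
    forall r : rank_fun {poly K}, prank r -> rk_matr r M = \sum_(d <- ds) rk1 r d.
  elim: Ms => [|M Ms [D hD]]; first by exists [::].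
  have [ds hds] := diag_rank_all (matr_mx M).
  exists (ds ++ D) => N /= [<-|/hD [es sub h]].
    by exists ds => // x hx; rewrite mem_cat hx.
  by exists es => // x /sub hx; rewrite mem_cat hx orbT.
have [t ht tD] := decomposition_elements D.
exists t => // M /hD [ds sub h]; rewrite !h //; last exact: rep_sum_prank.
by apply: eq_big_seq => d /sub dD; rewrite tD.
Qed.

End Decomposition.


(** * Approximation by regular subrings *)

Definition subring_prop (A : pzRingType) (B : A -> Prop) : Prop :=
  [/\ B 1, (forall x y, B x -> B y -> B (x - y)) & (forall x y, B x -> B y -> B (x * y))].

Section SubringType.
Variables (A : pzRingType) (B : A -> Prop).
Hypothesis hB : subring_prop B.

Definition subring_pred : {pred A} := fun a => `[< B a >].

Fact subring_pred_closed : subring_closed subring_pred.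
Proof.
have [h1 hs hm] := hB; split; first exact/asboolP.
  by move=> x y /asboolP hx /asboolP hy; apply/asboolP/hs.
by move=> x y /asboolP hx /asboolP hy; apply/asboolP/hm.
Qed.

HB.instance Definition _ := GRing.isSubringClosed.Build A subring_pred subring_pred_closed.

Record subring_type := SubringElt { sval_of : A; sval_ofP : sval_of \in subring_pred }.
HB.instance Definition _ := [isSub of subring_type for sval_of].
HB.instance Definition _ := [Choice of subring_type by <:].
HB.instance Definition _ := GRing.SubChoice_isSubPzRing.Build A subring_pred subring_type
  subring_pred_closed.

Lemma subring_embedding : exists (S : pzRingType) (f : {rmorphism S -> A}),
  injective f /\ forall a, B a <-> exists x, f x = a.
Proof.
exists subring_type, (val : {rmorphism subring_type -> A}); split; first exact: val_inj.
move=> a; split=> [ha|[x <-]]; last exact/asboolP/(valP x).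
have ha' : a \in subring_pred by exact/asboolP.
by exists (SubringElt ha').
Qed.

End SubringType.

Lemma subr_through (V : zmodType) (x y z : V) : z - y = x - y - (x - z).
Proof. by rewrite opprB addrC -[RHS]addrC addrA subrK addrC. Qed.

(** Both [L] and [h] are chosen before the rank function, so that the tolerance can be fixed before
    the periodic part is split off. *)
Lemma approx_subring (A : pzRingType) D Ms (e : real) : 0 < e ->
  exists (L : seq A) (h : real), 0 < h /\ forall rk : rank_fun A, prank rk ->
  (exists B : A -> Prop,
     [/\ subring_prop B, (forall x, B x -> exists2 y, B y & x * y * x = x)
       & (forall a, a \in L -> exists2 b, B b & rk1 rk (a - b) <= h)]) ->
  approx rk D Ms e.
Proof.
move=> e0.
pose entries (M : matr A) := [seq matr_mx M i j | i <- enum 'I_(projT1 M).1, j <- enum 'I_(projT1 M).2].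
pose L := 1 :: D ++ [seq a - b | a <- D, b <- D] ++ [seq a * b | a <- D, b <- D] ++
  flatten (map entries Ms).
have [N hN] : exists N : nat, forall M, List.In M Ms -> ((projT1 M).1 * (projT1 M).2 <= N)%N.
  elim: (Ms) => [|M l [N hN]]; first by exists 0%N.
  exists (maxn ((projT1 M).1 * (projT1 M).2) N) => M' /= [<-|/hN h]; first exact: leq_maxl.
  by apply: leq_trans h _; exact: leq_maxr.
(* A defect of the ring laws collects three errors h, a matrix at most N of them, one for each
   entry. *)
pose h := e / (N + 3)%:R.
have h0 : 0 < h by rewrite divr_gt0 ?ltr0n // addn3.
have hE : N%:R * h + h * 3 = e.
  have : (N + 3)%:R != 0 :> real by rewrite pnatr_eq0 addn3.
  by rewrite /h natrD => nz; field.
have Nh : 0 <= N%:R * h by rewrite mulr_ge0 ?ler0n ?ltW.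
exists L, h; split=> // rk rkP [B [sB rB aB]].
have [S [f [finj fB]]] := subring_embedding sB.
have /choice [phi hphi] : forall a : A, exists x : S, a \in L -> rk1 rk (a - f x) <= h.
  move=> a; have [aL|_] := boolP (a \in L); last by exists 0.
  by have [b /fB [x <-] hb] := aB a aL; exists x.
pose r : rank_fun S := fun m n M => rk m n (map_mx f M).
have r1 x : rk1 r x = rk1 rk (f x) by rewrite /rk1 /r map_scalar_mx.
have DL a : a \in D -> a \in L by move=> aD; rewrite in_cons mem_cat aD orbT.
exists (Model r phi); split=> /=.
- move=> x; have [|y /fB [y' <-] hy] := rB (f x); first by apply/fB; exists x.
  by exists y'; apply: finj; rewrite !rmorphM.
- exact: prank_pull.
- rewrite r1 rmorphB rmorph1 -opprB rk1N //.
  by apply: le_trans (hphi _ _) _; [rewrite inE eqxx | lra].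
- move=> a b aD bD; rewrite !r1 !rmorphB rmorphM /=.
  have ha := hphi a (DL a aD); have hb := hphi b (DL b bD); split.
    have hab : rk1 rk (a - b - f (phi (a - b))) <= h.
      have m1 : a - b \in [seq x - y | x <- D, y <- D] by apply/allpairsP; exists (a, b).
      by apply: hphi; rewrite in_cons !mem_cat m1 !orbT.
    have -> : f (phi (a - b)) - (f (phi a) - f (phi b)) =
        (a - f (phi a)) - (b - f (phi b)) - (a - b - f (phi (a - b))).
      have -> : a - f (phi a) - (b - f (phi b)) = a - b - (f (phi a) - f (phi b)).
        by rewrite !opprB addrACA [RHS]addrACA [- f _ - b]addrC.
      exact: subr_through.
    apply: le_trans (rk1B rkP _ _) _.
    apply: (@le_trans _ _ (h + h + h)); last by lra.
    by apply: lerD => //; apply: le_trans (rk1B rkP _ _) _; exact: lerD.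
  have hab : rk1 rk (a * b - f (phi (a * b))) <= h.
    have m1 : a * b \in [seq x * y | x <- D, y <- D] by apply/allpairsP; exists (a, b).
    by apply: hphi; rewrite in_cons !mem_cat m1 !orbT.
  have -> : f (phi (a * b)) - f (phi a) * f (phi b) =
      (a - f (phi a)) * b + f (phi a) * (b - f (phi b)) - (a * b - f (phi (a * b))).
    by rewrite mulrBl mulrBr [_ - _ * b + _]addrA subrK; exact: subr_through.
  apply: le_trans (rk1B rkP _ _) _.
  apply: (@le_trans _ _ (h + h + h)); last by lra.
  apply: lerD => //; apply: le_trans (rk1D rkP _ _) _; apply: lerD.
    exact: le_trans (rk1_mull rkP _ _) _.
  exact: le_trans (rk1_mulr rkP _ _) _.
- move=> M hM; rewrite /rk_matr /r /=; apply: le_trans (prk_dist rkP _ _) _.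
  apply: le_trans (prk_entries rkP _) _.
  apply: (@le_trans _ _ (\sum_(i < (projT1 M).1) \sum_(j < (projT1 M).2) h)).
    apply: ler_sum => i _; apply: ler_sum => j _; rewrite !mxE; apply: hphi.
    rewrite in_cons !mem_cat; do 4!(apply/orP; right).
    elim: (Ms) hM => // M' l IH /= [->|/IH hl]; rewrite mem_cat.
      by apply/orP; left; apply/allpairsP; exists (i, j); rewrite !mem_enum.
    by rewrite hl orbT.
  rewrite !sumr_const !card_ord -mulrnA -mulr_natl.
  apply: (@le_trans _ _ (N%:R * h)); last by lra.
  by rewrite ler_wpM2r ?(ltW h0) // ler_nat mulnC hN.
Qed.

Section Corner.
Variables (A : pzRingType) (C : A -> Prop) (H : nat) (v : 'cV[A]_H) (w : 'rV[A]_H).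
Hypotheses (CB : forall x y, C x -> C y -> C (x - y)) (CM : forall x y, C x -> C y -> C (x * y)).
Hypothesis CV : forall M : 'M[A]_H, (forall i j, C (M i j)) ->
  exists2 N : 'M[A]_H, (forall i j, C (N i j)) & M *m N *m M = M.
Hypotheses (wv : w *m v = 1%:M) (vw : forall k l, C ((v *m w) k l)).

(* Since w v = 1, the map a |-> v a w embeds A in a corner of the H x H matrices over A. *)
Definition corner (a : A) := forall k l, C ((v *m a%:M *m w) k l).

Lemma corner_entries m (M N : 'M[A]_m) : (forall i j, C (M i j)) -> (forall i j, C (N i j)) ->
  forall i j, C ((M *m N) i j).
Proof.
case: m M N => [|m] M N hM hN i j; first by case: i.
have C0 : C 0 by rewrite -(subrr (M ord0 ord0)); exact: CB.
rewrite mxE; elim/big_ind: _ => // [x y hx hy|k _]; last exact: CM.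
by rewrite -[y]opprK -[- y]sub0r; apply: CB => //; exact: CB.
Qed.

Lemma corner_subring : subring_prop corner.
Proof.
split=> [|x y hx hy|x y hx hy] k l; rewrite /corner.
- by rewrite mulmx1.
- by rewrite raddfB mulmxBr mulmxBl mxE [X in _ + X]mxE; apply: CB; [exact: hx | exact: hy].
have -> : v *m (x * y)%:M *m w = (v *m x%:M *m w) *m (v *m y%:M *m w).
  by rewrite scalar_mxM !mulmxA -[_ *m w *m v]mulmxA wv mulmx1.
exact: corner_entries.
Qed.

(** A quasi-inverse N of v x w pulls back to y = w N v; cutting N down by the idempotent v w keeps
    the entries in C. *)
Lemma corner_regular x : corner x -> exists2 y, corner y & x * y * x = x.
Proof.
move=> hx; have [N hN eN] := CV hx; exists ((w *m N *m v) 0 0).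
  move=> k l; rewrite -mx11_scalar.
  have -> : v *m (w *m N *m v) *m w = (v *m w) *m N *m (v *m w) by rewrite !mulmxA.
  by apply: corner_entries => //; exact: corner_entries.
set y := _ 0 0; have inj : injective (@scalar_mx A 1).
  by move=> a b /matrixP /(_ 0 0); rewrite !mxE.
apply: inj; rewrite !scalar_mxM -mx11_scalar.
transitivity (w *m ((v *m x%:M *m w) *m N *m (v *m x%:M *m w)) *m v).
  by rewrite !mulmxA wv mul1mx -[RHS]mulmxA wv mulmx1.
by rewrite eN !mulmxA wv mul1mx -mulmxA wv mulmx1.
Qed.

End Corner.

(** * Limits and corners of rank functions *)

Section Limits.
Implicit Types u v : nat -> real.

Definition conv u (l : real) := forall e, 0 < e -> exists N, forall n, (N <= n)%N -> `|u n - l| <= e.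

Lemma conv_le u v l l' : conv u l -> conv v l' -> (exists N, forall n, (N <= n)%N -> u n <= v n) -> l <= l'.
Proof.
move=> hu hv [N uv]; apply/ler_addgt0Pl => e e0; have e2 : 0 < e / 2 by lra.
have [N1 h1] := hu _ e2; have [N2 h2] := hv _ e2.
pose n := maxn N (maxn N1 N2).
have /uv h : (N <= n)%N by rewrite leq_maxl.
have /h1/ler_normlP[? ?] : (N1 <= n)%N by rewrite /n leq_max leq_maxl orbT.
have /h2/ler_normlP[? ?] : (N2 <= n)%N by rewrite /n leq_max leq_maxr orbT.
by lra.
Qed.

Lemma conv_unique u l l' : conv u l -> conv u l' -> l = l'.
Proof.
by move=> h h'; apply/eqP; rewrite eq_le; apply/andP; split;
  [apply: (conv_le h h') | apply: (conv_le h' h)]; exists 0%N.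
Qed.

Lemma conv_cst c : conv (fun=> c) c.
Proof. by move=> e e0; exists 0%N => n _; rewrite subrr normr0 ltW. Qed.

Lemma convD u v l l' : conv u l -> conv v l' -> conv (fun n => u n + v n) (l + l').
Proof.
move=> hu hv e e0; have e2 : 0 < e / 2 by lra.
have [N1 h1] := hu _ e2; have [N2 h2] := hv _ e2.
exists (maxn N1 N2) => n; rewrite geq_max => /andP[/h1/ler_normlP[? ?] /h2/ler_normlP[? ?]].
by apply/ler_normlP; split; lra.
Qed.

Lemma conv_shift u l k : conv u l -> conv (fun n => u (n + k)%N) l.
Proof.
move=> hu e /hu [N h]; exists N => n Nn; apply: h; apply: leq_trans Nn _; exact: leq_addr.
Qed.

Lemma conv_decreasing u : (forall n, u n.+1 <= u n) -> (forall n, 0 <= u n) -> exists l, conv u l.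
Proof.
move=> dec u0; pose E : set real := [set y | exists n, y = - u n]%classic.
have sE : has_sup E.
  by split; [exists (- u 0%N), 0%N | exists 0 => y [n ->]; rewrite lerNl oppr0; exact: u0].
exists (- sup E) => e e0; have [y [N ->] hN] := sup_adherent e0 sE.
exists N => n Nn.
have hn : u n <= u N by rewrite -(subnK Nn); elim: (n - N)%N => [|k IH]; [by [] | exact: le_trans (dec _) IH].
have : - u n <= sup E by apply: ub_le_sup; [case: sE | exists n].
by move=> h; apply/ler_normlP; split; lra.
Qed.

Lemma conv_increasing u (b : real) : (forall n, u n <= u n.+1) -> (forall n, u n <= b) ->
  exists l, conv u l.
Proof.
move=> inc ub; have [||l hl] := @conv_decreasing (fun n => b - u n).
- by move=> n; rewrite lerD2l lerN2.
- by move=> n; rewrite subr_ge0.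
by exists (b - l) => e /hl [N h]; exists N => n /h /ler_normlP[? ?]; apply/ler_normlP; split; lra.
Qed.

End Limits.

Lemma mul_scalarE (A : pzRingType) m n a (M : 'M[A]_(m, n)) i j : (a%:M *m M) i j = a * M i j.
Proof. by rewrite mul_scalar_mx mxE. Qed.

Lemma mulmx_scalarE (A : pzRingType) m n a (M : 'M[A]_(m, n)) i j : (M *m a%:M) i j = M i j * a.
Proof.
rewrite mxE (bigD1 j) //= mxE eqxx mulr1n big1 ?addr0 // => k kj.
by rewrite mxE (negPf kj) mulr0n mulr0.
Qed.

(* The last hypothesis lets g pass through M at the cost of a bounded shift of the index,
   which gives the inequality rho (M1 M2) <= rho M2. *)
Lemma limit_prank (A : pzRingType) (rk : rank_fun A) (g : nat -> A) (rho : rank_fun A) :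
  prank rk -> (forall m n (M : 'M[A]_(m, n)), conv (fun k => rk m n ((g k)%:M *m M)) (rho m n M)) ->
  (forall m n (M : 'M[A]_(m, n)), exists d1 d2, forall k,
     (g (k + d1)%N)%:M *m M = (g (k + d1)%N)%:M *m M *m (g (k + d2)%N)%:M) ->
  prank rho.
Proof.
move=> rkP hc hl; split.
- move=> m n M; apply: (conv_le (conv_cst 0) (hc _ _ M)); exists 0%N => k _; exact: prk_ge0.
- apply: (conv_unique (hc _ _ 0)) => e e0; exists 0%N => k _.
  by rewrite mulmx0 prk0 // subrr normr0 ltW.
- move=> m n p M1 M2; split.
    apply: (conv_le (hc _ _ _) (hc _ _ _)); exists 0%N => k _.
    by rewrite mulmxA; exact: prk_mull.
  have [d1 [d2 h]] := hl _ _ M1.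
  apply: (conv_le (conv_shift d1 (hc _ _ _)) (conv_shift d2 (hc _ _ _))); exists 0%N => k _.
  by rewrite mulmxA h -mulmxA; exact: prk_mulr.
- move=> m1 n1 m2 n2 M1 M2; apply: (conv_unique (hc _ _ _)).
  have e k : rk (m1 + m2)%N (n1 + n2)%N ((g k)%:M *m block_mx M1 0 0 M2) =
      rk _ _ ((g k)%:M *m M1) + rk _ _ ((g k)%:M *m M2).
    by rewrite scalar_mx_block mulmx_block !(mulmx0, mul0mx, addr0, add0r) prk_diag.
  move=> x x0; have [N hN] := convD (hc _ _ M1) (hc _ _ M2) x0.
  by exists N => k /hN; rewrite e.
- move=> m1 n1 m2 n2 M1 M2 M3; apply: (conv_le (convD (hc _ _ _) (hc _ _ _)) (hc _ _ _)).
  exists 0%N => k _.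
  by rewrite scalar_mx_block mulmx_block !(mulmx0, mul0mx, addr0, add0r) prk_trig.
Qed.

(** The hypothesis makes e idempotent (take a = 1) and a |-> e psi(a) multiplicative, so this is a
    rank function of the corner e B e pulled back to R. *)
Lemma corner_prank (R B : pzRingType) (psi : {rmorphism R -> B}) (rk : rank_fun B) (e : B) :
  prank rk -> (forall a, e * psi a = e * psi a * e) ->
  prank (fun m n (M : 'M[R]_(m, n)) => rk m n (e%:M *m map_mx psi M)).
Proof.
move=> rkP he.
have heM m n (M : 'M[R]_(m, n)) : e%:M *m map_mx psi M = e%:M *m map_mx psi M *m e%:M.
  by apply/matrixP => i j; rewrite mulmx_scalarE mul_scalarE mxE -he.
split.
- by move=> *; exact: (prk_ge0 rkP).
- by rewrite map_mx0 mulmx0 prk0.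
- move=> m n p M1 M2; rewrite map_mxM mulmxA; split; first exact: (prk_mull rkP).
  by rewrite heM -mulmxA; exact: (prk_mulr rkP).
- move=> m1 n1 m2 n2 M1 M2; rewrite map_block_mx !map_mx0 scalar_mx_block mulmx_block.
  by rewrite !(mulmx0, mul0mx, addr0, add0r) prk_diag.
- move=> m1 n1 m2 n2 M1 M2 M3; rewrite map_block_mx !map_mx0 scalar_mx_block mulmx_block.
  by rewrite !(mulmx0, mul0mx, addr0, add0r) prk_trig.
Qed.

Lemma poly_eval_ex (Q : pzRingType) (K : fieldType) (kap : {rmorphism K -> Q}) (u : Q) :
  (1 : Q) != 0 -> (forall k, kap k * u = u * kap k) ->
  exists ev : {rmorphism {poly K} -> Q}, ev 'X = u /\ forall k, ev k%:P = kap k.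
Proof.
move=> q1 cu.
(* The same ring, repackaged as a nonzero one, the structure on which [horner_morph] takes
   values. *)
pose Qn : nzRingType := HB.pack Q (GRing.PzSemiRing_isNonZero.Build Q q1).
pose kapn : {rmorphism K -> Qn} := kap.
have cun : commr_rmorph kapn (u : Qn) by move=> k; apply: esym; exact: (cu k).
exists (horner_morph cun : {rmorphism {poly K} -> Qn}); split.
  exact: (horner_morphX cun).
by move=> k; exact: (horner_morphC cun).
Qed.


(** * The crossed product *)

Section Dynamics.
Variables (X : Type) (T Tinv : X -> X).
Hypotheses (TK : forall x, T (Tinv x) = x) (TinvK : forall x, Tinv (T x) = x).

Definition iterz (z : int) (x : X) : X :=
  match z with Posz n => iter n T x | Negz n => iter n.+1 Tinv x end.

Lemma iterzS z x : iterz (z + 1) x = T (iterz z x).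
Proof.
case: z => [n|[|n]]; first by rewrite addrC -intS.
  by rewrite /= TK.
have -> : Negz n.+1 + 1 = Negz n by rewrite !NegzE; lia.
by rewrite /= TK.
Qed.

Lemma iterzB z x : iterz (z - 1) x = Tinv (iterz z x).
Proof. by rewrite -{2}(subrK 1 z) iterzS TinvK. Qed.

Lemma iterzD z w x : iterz (z + w) x = iterz z (iterz w x).
Proof.
elim/int_rect: z => [|n IH|n IH]; first by rewrite add0r.
  by rewrite intS (addrC 1) addrAC !iterzS IH.
by rewrite intS opprD (addrC (- 1)) addrAC !iterzB IH.
Qed.

Lemma iterzNK z x : iterz (- z) (iterz z x) = x.
Proof. by rewrite -iterzD addNr. Qed.

End Dynamics.

Arguments iterz {X} T Tinv z x : simpl never.

Lemma absz_modz (p : nat) (i : int) : (0 < p)%N ->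
  (absz (i %% p)%Z < p)%N /\ (absz (i %% p)%Z)%:Z = (i %% p)%Z.
Proof.
move=> p0; have pz : p%:Z != 0 by rewrite eqz_nat -lt0n.
have rE : (absz (i %% p)%Z)%:Z = (i %% p)%Z by rewrite gez0_abs ?modz_ge0.
by split=> //; rewrite -ltz_nat rE ltz_pmod.
Qed.

Lemma dvdz_sub_mod (p i : int) : (p %| i - (i %% p)%Z)%Z.
Proof. by rewrite {1}(divz_eq i p) addrK dvdz_mull. Qed.

Section ZPow.
Variables (B : pzRingType) (t tinv : B).
Hypotheses (tV : t * tinv = 1) (Vt : tinv * t = 1).

Lemma zpowS z : zpow t tinv (z + 1) = zpow t tinv z * t.
Proof.
case: z => [n|[|n]]; first by rewrite addrC -intS /= exprSr.
  by rewrite /= expr1 Vt.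
have -> : Negz n.+1 + 1 = Negz n by rewrite !NegzE; lia.
by rewrite /= [tinv ^+ n.+2]exprSr -mulrA Vt mulr1.
Qed.

Lemma zpowB z : zpow t tinv (z - 1) = zpow t tinv z * tinv.
Proof. by rewrite -{2}(subrK 1 z) zpowS -mulrA tV mulr1. Qed.

Lemma zpowD z w : zpow t tinv (z + w) = zpow t tinv z * zpow t tinv w.
Proof.
elim/int_rect: w => [|n IH|n IH]; first by rewrite addr0 mulr1.
  by rewrite intS (addrC 1) addrA !zpowS IH mulrA.
by rewrite intS opprD (addrC (- 1)) addrA !zpowB IH mulrA.
Qed.

Lemma zpowK z : zpow t tinv z * zpow t tinv (- z) = 1.
Proof. by rewrite -zpowD subrr. Qed.

Lemma zpowNK z : zpow t tinv (- z) * zpow t tinv z = 1.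
Proof. by rewrite -zpowD addNr. Qed.

End ZPow.

Arguments zpow {A} t tinv z : simpl never.

Section Crossed.
Variables (X : Type) (d : X -> X -> real) (T Tinv : X -> X).
Variables (K : fieldType) (A : pzRingType) (io : (X -> K) -> A) (t tinv : A).
Hypotheses (hcomp : mcompact d) (hT : homeomorphism d T Tinv).
Hypothesis hA : is_crossed_product d T Tinv io t tinv.

Local Notation LC := (@locally_constant X d _).
Local Notation Tz := (iterz T Tinv).
Local Notation tz := (zpow t tinv).

Let TK : forall x, T (Tinv x) = x. Proof. by case: hT => _ [_ []]. Qed.
Let TinvK : forall x, Tinv (T x) = x. Proof. by case: hT => _ [_ []]. Qed.
Let tV : t * tinv = 1. Proof. by case: hA => _ [_ [_ []]]. Qed.
Let Vt : tinv * t = 1. Proof. by case: hA => _ [_ [_ [_ []]]]. Qed.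

Definition near_point (x : X) (P : X -> Prop) :=
  exists eps, Rlt R0 eps /\ (forall y, Rlt (d x y) eps -> P y).

Lemma near_point_mono x (P Q : X -> Prop) :
  (forall y, P y -> Q y) -> near_point x P -> near_point x Q.
Proof. by move=> PQ [e [e0 h]]; exists e; split=> // y /h /PQ. Qed.

Lemma near_point_all (I : finType) x (P : I -> X -> Prop) :
  (forall i, near_point x (P i)) -> near_point x (fun y => forall i, P i y).
Proof.
move=> h; suff [e [e0 he]] : near_point x (fun y => forall i, i \in enum I -> P i y).
  by exists e; split=> // y /he hy i; apply: hy; rewrite mem_enum.
elim: (enum I) => [|i s [e [e0 he]]].
  by exists R1; split=> //; exact: RIneq.Rlt_0_1.
have [e' [e'0 he']] := h i; exists (Rbasic_fun.Rmin e e'); split; first exact: Rbasic_fun.Rmin_glb_lt.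
move=> y hy j; rewrite inE => /orP[/eqP ->|].
  by apply: he'; apply: RIneq.Rlt_le_trans hy _; exact: Rbasic_fun.Rmin_r.
by apply: he; apply: RIneq.Rlt_le_trans hy _; exact: Rbasic_fun.Rmin_l.
Qed.

Lemma lc_determined (I : finType) (Y Z : Type) (F : I -> X -> Y) (g : X -> Z) :
  (forall i, LC (F i)) -> (forall x y, (forall i, F i y = F i x) -> g y = g x) -> LC g.
Proof.
move=> hF hg x; apply: (@near_point_mono x _ _ (hg x)); apply: near_point_all => i; exact: hF.
Qed.

Lemma lc_cst (Y : Type) (y : Y) : LC (fun=> y).
Proof. by move=> x; exists R1; split=> //; exact: RIneq.Rlt_0_1. Qed.

Lemma lc_map (Y Z : Type) (f : X -> Y) (g : Y -> Z) : LC f -> LC (fun x => g (f x)).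
Proof. by move=> hf x; have [e [e0 h]] := hf x; exists e; split=> // y /h ->. Qed.

Lemma lc_map2 (Y Z W : Type) (f : X -> Y) (g : X -> Z) (h : Y -> Z -> W) :
  LC f -> LC g -> LC (fun x => h (f x) (g x)).
Proof.
move=> hf hg; pose F (b : bool) x : Y + Z := if b then inl (f x) else inr (g x).
apply: (@lc_determined bool _ _ F) => [[]|x y e].
- exact: (lc_map inl hf).
- exact: (lc_map inr hg).
- by have [->] := e true; have [->] := e false.
Qed.

Lemma lc_comp (Y : Type) (S : X -> X) (f : X -> Y) : mcontinuous d S -> LC f ->
  LC (fun x => f (S x)).
Proof.
move=> hS hf x; have [e [e0 he]] := hf (S x); have [e' [e'0 he']] := hS x e e0.
by exists e'; split=> // y /he' /he.
Qed.

Lemma lc_iterz (Y : Type) z (f : X -> Y) : LC f -> LC (fun x => f (Tz z x)).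
Proof.
have [cT [cTinv _]] := hT.
have it (S : X -> X) n g : mcontinuous d S -> LC g -> LC (fun x => g (iter n S x) : Y).
  move=> cS; elim: n g => [|n IH] g hg //.
  by have := IH _ (lc_comp cS hg); apply.
by case: z => n hf; apply: it.
Qed.

Lemma compact_cover (U : X -> X -> Prop) : (forall x, mopen d (U x)) -> (forall x, U x x) ->
  exists l : list X, forall y, exists x, List.In x l /\ U x y.
Proof. by move=> hU Ux; apply: hcomp => // x; exists x. Qed.

Lemma mopen_lc (Y : Type) (f : X -> Y) y : LC f -> mopen d (fun x => f x = y).
Proof. by move=> hf x <-; exact: hf. Qed.

Lemma lc_finite (Y : eqType) (f : X -> Y) : LC f -> exists s : seq Y, forall x, f x \in s.
Proof.
move=> hf; have [l hl] : exists l : list X, forall y, exists x, List.In x l /\ f y = f x.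
  by apply: compact_cover => // x; exact: mopen_lc.
exists [seq f x | x <- l] => x; have [y [hy ->]] := hl x.
by elim: l hy {hl} => //= z l IH [->|/IH]; rewrite inE ?eqxx // => ->; rewrite orbT.
Qed.

Definition ind (P : X -> bool) : X -> K := fun x => (P x)%:R.

Lemma lc_ind (P : X -> bool) : LC P -> LC (ind P).
Proof. exact: (lc_map (fun b : bool => b%:R)). Qed.

Lemma lcD f g : LC f -> LC g -> LC (fun x => f x + g x : K).
Proof. exact: lc_map2. Qed.

Lemma lcM f g : LC f -> LC g -> LC (fun x => f x * g x : K).
Proof. exact: lc_map2. Qed.

Lemma ioD f g : LC f -> LC g -> io (fun x => f x + g x) = io f + io g.
Proof. by case: hA => h _; exact: h. Qed.

Lemma ioM f g : LC f -> LC g -> io f * io g = io (fun x => f x * g x).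
Proof. by case: hA => _ [h _] *; rewrite h. Qed.

Lemma io1 : io (fun=> 1) = 1. Proof. by case: hA => _ [_ []]. Qed.

Lemma io0 : io (fun=> 0) = 0.
Proof.
have h : LC (fun=> 0 : K) by exact: lc_cst.
have := ioD h h; have -> : (fun x : X => 0 + 0 : K) = (fun=> 0) by apply/funext => x; rewrite addr0.
by move=> e; rewrite -[LHS](addrK (io (fun=> 0))) -e subrr.
Qed.

Lemma ioN f : LC f -> io (fun x => - f x) = - io f.
Proof.
move=> hf; apply/eqP; rewrite -addr_eq0 addrC -ioD //; last exact: (lc_map -%R).
by rewrite -io0; apply/eqP; congr io; apply/funext => x; rewrite subrr.
Qed.

Lemma ioB f g : LC f -> LC g -> io (fun x => f x - g x) = io f - io g.
Proof. by move=> hf hg; rewrite ioD ?ioN //; exact: (lc_map -%R). Qed.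

Lemma lc_sum I (r : seq I) (F : I -> X -> K) : (forall i, LC (F i)) ->
  LC (fun x => \sum_(i <- r) F i x).
Proof.
move=> hF; elim: r => [|i r IH].
  by under eq_fun do rewrite big_nil; exact: lc_cst.
by under eq_fun do rewrite big_cons; exact: lcD.
Qed.

Lemma io_sum I (r : seq I) (F : I -> X -> K) : (forall i, LC (F i)) ->
  io (fun x => \sum_(i <- r) F i x) = \sum_(i <- r) io (F i).
Proof.
move=> hF; elim: r => [|i r IH].
  by under eq_fun do rewrite big_nil; rewrite big_nil io0.
by under eq_fun do rewrite big_cons; rewrite big_cons ioD ?IH //; exact: lc_sum.
Qed.

Lemma tz_io z f : LC f -> tz z * io f = io (fun x => f (Tz (- z) x)) * tz z.
Proof.
have ht g : LC g -> t * io g = io (fun x => g (Tinv x)) * t.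
  by case: hA => _ [_ [_ [_ [_ [h _]]]]]; exact: h.
have hti g : LC g -> tinv * io g = io (fun x => g (T x)) * tinv.
  move=> hg; have hg' : LC (fun x => g (T x)) by apply: lc_comp => //; case: hT.
  have e : io g * t = t * io (fun x => g (T x)).
    by rewrite ht //; congr (io _ * t); apply/funext => x; rewrite TK.
  by rewrite -[LHS]mulr1 -tV mulrA -(mulrA tinv) e !mulrA Vt mul1r.
elim/int_rect: z f => [|n IH|n IH] f hf; first by rewrite /zpow /= mul1r mulr1.
  rewrite intS (addrC 1) zpowS // -mulrA ht // mulrA IH; last first.
    by apply: lc_comp => //; case: hT => _ [].
  rewrite mulrA; congr (io _ * _ * _); apply/funext => x.
  by rewrite opprD addrC addrC iterzB.
rewrite intS opprD (addrC (- 1)) zpowB // -mulrA hti // mulrA IH; last first.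
  by apply: lc_comp => //; case: hT.
rewrite mulrA; congr (io _ * _ * _); apply/funext => x.
by rewrite opprB opprK addrC iterzS.
Qed.


Definition lc_image (a : A) := exists2 f, LC f & a = io f.

Lemma lc_imageB x y : lc_image x -> lc_image y -> lc_image (x - y).
Proof.
move=> [f hf ->] [g hg ->]; exists (fun x => f x - g x); last by rewrite ioB.
exact: (lc_map2 (fun a b => a - b) hf hg).
Qed.

Lemma lc_imageM x y : lc_image x -> lc_image y -> lc_image (x * y).
Proof.
move=> [f hf ->] [g hg ->]; exists (fun x => f x * g x); last by rewrite ioM.
exact: lcM.
Qed.

(** The pseudo-inverse is taken pointwise; it depends only on the finitely many entries, so it is
    again locally constant. *)
Lemma lc_image_regular H (M : 'M[A]_H) : (forall i j, lc_image (M i j)) ->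
  exists2 N : 'M[A]_H, (forall i j, lc_image (N i j)) & M *m N *m M = M.
Proof.
move=> hM; have /choice [F hF] : forall ij : 'I_H * 'I_H, exists f, LC f /\ M ij.1 ij.2 = io f.
  by move=> [i j]; have [f] := hM i j; exists f.
pose mat x : 'M[K]_H := \matrix_(i, j) F (i, j) x.
pose G i j x := pinvmx (mat x) i j.
have hG i j : LC (G i j).
  apply: (@lc_determined _ _ _ F) => [ij|x y e]; first by case: (hF ij).
  by rewrite /G; congr (pinvmx _ _ _); apply/matrixP => k l; rewrite !mxE e.
exists (\matrix_(i, j) io (G i j)).
  by move=> i j; rewrite mxE; exists (G i j).
have hFL i j : LC (F (i, j)) by case: (hF (i, j)).
have ME i j : M i j = io (F (i, j)) by case: (hF (i, j)).
have h1 i k : (M *m \matrix_(i, j) io (G i j)) i k = io (fun x => \sum_j F (i, j) x * G j k x).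
  rewrite mxE io_sum => [|j]; last exact: lcM.
  by apply: eq_bigr => j _; rewrite mxE ME ioM.
apply/matrixP => i j; rewrite mxE.
transitivity (\sum_k io (fun x => (\sum_l F (i, l) x * G l k x) * F (k, j) x)).
  by apply: eq_bigr => k _; rewrite h1 ME ioM //; apply: lc_sum => l; exact: lcM.
rewrite -io_sum => [|k]; last by apply: lcM => //; apply: lc_sum => l; exact: lcM.
rewrite ME; congr io; apply/funext => x.
have := mulmxKpV (submx_refl (mat x)) => /matrixP /(_ i j).
rewrite [X in _ = X -> _]mxE => <-; rewrite mxE; apply: eq_bigr => k _; rewrite mxE mxE.
by congr (_ * _); apply: eq_bigr => l _; rewrite mxE.
Qed.

(** * Rokhlin towers *)

Section Tower.
Variables (E : X -> bool) (H : nat).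
Hypotheses (hE : LC E) (hH : forall x, exists k, (k < H)%N && E (Tz (- k.+1%:Z) x)).

Let ex_level x : exists k, E (Tz (- k.+1%:Z) x).
Proof. by have [k /andP[_ h]] := hH x; exists k. Qed.

(* The time elapsed since the last visit to E; the towers have base T E. *)
Definition level x : nat := ex_minn (ex_level x).

Lemma levelP x k : level x = k <->
  E (Tz (- k.+1%:Z) x) /\ forall j, (j < k)%N -> ~~ E (Tz (- j.+1%:Z) x).
Proof.
rewrite /level; case: ex_minnP => m hm hmin; split=> [<-|[h1 h2]].
  by split=> // j jm; apply/negP => /hmin; rewrite leqNgt jm.
apply/eqP; rewrite eqn_leq hmin //= leqNgt; apply/negP => /h2.
by rewrite hm.
Qed.

Lemma level_lt x : (level x < H)%N.
Proof.
have [k /andP[kH h]] := hH x; rewrite /level; case: ex_minnP => m _ /(_ k h) mk.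
exact: leq_ltn_trans kH.
Qed.

Lemma levelS x : ~~ E x -> level (T x) = (level x).+1.
Proof.
move=> nE; apply/levelP; have /levelP := erefl (level x); set k := level x => -[h1 h2].
have e j : Tz (- j.+2%:Z) (T x) = Tz (- j.+1%:Z) x.
  by rewrite -[T x]/(Tz 1 x) -(iterzD TK TinvK); congr Tz; lia.
split=> [|[|j] jk]; rewrite ?e //; last exact: h2.
by rewrite /iterz /= TinvK.
Qed.

Lemma lc_level : LC level.
Proof.
apply: (@lc_determined 'I_H _ _ (fun i x => E (Tz (- (i : nat).+1%:Z) x))).
  by move=> i; exact: lc_iterz.
move=> x y e; apply/levelP; have /levelP := erefl (level x) => -[h1 h2].
split; first by have := e (Ordinal (level_lt x)) => /= ->.
by move=> j jk; have := e (Ordinal (ltn_trans jk (level_lt x))) => /= ->; exact: h2.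
Qed.

Definition lev k : X -> bool := fun x => level x == k.

Lemma lc_lev k : LC (lev k). Proof. exact: (lc_map (fun n => n == k) lc_level). Qed.

(** The product is a function times t^(w - z), so it lies in C_K(X) when the exponents agree, and
    otherwise because g vanishes. *)
Lemma lc_image_conj (z w : int) g : LC g -> (z != w -> forall x, g x = 0) ->
  lc_image (tz (- z) * io g * tz w).
Proof.
move=> hg; have [<- _|_ /(_ isT) g0] := eqVneq z w; last first.
  exists (fun=> 0); first exact: lc_cst.
  by rewrite (_ : g = fun=> 0) ?io0 ?mulr0 ?mul0r //; apply/funext.
exists (fun x => g (Tz z x)); first exact: lc_iterz.
by rewrite tz_io // -mulrA zpowNK // mulr1 opprK.
Qed.

(** Entry k carries level k down to the base, so sandwiching a between [tower_col] and [tower_row]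
    writes it in the coordinates base times height. *)
Definition tower_col : 'cV[A]_H := \col_k (tz (- (k : nat)%:Z) * io (ind (lev k))).
Definition tower_row : 'rV[A]_H := \row_k (io (ind (lev k)) * tz (k : nat)%:Z).

Definition tower_ring := corner lc_image tower_col tower_row.

Lemma tower_entry a k l : (tower_col *m a%:M *m tower_row) k l =
  tz (- (k : nat)%:Z) * (io (ind (lev k)) * a * io (ind (lev l))) * tz (l : nat)%:Z.
Proof. by rewrite !mxE big_ord1 !mxE big_ord1 !mxE eqxx mulr1n !mulrA. Qed.

Lemma tower_row_col : tower_row *m tower_col = 1%:M.
Proof.
apply/matrixP => i j; rewrite !mxE !ord1 eqxx mulr1n.
transitivity (\sum_(k < H) io (ind (lev k))).
  apply: eq_bigr => k _; rewrite !mxE mulrA -[_ * tz _ * tz _]mulrA zpowK // mulr1.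
  rewrite ioM; try exact: (lc_ind (lc_lev _)).
  by congr io; apply/funext => x; rewrite /ind -natrM mulnb andbb.
rewrite -io_sum => [|k]; last exact: (lc_ind (lc_lev k)).
rewrite -io1; congr io; apply/funext => x.
rewrite (bigD1 (Ordinal (level_lt x))) //= big1 => [|k kx].
  by rewrite /ind /lev eqxx addr0.
by rewrite /ind /lev; case: eqP => // e; case/eqP: kx; apply: val_inj.
Qed.

Lemma ind_mul_ne0 (P Q : X -> bool) x : (P x && Q x = false) -> ind P x * ind Q x = 0.
Proof. by rewrite /ind -natrM mulnb => ->. Qed.

Lemma tower_io f : LC f -> tower_ring (io f).
Proof.
move=> hf k l; have hl := lc_ind (lc_lev l); have hk := lc_ind (lc_lev k).
rewrite tower_entry (ioM hk hf) (ioM (lcM hk hf) hl).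
apply: lc_image_conj; first exact: (lcM (lcM hk hf) hl).
move=> kl x; rewrite mulrAC ind_mul_ne0 ?mul0r //.
by apply/negP => /andP[/eqP h1 /eqP h2]; move: kl; rewrite -h1 -h2 eqxx.
Qed.

Let nE : X -> bool := fun x => ~~ E x.
Let lc_nE : LC nE. Proof. exact: (lc_map negb hE). Qed.

(** Outside E the map T raises the level by exactly one, so only the entries with k = l + 1 survive,
    and in these the powers of t cancel. *)
Lemma tower_shift : tower_ring (t * io (ind nE)).
Proof.
have hn := lc_ind lc_nE => k l; rewrite tower_entry.
have hl := lc_ind (lc_lev l); have hk := lc_ind (lc_lev k).
have -> : io (ind (lev k)) * (t * io (ind nE)) * io (ind (lev l)) =
    io (fun x => ind (lev k) x * (ind nE (Tinv x) * ind (lev l) (Tinv x))) * tz 1.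
  rewrite -!mulrA (ioM hn hl) -[t]/(tz 1) (tz_io _ (lcM hn hl)).
  by rewrite mulrA ioM //; exact: (lc_iterz (- 1) (lcM hn hl)).
rewrite -!mulrA -zpowD // mulrA.
apply: lc_image_conj.
  exact: (lcM hk (lc_iterz (- 1) (lcM hn hl))).
move=> kl x; rewrite /ind -!natrM !mulnb /lev.
case: eqP => //= hk'; case: (boolP (nE _)) => //= hx; case: eqP => //= hl'.
by move: kl; rewrite -hk' -hl' -{1}(TK x) levelS // intS eqxx.
Qed.

Lemma tower_unshift : tower_ring (io (ind nE) * tinv).
Proof.
have hn := lc_ind lc_nE => k l; rewrite tower_entry.
have hl := lc_ind (lc_lev l); have hk := lc_ind (lc_lev k).
have -> : io (ind (lev k)) * (io (ind nE) * tinv) * io (ind (lev l)) =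
    io (fun x => ind (lev k) x * ind nE x * ind (lev l) (T x)) * tz (- 1).
  rewrite mulrA (ioM hk hn) -mulrA -[tinv]/(tz (- 1)) (tz_io _ hl) mulrA.
  by rewrite (ioM (lcM hk hn) (lc_iterz 1 hl)).
rewrite -!mulrA -zpowD // mulrA.
apply: lc_image_conj.
  exact: (lcM (lcM hk hn) (lc_iterz 1 hl)).
move=> kl x; rewrite /ind -!natrM !mulnb /lev.
case: eqP => //= hk'; case: (boolP (nE _)) => //= hx; case: eqP => //= hl'.
by move: kl; rewrite -hk' -hl' levelS // intS addKr eqxx.
Qed.

Lemma tower_subring : subring_prop tower_ring.
Proof.
apply: corner_subring => //; [exact: lc_imageB | exact: lc_imageM | exact: tower_row_col |].
move=> k l; have := @tower_io (fun=> 1) (lc_cst _) k l.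
by rewrite io1 mulmx1.
Qed.

Lemma tower_regular x : tower_ring x -> exists2 y, tower_ring y & x * y * x = x.
Proof.
apply: corner_regular; [exact: lc_imageB | exact: lc_imageM | exact: lc_image_regular | exact: tower_row_col |].
move=> k l; have := @tower_io (fun=> 1) (lc_cst _) k l.
by rewrite io1 mulmx1.
Qed.

End Tower.


(* The pairs (f_i, n_i) stand for \sum_i f_i t^n_i; exponents may be repeated. *)
Definition val_terms (s : seq ((X -> K) * int)) : A := \sum_(u <- s) io u.1 * tz u.2.
Definition lc_terms (s : seq ((X -> K) * int)) := forall u, List.In u s -> LC u.1.

Lemma terms_ex a : exists2 s, lc_terms s & a = val_terms s.
Proof.
case: hA => _ [_ [_ [_ [_ [_ [h _]]]]]]; have [N [f [hf ->]]] := h a.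
exists [seq (f i, (i : nat)%:Z - N%:Z) | i <- enum 'I_(N + N).+1].
  move=> u; elim: (enum _) => //= i s IH [<-|/IH //]; exact: hf.
by rewrite /val_terms big_map big_enum.
Qed.

Lemma rk1_exp (rk : rank_fun A) (a b : A) n : prank rk ->
  rk1 rk (a ^+ n - b ^+ n) <= n%:R * rk1 rk (a - b).
Proof.
move=> rkP; elim: n => [|n IH]; first by rewrite !expr0 subrr rk1_0 // mul0r.
have -> : a ^+ n.+1 - b ^+ n.+1 = a * (a ^+ n - b ^+ n) + (a - b) * b ^+ n.
  by rewrite mulrBr mulrBl !exprS addrA subrK.
apply: le_trans (rk1D rkP _ _) _; rewrite -natr1 [leRHS]mulrDl mul1r; apply: lerD.
  exact: le_trans (rk1_mulr rkP _ _) IH.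
exact: rk1_mull.
Qed.

(* t is replaced by its compression t (1 - 1_E) to the towers, at the cost of rank rk(1_E). *)
Lemma approx_towers D Ms (e : real) : 0 < e ->
  exists2 h : real, 0 < h & forall rk : rank_fun A, prank rk ->
  (exists (E : X -> bool) (H : nat),
     [/\ LC E, (forall x, exists k, (k < H)%N && E (Tz (- k.+1%:Z) x))
       & rk1 rk (io (ind E)) <= h]) ->
  approx rk D Ms e.
Proof.
move=> e0; have [L [h [h0 happ]]] := @approx_subring A D Ms e e0.
(* Replacing t by its compression in t^n costs |n| times the rank of the difference, by telescoping;
   [wt] adds up these costs. *)
pose wt (s : seq ((X -> K) * int)) := (\sum_(u <- s) `|u.2|)%N.
have [N hN] : exists N : nat, forall a, a \in L -> exists2 s, lc_terms s & a = val_terms s /\ (wt s <= N)%N.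
  elim: (L) => [|a l [N hN]]; first by exists 0%N.
  have [s hs es] := terms_ex a; exists (maxn (wt s) N) => b.
  rewrite inE => /orP[/eqP ->|/hN [r hr [er wr]]].
    by exists s => //; split=> //; exact: leq_maxl.
  by exists r => //; split=> //; apply: leq_trans wr _; exact: leq_maxr.
have h'0 : 0 < h / N.+1%:R by rewrite divr_gt0 ?ltr0n.
exists (h / N.+1%:R) => // rk rkP [E [H [hE hH rE]]]; apply: happ => //.
have hnE : LC (fun x => ~~ E x) by exact: (lc_map negb hE).
pose u := t * io (ind (fun x => ~~ E x)); pose u' := io (ind (fun x => ~~ E x)) * tinv.
have compl : 1 - io (ind (fun x => ~~ E x)) = io (ind E).
  rewrite -io1 -ioB; [|exact: lc_cst|exact: lc_ind].
  by congr io; apply/funext => x; rewrite /ind; case: (E x); rewrite ?subr0 ?subrr.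
have ru : rk1 rk (t - u) <= h / N.+1%:R.
  have -> : t - u = t * io (ind E) by rewrite -compl mulrBr mulr1.
  exact: le_trans (rk1_mulr rkP _ _) rE.
have ru' : rk1 rk (tinv - u') <= h / N.+1%:R.
  have -> : tinv - u' = io (ind E) * tinv by rewrite -compl mulrBl mul1r.
  exact: le_trans (rk1_mull rkP _ _) rE.
pose B := tower_ring hH; have [B1 BB BM] := tower_subring hE hH.
have B0 : B 0 by rewrite -(subrr 1); exact: BB.
have BD x y : B x -> B y -> B (x + y).
  by move=> hx hy; rewrite -[y]opprK -[- y]add0r; apply: (BB) => //; exact: BB.
have BX x n : B x -> B (x ^+ n).
  by move=> hx; elim: n => [|n IH]; rewrite ?expr0 ?exprS //; exact: BM.
exists B; split; [exact: tower_subring | exact: tower_regular |].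
move=> a /hN [s hs [-> ws]]; exists (\sum_(w <- s) io w.1 * zpow u u' w.2).
  elim: s hs {ws} => [|w s IH] hs; first by rewrite big_nil.
  rewrite big_cons; apply: BD; last by apply: IH => v hv; apply: hs; right.
  apply: BM; first by apply: tower_io => //; apply: hs; left.
  by rewrite /zpow; case: w.2 => n; apply: BX; [exact: tower_shift | exact: tower_unshift].
rewrite /val_terms -sumrB; apply: le_trans (rk1_sum rkP _ _ _) _.
apply: (@le_trans _ _ ((wt s)%:R * (h / N.+1%:R))); last first.
  rewrite mulrCA ger_pMr // ler_pdivrMr ?ltr0n // mul1r ler_nat.
  exact: leq_trans ws _.
rewrite /wt natr_sum mulr_suml; apply: ler_sum => w _.
rewrite -mulrBr; apply: le_trans (rk1_mulr rkP _ _) _.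
rewrite /zpow; case: w.2 => n /=.
  by apply: le_trans (rk1_exp _ _ _ rkP) _; rewrite ler_wpM2l ?ler0n.
by apply: le_trans (rk1_exp _ _ _ rkP) _; rewrite ler_wpM2l ?ler0n.
Qed.


Lemma eq_big_In (V : nmodType) (I : Type) (s : seq I) (F G : I -> V) :
  (forall u, List.In u s -> F u = G u) -> \sum_(u <- s) F u = \sum_(u <- s) G u.
Proof.
elim: s => [|u s IH] h; first by rewrite !big_nil.
by rewrite !big_cons h ?IH //; [move=> v hv; apply: h; right | left].
Qed.

Lemma In_leq_bigmax (I : Type) (s : seq I) (F : I -> nat) u :
  List.In u s -> (F u <= \max_(v <- s) F v)%N.
Proof.
elim: s => //= v s IH [->|/IH h]; rewrite big_cons leq_max ?leqnn //.
by rewrite h orbT.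
Qed.

(** D bounds the exponents of a, so a only links points of an orbit at distance at most D in
    time. *)
Lemma local_elt a : exists D : nat, forall P Q : X -> bool, LC P -> LC Q ->
  (forall z x, (absz z <= D)%N -> P x -> Q (Tz z x)) ->
  io (ind P) * a = io (ind P) * a * io (ind Q).
Proof.
have [s hs ->] := terms_ex a; exists (\max_(u <- s) absz u.2)%N => P Q hP hQ hPQ.
rewrite /val_terms mulr_sumr mulr_suml; apply: eq_big_In => u us.
have hu := hs u us; have iP := lc_ind hP; have iQ := lc_ind hQ.
rewrite -[RHS]mulrA -[_ * _ * io (ind Q)]mulrA (tz_io _ iQ) (mulrA (io u.1)).
rewrite (ioM hu (lc_iterz _ iQ)) !mulrA (ioM iP hu) (ioM iP (lcM hu (lc_iterz _ iQ))).
congr (io _ * _); apply/funext => x; rewrite /ind.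
case: (boolP (P x)) => [Px|_]; last by rewrite !mul0r.
by rewrite hPQ ?mulr1 // abszN; exact: (In_leq_bigmax (fun v => absz v.2)).
Qed.

Lemma local_mx m n (M : 'M[A]_(m, n)) : exists D : nat, forall P Q : X -> bool, LC P -> LC Q ->
  (forall z x, (absz z <= D)%N -> P x -> Q (Tz z x)) ->
  (io (ind P))%:M *m M = (io (ind P))%:M *m M *m (io (ind Q))%:M.
Proof.
have /choice [D hD] : forall ij : 'I_m * 'I_n, exists D : nat, forall P Q : X -> bool, LC P -> LC Q ->
  (forall z x, (absz z <= D)%N -> P x -> Q (Tz z x)) ->
  io (ind P) * M ij.1 ij.2 = io (ind P) * M ij.1 ij.2 * io (ind Q).
  by move=> ij; exact: local_elt.
exists (\max_ij D ij)%N => P Q hP hQ hPQ; apply/matrixP => i j.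
rewrite mulmx_scalarE mul_scalarE; apply: (hD (i, j)) => // z x hz; apply: hPQ.
exact: leq_trans hz (leq_bigmax (i, j)).
Qed.

(** * Splitting off a periodic orbit *)

Section Split.
Variables (rk : rank_fun A) (V : nat -> X -> bool).
Hypotheses (rkP : prank rk) (hV : forall n, LC (V n)).
(** Invariance up to a change of index; the case z = 0 says that the sets decrease. *)
Hypothesis V_shift : forall n D z x, (absz z <= D)%N -> V (n + D)%N x -> V n (Tz z x).

Let W n x := ~~ V n x.
Let hW n : LC (W n). Proof. exact: (lc_map negb (hV n)). Qed.

Let V_mono n m x : (n <= m)%N -> V m x -> V n x.
Proof.
move=> nm; rewrite -(subnKC nm) => h; exact: (@V_shift n (m - n)%N 0 x isT h).
Qed.

Let W_shift n D z x : (absz z <= D)%N -> W n x -> W (n + D)%N (Tz z x).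
Proof.
move=> hz; apply: contra => h; rewrite -(iterzNK TK TinvK z x).
by apply: V_shift h; rewrite abszN.
Qed.

Let io_indM (P Q : X -> bool) : LC P -> LC Q ->
  io (ind P) * io (ind Q) = io (ind (fun x => P x && Q x)).
Proof.
move=> hP hQ; rewrite ioM; try exact: lc_ind.
by congr io; apply/funext => x; rewrite /ind -natrM mulnb.
Qed.

Let compl n : io (ind (W n)) = 1 - io (ind (V n)).
Proof.
rewrite -io1 -ioB; [|exact: lc_cst|exact: lc_ind].
by congr io; apply/funext => x; rewrite /ind /W; case: (V n x); rewrite ?subr0 ?subrr.
Qed.

Let rkV k m n (M : 'M[A]_(m, n)) := rk ((io (ind (V k)))%:M *m M).
Let rkW k m n (M : 'M[A]_(m, n)) := rk ((io (ind (W k)))%:M *m M).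

Let rkV_dec k m n (M : 'M[A]_(m, n)) : rkV k.+1 M <= rkV k M.
Proof.
rewrite /rkV; have -> : io (ind (V k.+1)) = io (ind (V k.+1)) * io (ind (V k)).
  rewrite io_indM //; congr io; apply/funext => x; rewrite /ind.
  by case: (boolP (V k.+1 x)) => //= h; rewrite (V_mono (leqnSn k)).
by rewrite scalar_mxM -mulmxA; exact: (prk_mulr rkP).
Qed.

Let rkW_inc k m n (M : 'M[A]_(m, n)) : rkW k M <= rkW k.+1 M.
Proof.
rewrite /rkW; have -> : io (ind (W k)) = io (ind (W k)) * io (ind (W k.+1)).
  rewrite io_indM //; congr io; apply/funext => x; rewrite /ind.
  case: (boolP (W k x)) => //= h.
  by have := @W_shift k 1 0 x isT h; rewrite addn1 => ->.
by rewrite scalar_mxM -mulmxA; exact: (prk_mulr rkP).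
Qed.

(* rho is the part of rk carried by the invariant set \bigcap_n V n, and rk' the rest. *)
Lemma rank_split : exists rho rk' : rank_fun A,
  [/\ prank rho, prank rk', (forall m n (M : 'M_(m, n)), rk M = rk' m n M + rho m n M),
      (forall m n (M : 'M_(m, n)), conv (fun k => rkV k M) (rho m n M))
    & conv (fun k => rk1 rk' (io (ind (V k)))) 0].
Proof.
have /choice [rho0 hrho0] : forall M : matr A, exists l, conv (fun k => rkV k (matr_mx M)) l.
  move=> M; apply: conv_decreasing => n; first exact: rkV_dec.
  exact: (prk_ge0 rkP).
have /choice [rk'0 hrk'0] : forall M : matr A, exists l, conv (fun k => rkW k (matr_mx M)) l.
  move=> M; apply: (@conv_increasing _ (rk_matr rk M)) => n; first exact: rkW_inc.
  exact: (prk_mulr rkP).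
pose rho : rank_fun A := fun m n M => rho0 (to_matr M).
pose rk' : rank_fun A := fun m n M => rk'0 (to_matr M).
have hrho m n (M : 'M_(m, n)) : conv (fun k => rkV k M) (rho m n M) by exact: (hrho0 (to_matr M)).
have hrk' m n (M : 'M_(m, n)) : conv (fun k => rkW k M) (rk' m n M) by exact: (hrk'0 (to_matr M)).
have rhoP : prank rho.
  apply: (limit_prank rkP hrho) => m n M; have [D hD] := local_mx M.
  exists D, 0%N => k; rewrite addn0; apply: hD => // z x; exact: V_shift.
have rk'P : prank rk'.
  apply: (limit_prank rkP hrk') => m n M; have [D hD] := local_mx M.
  exists 0%N, D => k; rewrite addn0; apply: hD => // z x; exact: W_shift.
have split m n (M : 'M_(m, n)) : rk M = rk' m n M + rho m n M.
  apply/eqP; rewrite eq_le; apply/andP; split.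
    apply: (conv_le (conv_cst _) (convD (hrk' _ _ M) (hrho _ _ M))); exists 0%N => k _.
    have {1}-> : M = (io (ind (W k)))%:M *m M + (io (ind (V k)))%:M *m M.
      by rewrite -mulmxDl -raddfD compl subrK mul1mx.
    exact: prkD.
  (* The gap of 2 D between the indices leaves room for g = 1_V at index k + D: M carries W_k into 1
     - g and V_(k+2D) into g, so both pieces are cut from M at once as a block diagonal matrix. *)
  have [D hD] := local_mx M.
  apply: (conv_le (convD (hrk' _ _ M) (conv_shift (D + D)%N (hrho _ _ M))) (conv_cst _)).
  exists 0%N => k _; rewrite /rkW /rkV.
  set e := io (ind (W k)); set f := io (ind (V _)); pose g := io (ind (V (k + D)%N)).
  have e1 : e%:M *m M = e%:M *m M *m (1 - g)%:M.
    by rewrite -compl; apply: hD => // z x; exact: W_shift.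
  have f1 : f%:M *m M = f%:M *m M *m g%:M.
    by apply: hD => // z x hz; rewrite addnA; exact: V_shift.
  have gg : g * g = g.
    by rewrite io_indM //; congr io; apply/funext => x; rewrite /ind andbb.
  have g1 : (1 - g)%:M *m g%:M = 0 :> 'M_n.
    by rewrite -scalar_mxM mulrBl mul1r gg subrr raddf0.
  have g2 : g%:M *m (1 - g)%:M = 0 :> 'M_n.
    by rewrite -scalar_mxM mulrBr mulr1 gg subrr raddf0.
  rewrite -(prk_diag rkP).
  have -> : block_mx (e%:M *m M) 0 0 (f%:M *m M) =
     col_mx e%:M f%:M *m M *m row_mx (1 - g)%:M g%:M.
    have z1 : e%:M *m M *m g%:M = 0 by rewrite e1 -mulmxA g1 mulmx0.
    have z2 : f%:M *m M *m (1 - g)%:M = 0 by rewrite f1 -mulmxA g2 mulmx0.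
    by rewrite mul_col_mx mul_col_row -e1 -f1 z1 z2.
  exact: prk_mul3.
exists rho, rk'; split=> //.
(* All of rho is carried by each V k, so rk' of V k is rk of V k minus the limit of these
   numbers. *)
have rhoV k : rk1 rho (io (ind (V k))) = rk1 rho 1.
  apply: (conv_unique (conv_shift k (hrho _ _ ((io (ind (V k)))%:M : 'M_1)))) => e /(conv_shift k (hrho _ _ (1%:M : 'M_1))) [N hN].
  exists N => n /hN; rewrite /rkV /rk1 mulmx1 -scalar_mxM io_indM //.
  congr (`|rk (io _)%:M - _| <= _); apply/funext => x; rewrite /ind.
  by case: (boolP (V (n + k)%N x)) => //= h; rewrite (V_mono (leq_addl n k)).
move=> e /(hrho _ _ (1%:M : 'M_1)) [N hN]; exists N => n /hN; rewrite /rkV mulmx1 subr0.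
congr (_ <= _); congr `|_|; rewrite -/(rk1 rk _) -/(rk1 rho 1) -(rhoV n).
by rewrite /rk1 split addrK.
Qed.

End Split.


(** * Cylinder functions of a labelling *)

Section Label.
Variables (Y : eqType) (c : X -> Y).
Hypothesis hc : LC c.

(* f depends only on finitely many letters of the c-itinerary of x. *)
Definition cyl (Z : Type) (f : X -> Z) := exists m : nat, forall x x',
  (forall j, (absz j <= m)%N -> c (Tz j x) = c (Tz j x')) -> f x = f x'.

Lemma int_window (P : int -> Prop) n :
  (forall j : 'I_(n + n).+1, P ((j : nat)%:Z - n%:Z)) <-> (forall j, (absz j <= n)%N -> P j).
Proof.
split=> h j; last by apply: h; have := ltn_ord j; lia.
move=> hj; have lt : (absz (j + n%:Z)%R < (n + n).+1)%N by lia.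
have := h (Ordinal lt) => /=.
by have -> : (absz (j + n%:Z)%R)%:Z - n%:Z = j by lia.
Qed.

Lemma cyl_lc (Z : Type) (f : X -> Z) : cyl f -> LC f.
Proof.
move=> [m hm]; apply: (@lc_determined 'I_(m + m).+1 _ _ (fun j x => c (Tz ((j : nat)%:Z - m%:Z) x))).
  by move=> j; exact: lc_iterz.
by move=> x y /(int_window (fun j => c (Tz j y) = c (Tz j x))) e; exact: hm.
Qed.

Lemma cyl_cst (Z : Type) (z : Z) : cyl (fun=> z). Proof. by exists 0%N. Qed.

Lemma cyl_map2 (Z1 Z2 Z : Type) (h : Z1 -> Z2 -> Z) f g : cyl f -> cyl g ->
  cyl (fun x => h (f x) (g x)).
Proof.
move=> [m hm] [n hn]; exists (maxn m n) => x x' e; congr h.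
  by apply: hm => j hj; apply: e; rewrite leq_max hj.
by apply: hn => j hj; apply: e; rewrite leq_max hj orbT.
Qed.

Lemma cyl_map (Z1 Z : Type) (h : Z1 -> Z) f : cyl f -> cyl (fun x => h (f x)).
Proof. by move=> hf; exact: (cyl_map2 (fun a _ => h a) hf hf). Qed.

Lemma cylM f g : cyl f -> cyl g -> cyl (fun x => f x * g x : K).
Proof. exact: cyl_map2. Qed.

Lemma cyl_ind P : cyl P -> cyl (ind P).
Proof. exact: (cyl_map (fun b : bool => b%:R)). Qed.

Lemma cyl_iterz (Z : Type) (f : X -> Z) z : cyl f -> cyl (fun x => f (Tz z x)).
Proof.
move=> [m hm]; exists (m + absz z)%N => x x' e; apply: hm => j hj.
by rewrite -!(iterzD TK TinvK); apply: e; lia.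
Qed.

Lemma cyl_sum I (r : seq I) (F : I -> X -> K) : (forall i, cyl (F i)) ->
  cyl (fun x => \sum_(i <- r) F i x).
Proof.
move=> hF; elim: r => [|i r IH].
  by under eq_fun do rewrite big_nil; exact: cyl_cst.
by under eq_fun do rewrite big_cons; exact: (cyl_map2 +%R (hF i) IH).
Qed.

Definition window (n : nat) (x y : X) : bool :=
  [forall j : 'I_(n + n).+1, c (Tz ((j : nat)%:Z - n%:Z) x) == c (Tz ((j : nat)%:Z - n%:Z) y)].

Lemma windowP n x y : reflect (forall j, (absz j <= n)%N -> c (Tz j x) = c (Tz j y)) (window n x y).
Proof.
apply: (iffP forallP) => [h|/(int_window (fun j => c (Tz j x) = c (Tz j y))) h j]; last by apply/eqP.
by apply/(int_window (fun j => c (Tz j x) = c (Tz j y))) => j; apply/eqP; exact: h.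
Qed.

Lemma cyl_window n y : cyl (fun x => window n x y).
Proof.
exists n => x x' e; apply/windowP/windowP => h j hj; first by rewrite -e // h.
by rewrite e // h.
Qed.

(** * The action at a single periodic itinerary *)

Section Periodic.
Variables (x0 : X) (p : nat).
Hypothesis p0 : (0 < p)%N.
Hypothesis per : forall j, c (Tz (j + p%:Z) x0) = c (Tz j x0).
Hypothesis per_min : forall k : nat, (0 < k < p)%N -> exists j, c (Tz (j + k%:Z) x0) != c (Tz j x0).

Lemma per_mul j k : c (Tz (j + k * p%:Z) x0) = c (Tz j x0).
Proof.
elim/int_rect: k => [|k IH|k IH]; first by rewrite mul0r addr0.
  by rewrite intS mulrDl mul1r (addrC p%:Z) addrA per IH.
rewrite -IH -[LHS]per; congr (c (Tz _ x0)); rewrite intS; ring.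
Qed.

Lemma per_mod j j' : (p %| j - j')%Z -> c (Tz j x0) = c (Tz j' x0).
Proof.
by move=> /dvdzP[k e]; rewrite -(per_mul j' k) -e addrC subrK.
Qed.

(** Only the itinerary of x0 is periodic, the point itself need not be; this replaces T^p x0 =
    x0. *)
Lemma per_cyl (Z : Type) (f : X -> Z) j j' : cyl f -> (p %| j - j')%Z ->
  f (Tz j x0) = f (Tz j' x0).
Proof.
move=> [m hm] h; apply: hm => k _; rewrite -!(iterzD TK TinvK); apply: per_mod.
by rewrite opprD addrACA subrr add0r.
Qed.

(** Decreasing clopen neighbourhoods of the set of points sharing the itinerary of some T^i x0; they
    are the sets V n of the splitting. *)
Definition near_orbit n x := [exists i : 'I_p, window n x (Tz (i : nat)%:Z x0)].

Lemma near_orbitP n x : near_orbit n x <-> exists i : int, window n x (Tz i x0).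
Proof.
split=> [/existsP [i h]|[i /windowP h]]; first by exists (i : nat)%:Z.
have [lt rE] := absz_modz i p0.
apply/existsP; exists (Ordinal lt); apply/windowP => j hj /=.
rewrite h // rE -!(iterzD TK TinvK); apply: per_mod.
by rewrite opprD addrACA subrr add0r dvdz_sub_mod.
Qed.

Lemma cyl_near_orbit n : cyl (near_orbit n).
Proof.
exists n => x x' e; apply/idP/idP => /near_orbitP [i /windowP h]; apply/near_orbitP;
  exists i; apply/windowP => j hj; first by rewrite -e // h.
by rewrite e // h.
Qed.

Lemma near_orbit_shift n D z x : (absz z <= D)%N -> near_orbit (n + D)%N x -> near_orbit n (Tz z x).
Proof.
move=> hz /near_orbitP [i /windowP h]; apply/near_orbitP; exists (z + i); apply/windowP => j hj.
rewrite (iterzD TK TinvK z) -(iterzD TK TinvK j z x) -(iterzD TK TinvK j z) h //.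
by lia.
Qed.

Definition base : X -> bool := fun x => window p x x0.

Lemma cyl_base : cyl base. Proof. exact: cyl_window. Qed.

(** If the windows match, then k mod p is a period of the whole itinerary, because every index
    reduces modulo p into a window of radius p. Minimality of p leaves only the remainder 0. *)
Lemma base_orbit k : base (Tz k x0) = (p %| k)%Z.
Proof.
have pz : p%:Z != 0 by rewrite eqz_nat -lt0n.
apply/windowP/idP => [h|pk j _]; last first.
  by rewrite -(iterzD TK TinvK); apply: per_mod; rewrite addrAC subrr add0r.
rewrite -[(p %| k)%Z]negbK; apply/negP => npk.
set r := absz (k %% p)%Z.
have rE : r%:Z = (k %% p)%Z by rewrite gez0_abs ?modz_ge0.
have rp : (0 < r < p)%N.
  rewrite -!ltz_nat rE lt_def modz_ge0 // andbT.
  apply/andP; split; last by rewrite ltz_pmod.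
  by apply/eqP => e; apply: (negP npk); apply/dvdz_mod0P.
have [j] := per_min rp; rewrite rE => /eqP; apply.
set q := (j %% p)%Z.
have q0 : 0 <= q by rewrite modz_ge0.
have qp : q < p by rewrite ltz_pmod.
have hq : (absz q <= p)%N by lia.
have dq : (p %| j - q)%Z by exact: dvdz_sub_mod.
have dk : (p %| (k %% p)%Z - k)%Z by rewrite -opprB rpredN dvdz_sub_mod.
rewrite (@per_mod j q dq) -(h q hq) -(iterzD TK TinvK); apply: per_mod.
have -> : j + (k %% p)%Z - (q + k) = (j - q) + ((k %% p)%Z - k) by lia.
exact: rpredD.
Qed.

Lemma cyl_orbit (f : X -> K) : cyl f -> (forall i, f (Tz i x0) = 0) ->
  exists N, forall n, (N <= n)%N -> forall x, near_orbit n x -> f x = 0.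
Proof.
move=> [m hm] hf; exists m => n mn x /near_orbitP [i /windowP h].
rewrite -(hf i); apply: hm => j hj; apply: h; exact: leq_trans mn.
Qed.


Definition cyl_terms (s : seq ((X -> K) * int)) := forall u, List.In u s -> cyl u.1.

Lemma cyl_terms_lc s : cyl_terms s -> lc_terms s.
Proof. by move=> h u /h; exact: cyl_lc. Qed.

(* The matrix of \sum f t^n on the periodic itinerary of x0, in the basis of p levels, with
   t^p acting on the base as a variable whose q-th power times k is [g q k]. *)
Definition orbit_mx (W : zmodType) (g : int -> K -> W) (s : seq ((X -> K) * int)) : 'M[W]_p :=
  \matrix_(a, b) \sum_(u <- s)
    if (p %| u.2 + (b : nat)%:Z - (a : nat)%:Z)%Z
    then g ((u.2 + (b : nat)%:Z - (a : nat)%:Z) %/ p)%Z (u.1 (Tz (a : nat)%:Z x0)) else 0.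

(* Only meaningful for q >= 0. *)
Definition monomial (q : int) (k : K) : {poly K} := k *: 'X^(absz q).

Section Core.
Variables (rho : rank_fun A) (Q : pzRingType) (pi : {rmorphism A -> Q}) (rq : rank_fun Q).
Hypotheses (rqP : prank rq) (rqE : forall m n (M : 'M_(m, n)), rq (map_mx pi M) = rho M).
Hypothesis hnull : forall f, cyl f -> (forall i, f (Tz i x0) = 0) -> pi (io f) = 0.

Let e := io (ind base).

Lemma pi_io_eq f g : cyl f -> cyl g -> (forall i, f (Tz i x0) = g (Tz i x0)) ->
  pi (io f) = pi (io g).
Proof.
move=> hf hg h; apply/eqP; rewrite -subr_eq0 -rmorphB -ioB; try exact: cyl_lc.
apply/eqP; apply: hnull => [|i]; first exact: (cyl_map2 (fun a b => a - b) hf hg).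
by rewrite h subrr.
Qed.

Let cyl_e : cyl (ind base). Proof. exact/cyl_ind/cyl_base. Qed.

(** Modulo null elements the base returns to itself only at times divisible by p, and f has the
    single value [f x0] on it. *)
Lemma pi_corner f w : cyl f -> pi (e * io f * tz w * e) =
  if (p %| w)%Z then pi (io (fun=> f x0) * e * tz w) else 0.
Proof.
move=> hf; have hf' := cyl_lc hf; have he := cyl_lc cyl_e.
have hew := cyl_iterz (- w) cyl_e.
rewrite /e -mulrA (tz_io w he) mulrA (ioM he hf') (ioM (lcM he hf') (cyl_lc hew)).
have hcf : cyl (fun=> f x0) by exact: cyl_cst.
have eqf i : f (Tz i x0) = f (Tz i x0) by [].
case: ifP => pw.
  rewrite (ioM (cyl_lc hcf) he) !rmorphM; congr (_ * _).
  apply: pi_io_eq => [||i]; [exact: cylM (cylM cyl_e hf) hew | exact: cylM hcf cyl_e |].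
  rewrite /ind -(iterzD TK TinvK) !base_orbit.
  have -> : (p %| - w + i)%Z = (p %| i)%Z by rewrite addrC rpredBr.
  case: (boolP (p %| i)%Z) => pi'; rewrite ?(mul0r, mulr0) // ?mulr1 ?mul1r.
  rewrite -[x0 in RHS]/(Tz 0 x0); apply: (per_cyl hf); by rewrite subr0.
rewrite rmorphM hnull ?mul0r // => [|i]; first exact: cylM (cylM cyl_e hf) hew.
rewrite /ind -(iterzD TK TinvK) !base_orbit.
case: (boolP (p %| i)%Z) => pi'; rewrite ?(mul0r, mulr0) //.
by rewrite rpredDr // rpredN pw mulr0.
Qed.

Lemma pi_partition : \sum_(a < p) pi (tz (a : nat)%:Z * e * tz (- (a : nat)%:Z)) = 1.
Proof.
have he := cyl_lc cyl_e.
transitivity (pi (io (fun x => \sum_(a < p) ind base (Tz (- (a : nat)%:Z) x)))).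
  rewrite io_sum => [|a]; last exact: lc_iterz.
  rewrite rmorph_sum; apply: eq_bigr => a _; congr (pi _).
  by rewrite /e tz_io // -mulrA zpowK // mulr1.
rewrite -(rmorph1 pi) -io1; apply: pi_io_eq => [||i].
- by apply: cyl_sum => a; exact: cyl_iterz.
- exact: cyl_cst.
have [lt rE] := absz_modz i p0.
rewrite (bigD1 (Ordinal lt)) //= big1 => [|a an].
  rewrite addr0 /ind -(iterzD TK TinvK) base_orbit rE.
  by rewrite {2}(divz_eq i p) addrCA addNr addr0 dvdz_mull.
rewrite /ind -(iterzD TK TinvK) base_orbit.
case: (boolP (_ %| _)%Z) => // h; case/eqP: an; apply: val_inj => /=.
have ha : (a : nat)%:Z = (i %% p)%Z.
  have : ((a : nat)%:Z == i %[mod p])%Z by rewrite eqz_mod_dvd -rpredN opprB addrC.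
  by move=> /eqP <-; rewrite modz_small //= ltz_nat ltn_ord.
by rewrite -ha.
Qed.

Let ee : e * e = e.
Proof.
have he := cyl_lc cyl_e; rewrite /e ioM //; congr io; apply/funext => x.
by rewrite /ind -natrM mulnb andbb.
Qed.

(* Here [sg] is P |-> rho (e P(t^p)), with e the indicator of the base: modulo rho-null elements
   the levels t^a e t^-a (a < p) are a partition of 1 and t^p commutes with e. *)
Lemma rank_on_orbit : (1 : Q) != 0 -> exists sg : rank_fun {poly K},
  [/\ prank sg, rk1 sg 'X = rk1 sg 1
    & forall m n (M : 'M[A]_(m, n)) (S : 'I_m -> 'I_n -> seq ((X -> K) * int)),
      (forall i j, M i j = val_terms (S i j)) -> (forall i j, cyl_terms (S i j)) ->
      (forall i j u, List.In u (S i j) -> p%:Z <= u.2) ->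
      rho M = sg _ _ (flat (\matrix_(i, j) orbit_mx monomial (S i j)))].
Proof.
move=> q1.
pose kap (k : K) : Q := pi (io (fun=> k)).
have kB : zmod_morphism kap.
  by move=> a b; rewrite /kap -rmorphB -ioB //; exact: lc_cst.
have kM : monoid_morphism kap.
  split; first by rewrite /kap io1 rmorph1.
  by move=> a b; rewrite /kap -rmorphM ioM //; exact: lc_cst.
pose kapr : {rmorphism K -> Q} := HB.pack kap
  (GRing.isZmodMorphism.Build K Q kap kB) (GRing.isMonoidMorphism.Build K Q kap kM).
have kC z k : kap k * pi (tz z) = pi (tz z) * kap k.
  by rewrite /kap -!rmorphM tz_io //; exact: lc_cst.
have kE k : kap k * pi e = pi e * kap k.
  have he := cyl_lc cyl_e; have hk := @lc_cst K k.
  by rewrite /kap -!rmorphM /e !ioM //; congr (pi (io _)); apply/funext => x; rewrite mulrC.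
have [ev [evX evC]] := @poly_eval_ex Q K kapr (pi (tz p%:Z)) q1 (kC p%:Z).
have tzX q : pi (tz p%:Z) ^+ q = pi (tz (p * q)%:Z).
  elim: q => [|q IH]; first by rewrite muln0 expr0 rmorph1.
  by rewrite exprS IH -rmorphM -zpowD // mulnS PoszD.
have evM k q : ev (k *: 'X^q) = kap k * pi (tz (p * q)%:Z).
  by rewrite -mul_polyC rmorphM rmorphXn /= evX evC tzX.
have corner1 w : (p %| w)%Z -> pi e * pi (tz w) * pi e = pi e * pi (tz w).
  move=> pw; have := @pi_corner (fun=> 1) w (cyl_cst _).
  by rewrite pw io1 mulr1 mul1r !rmorphM.
have evE (P : {poly K}) : pi e * ev P = pi e * ev P * pi e.
  rewrite -[P]coefK poly_def rmorph_sum mulr_sumr mulr_suml; apply: eq_bigr => i _.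
  rewrite evM mulrA -[in RHS]mulrA -kE -!mulrA; congr (_ * _).
  by rewrite mulrA corner1 // PoszM dvdz_mulr.
pose sg : rank_fun {poly K} := fun m n M => rq ((pi e)%:M *m map_mx ev M).
have sgP : prank sg by exact: corner_prank.
exists sg; split=> //.
  have s1 P : rk1 sg P = rk1 rq (pi e * ev P) by rewrite /rk1 /sg map_scalar_mx -scalar_mxM.
  rewrite !s1 evX rmorph1 mulr1; apply/eqP; rewrite eq_le rk1_mull //=.
  rewrite -{1}[pi e]mulr1 -(rmorph1 pi) -(zpowK tV Vt p%:Z) rmorphM mulrA.
  exact: rk1_mull.
move=> m n M S hM hS hz.
(* Change of coordinates that moves each of the p levels to the base; since [Um k *m Vm k] is the
   identity, it preserves ranks. *)
pose Um k : 'M[Q]_(k, k * p) := \matrix_(i, l)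
  if i == (unidx l).1 then pi (tz ((unidx l).2 : nat)%:Z) * pi e else 0.
pose Vm k : 'M[Q]_(k * p, k) := \matrix_(l, i)
  if i == (unidx l).1 then pi e * pi (tz (- ((unidx l).2 : nat)%:Z)) else 0.
have UV k : Um k *m Vm k = 1%:M.
  apply/matrixP => i i'; rewrite !mxE sum_mxvec_index (bigD1 i) //= [X in _ + X]big1 => [|j ji].
    rewrite addr0; have [->|ii'] := eqVneq i i'.
      rewrite -pi_partition; apply: eq_bigr => a _; rewrite !mxE !mxvec_indexK /= !eqxx.
      by rewrite -!rmorphM !mulrA -[_ * e * e]mulrA ee.
    by rewrite big1 // => a _; rewrite !mxE !mxvec_indexK /= eq_sym (negPf ii') mulr0.
  by rewrite big1 // => a _; rewrite !mxE !mxvec_indexK /= eq_sym (negPf ji) mul0r.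
have VMU (N : 'M[Q]_(m, n)) i a j b : (Vm m *m N *m Um n) (mxvec_index i a) (mxvec_index j b) =
    pi e * pi (tz (- (a : nat)%:Z)) * N i j * pi (tz (b : nat)%:Z) * pi e.
  rewrite mxE (bigD1 j) //= big1 => [|j' jj'].
    rewrite addr0 !mxE mxvec_indexK /= eqxx (bigD1 i) //= big1 => [|i' ii'].
      by rewrite addr0 mxE mxvec_indexK /= eqxx !mulrA.
    by rewrite mxE mxvec_indexK /= (negPf ii') mul0r.
  by rewrite [X in _ * X]mxE mxvec_indexK /= (negPf jj') mulr0.
rewrite -rqE; transitivity (rq (Vm m *m map_mx pi M *m Um n)).
  apply/eqP; rewrite eq_le; apply/andP; split; last exact: prk_mul3.
  have {1}-> : map_mx pi M = Um m *m (Vm m *m map_mx pi M *m Um n) *m Vm n.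
    by rewrite !mulmxA UV mul1mx -mulmxA UV mulmx1.
  exact: prk_mul3.
rewrite /sg; congr (rq _); apply/matrixP => k l.
case/mxvec_indexP: k => i a; case/mxvec_indexP: l => j b.
rewrite VMU mul_scalarE !mxE !mxvec_indexK /= ?mxE hM.
rewrite /val_terms rmorph_sum [in RHS]rmorph_sum !mulr_sumr !mulr_suml /=.
apply: eq_big_In => u us; set w := u.2 + _ - _.
have hu := hS i j u us; have hu' := cyl_lc hu.
transitivity (pi (e * io (fun x => u.1 (Tz (a : nat)%:Z x)) * tz w * e)).
  rewrite -!rmorphM; congr (pi _); rewrite -!mulrA; congr (_ * _).
  rewrite !mulrA (tz_io _ hu') opprK -!mulrA; congr (_ * _).
  by rewrite !mulrA -!zpowD //; congr (tz _ * _); rewrite /w [RHS]addrC addrA.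
rewrite pi_corner; last exact: cyl_iterz.
case: ifP => pw; last by rewrite rmorph0 mulr0.
(* Exponents are at least p while the level a is less than p, so only nonnegative powers of t^p
   occur and the entries are polynomials. *)
have w0 : 0 <= w.
  by have := hz i j u us; have := ltn_ord a; rewrite /w; lia.
rewrite /monomial evM mulrA -kE -mulrA !rmorphM -mulrA; congr (_ * (_ * pi (tz _))).
have q0 : 0 <= (w %/ p)%Z by rewrite divz_ge0.
by rewrite -[RHS]/(p%:Z * (absz (w %/ p)%Z)%:Z) gez0_abs // mulrC divzK.
Qed.

End Core.


(** * Extending representations of K[X] to the elements with cylinder coefficients *)

Definition cyl_elt a := exists2 s, cyl_terms s & a = val_terms s.

Definition mul_terms (s s' : seq ((X -> K) * int)) :=
  [seq ((fun x => u.1 x * v.1 (Tz (- u.2) x)), u.2 + v.2) | u <- s, v <- s'].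

Definition opp_terms (s : seq ((X -> K) * int)) := [seq ((fun x => - u.1 x), u.2) | u <- s].

Lemma In_map (I J : Type) (h : I -> J) (s : seq I) v :
  List.In v (map h s) -> exists2 u, List.In u s & v = h u.
Proof. by elim: s => //= u s IH [<-|/IH [w hw ->]]; [exists u => //; left | exists w => //; right]. Qed.

Lemma In_cat (I : Type) (s s' : seq I) v : List.In v (s ++ s') -> List.In v s \/ List.In v s'.
Proof. exact: List.in_app_or. Qed.

Lemma cyl_terms_cat s s' : cyl_terms s -> cyl_terms s' -> cyl_terms (s ++ s').
Proof. by move=> h h' u hu; case: (In_cat hu) => ?; [exact: h | exact: h']. Qed.

Lemma cyl_terms_mul s s' : cyl_terms s -> cyl_terms s' -> cyl_terms (mul_terms s s').
Proof.
move=> hs hs' u; rewrite /mul_terms; elim: s hs => //= v s IH hs.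
move=> hu; case: (In_cat hu) => [h|]; last by apply: IH => y hy; apply: hs; right.
have [w hw ->] := In_map h.
by apply: cylM; [apply: hs; left | apply: cyl_iterz; exact: hs'].
Qed.

Lemma cyl_terms_opp s : cyl_terms s -> cyl_terms (opp_terms s).
Proof. by move=> hs u h; have [v hv ->] := In_map h; apply: (cyl_map -%R); exact: hs. Qed.

Lemma val_cat s s' : val_terms (s ++ s') = val_terms s + val_terms s'.
Proof. by rewrite /val_terms big_cat. Qed.

Lemma val_opp s : lc_terms s -> val_terms (opp_terms s) = - val_terms s.
Proof.
move=> hs; rewrite /val_terms big_map -sumrN; apply: eq_big_In => u /hs hu.
by rewrite ioN // mulNr.
Qed.

Lemma val_mul s s' : lc_terms s -> lc_terms s' -> val_terms (mul_terms s s') = val_terms s * val_terms s'.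
Proof.
move=> hs hs'; rewrite /val_terms /mul_terms big_allpairs_dep mulr_suml; apply: eq_big_In => u /hs hu.
rewrite mulr_sumr; apply: eq_big_In => v /hs' hv /=.
rewrite zpowD // -ioM //; last exact: lc_iterz.
by rewrite !mulrA -[io u.1 * io _ * _]mulrA -tz_io // !mulrA.
Qed.

Lemma regroup (V : nmodType) s N (H : (X -> K) * int -> V) :
  (forall u, List.In u s -> (absz u.2 <= N)%N) ->
  \sum_(u <- s) H u = \sum_(i < (N + N).+1) \sum_(u <- s | u.2 == (i : nat)%:Z - N%:Z) H u.
Proof.
move=> hN; rewrite (exchange_big_dep xpredT) //=; apply: eq_big_In => u /hN hu.
have lt : (absz (u.2 + N%:Z)%R < (N + N).+1)%N by lia.
rewrite (bigD1 (Ordinal lt)) /=; last by apply/eqP; lia.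
rewrite big1 ?addr0 // => i /andP[/eqP e /eqP ne]; case: ne; apply: val_inj => /=.
by lia.
Qed.

Lemma lc_sum_terms s (P : pred ((X -> K) * int)) : lc_terms s ->
  LC (fun x => \sum_(u <- s | P u) u.1 x) /\
  io (fun x => \sum_(u <- s | P u) u.1 x) = \sum_(u <- s | P u) io u.1.
Proof.
elim: s => [|u s IH] hs.
  by under eq_fun do rewrite big_nil; rewrite big_nil io0; split=> //; exact: lc_cst.
have [|h1 h2] := IH; first by move=> v hv; apply: hs; right.
have hu : LC u.1 by apply: hs; left.
under eq_fun do rewrite big_cons; rewrite big_cons; case: (P u) => //.
by split; [exact: lcD | rewrite ioD // h2].
Qed.

(** Uniqueness of coefficients adapted to repeated exponents: after grouping by exponent each
    coefficient sum vanishes, and G is additive in the coefficient. *)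
Lemma val_terms_eq0 s (V : zmodType) (G : int -> K -> V) y : lc_terms s -> val_terms s = 0 ->
  (forall z, zmod_morphism (G z)) -> \sum_(u <- s) G u.2 (u.1 y) = 0.
Proof.
move=> hs s0 hG; pose N := (\max_(u <- s) absz u.2)%N.
have hN u : List.In u s -> (absz u.2 <= N)%N by exact: (In_leq_bigmax (fun v => absz v.2)).
pose f (i : 'I_(N + N).+1) x := \sum_(u <- s | u.2 == (i : nat)%:Z - N%:Z) u.1 x.
have hf i : LC (f i) by case: (lc_sum_terms (fun u => u.2 == (i : nat)%:Z - N%:Z) hs).
have f0 : forall i x, f i x = 0.
  case: hA => _ [_ [_ [_ [_ [_ [_ h]]]]]]; apply: h => //.
  transitivity (val_terms s); last exact: s0.
  rewrite /val_terms (regroup _ hN); apply: eq_bigr => i _.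
  have [_ ->] := lc_sum_terms (fun u => u.2 == (i : nat)%:Z - N%:Z) hs.
  by rewrite mulr_suml; apply: eq_bigr => u /eqP ->.
rewrite (regroup _ hN) big1 // => i _.
pose Gi : {additive K -> V} := HB.pack (G ((i : nat)%:Z - N%:Z))
  (GRing.isZmodMorphism.Build K V (G ((i : nat)%:Z - N%:Z)) (hG _)).
transitivity (\sum_(u <- s | u.2 == (i : nat)%:Z - N%:Z) Gi (u.1 y)).
  by apply: eq_bigr => u /eqP ->.
by rewrite -raddf_sum -/(f i y) f0 raddf0.
Qed.

Section OrbitRep.
Variables (W : pzRingType) (g : int -> K -> W).
Hypotheses (gB : forall z, zmod_morphism (g z)) (g1 : g 0 1 = 1).
Hypothesis gM : forall z w a b, g z a * g w b = g (z + w) (a * b).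

Lemma orbit_mx_eq0 s : lc_terms s -> val_terms s = 0 -> orbit_mx g s = 0.
Proof.
move=> hs s0; apply/matrixP => a b; rewrite !mxE.
pose G z k := if (p %| z + (b : nat)%:Z - (a : nat)%:Z)%Z
    then g ((z + (b : nat)%:Z - (a : nat)%:Z) %/ p)%Z k else 0.
apply: (@val_terms_eq0 s W G (Tz (a : nat)%:Z x0) hs s0) => z x y; rewrite /G.
by case: ifP; rewrite ?subrr // => _; exact: gB.
Qed.

Lemma orbit_mx_cat s s' : orbit_mx g (s ++ s') = orbit_mx g s + orbit_mx g s'.
Proof. by apply/matrixP => a b; rewrite !mxE big_cat. Qed.

Lemma orbit_mx_opp s : orbit_mx g (opp_terms s) = - orbit_mx g s.
Proof.
apply/matrixP => a b; rewrite !mxE big_map -sumrN; apply: eq_bigr => u _ /=.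
by case: ifP; rewrite ?oppr0 // => _; rewrite -[- u.1 _]sub0r gB -{1}(subrr 0) gB subrr sub0r.
Qed.

Lemma orbit_mx_ext s s' : lc_terms s -> lc_terms s' -> val_terms s = val_terms s' ->
  orbit_mx g s = orbit_mx g s'.
Proof.
move=> hs hs' e; apply/eqP; rewrite -subr_eq0 -orbit_mx_opp -orbit_mx_cat; apply/eqP.
apply: orbit_mx_eq0; last by rewrite val_cat val_opp // e subrr.
move=> u hu; case: (In_cat hu) => [|h]; first exact: hs.
by have [v hv ->] := In_map h; apply: (lc_map -%R); exact: hs'.
Qed.

(** From level a, a term with exponent n passes through exactly one intermediate level r, the
    residue of a - n. The second factor is evaluated at T^(a - n) x0 on one side and at T^r x0 on
    the other, and a cylinder function does not distinguish them. *)
Lemma orbit_mx_mul s s' : cyl_terms s' ->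
  orbit_mx g (mul_terms s s') = orbit_mx g s * orbit_mx g s'.
Proof.
move=> hs'; apply/matrixP => a b; rewrite !mxE big_allpairs_dep.
under [RHS]eq_bigr do rewrite !mxE mulr_suml.
rewrite [RHS]exchange_big /=; apply: eq_bigr => u _.
under [RHS]eq_bigr do rewrite mulr_sumr.
rewrite [RHS]exchange_big /=; apply: eq_big_In => v /hs' hv.
have pz : p%:Z != 0 by rewrite eqz_nat -lt0n.
pose r := (((a : nat)%:Z - u.2) %% p)%Z.
have [lt rE] : (absz r < p)%N /\ (absz r)%:Z = r by exact: absz_modz.
have dr : (p %| u.2 + r - (a : nat)%:Z)%Z.
  by rewrite -rpredN opprB opprD addrA dvdz_sub_mod.
rewrite (bigD1 (Ordinal lt)) //= big1 => [|k kr]; last first.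
  case: ifP; rewrite ?mul0r // => h; case/eqP: kr; apply: val_inj => /=.
  have : ((k : nat)%:Z == r %[mod p])%Z.
    rewrite eqz_mod_dvd.
    have -> : (k : nat)%:Z - r = u.2 + (k : nat)%:Z - (a : nat)%:Z - (u.2 + r - (a : nat)%:Z) by lia.
    exact: rpredB.
  have hr : 0 <= r < p%:Z by rewrite modz_ge0 // ltz_pmod.
  have hk : 0 <= (k : nat)%:Z < p%:Z by rewrite ltz_nat ltn_ord.
  by rewrite (modz_small hk) (modz_small hr) => /eqP ek; lia.
rewrite addr0 rE dr.
have -> : u.2 + v.2 + (b : nat)%:Z - (a : nat)%:Z =
   (u.2 + r - (a : nat)%:Z) + (v.2 + (b : nat)%:Z - r) by lia.
have -> : (p %| u.2 + r - (a : nat)%:Z + (v.2 + (b : nat)%:Z - r))%Z = (p %| v.2 + (b : nat)%:Z - r)%Z.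
  exact: rpredDl.
case: ifP => h; last by rewrite mulr0.
rewrite gM divzDl //; congr (g _ (_ * _)).
rewrite -(iterzD TK TinvK) addrC; apply: (per_cyl hv).
exact: dvdz_sub_mod.
Qed.

Lemma orbit_mx_unit : orbit_mx g [:: ((fun=> 1), 0)] = 1.
Proof.
apply/matrixP => a b; rewrite !mxE big_seq1 /= add0r.
have [->|ab] := eqVneq a b; first by rewrite subrr dvdz0 div0z g1.
case: ifP => // h; case/eqP: ab; apply: val_inj => /=.
have : ((b : nat)%:Z == (a : nat)%:Z %[mod p])%Z by rewrite eqz_mod_dvd.
by rewrite /= !modz_nat !modn_small // => /eqP [].
Qed.

End OrbitRep.


Section Representation.
Variables (F : fieldType) (j : nat) (psi : {rmorphism {poly K} -> 'M[F]_j}).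
Hypothesis psiX : psi 'X \in unitmx.

(** The image of k (t^p)^q; it extends the image of [monomial] to negative q. *)
Definition rep_coef (q : int) (k : K) : 'M[F]_j :=
  psi k%:P * zpow (psi 'X) (invmx (psi 'X)) q.

Let SV : psi 'X * invmx (psi 'X) = 1. Proof. exact: mulmxV. Qed.
Let VS : invmx (psi 'X) * psi 'X = 1. Proof. exact: mulVmx. Qed.

Lemma rep_coefB z : zmod_morphism (rep_coef z).
Proof. by move=> x y; rewrite /rep_coef polyCB rmorphB mulrBl. Qed.

Lemma rep_coef1 : rep_coef 0 1 = 1.
Proof. by rewrite /rep_coef polyC1 rmorph1 mul1r /zpow. Qed.

Lemma rep_coefM z w a b : rep_coef z a * rep_coef w b = rep_coef (z + w) (a * b).
Proof.
have cX : psi b%:P * psi 'X = psi 'X * psi b%:P by rewrite -!rmorphM mulrC.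
have cV : psi b%:P * invmx (psi 'X) = invmx (psi 'X) * psi b%:P.
  by rewrite -[LHS]mul1r -VS -mulrA (mulrA (psi 'X)) -cX -!mulrA SV mulr1.
have cz : psi b%:P * zpow (psi 'X) (invmx (psi 'X)) z = zpow (psi 'X) (invmx (psi 'X)) z * psi b%:P.
  by rewrite /zpow; case: z => n; [exact: (commrX _ cX) | exact: (commrX _ cV)].
by rewrite /rep_coef -!mulrA (mulrA _ (psi b%:P)) -cz -mulrA -zpowD // !mulrA polyCM rmorphM.
Qed.

Lemma rep_coef_nat (q : int) k : 0 <= q -> psi (monomial q k) = rep_coef q k.
Proof.
case: q => // n _; rewrite /monomial /rep_coef /zpow -mul_polyC rmorphM rmorphXn //=.
Qed.

End Representation.

(** Right multiplication by the unit t^(p L): it clears negative exponents and leaves ranks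
    unchanged. *)
Definition shift_terms (s : seq ((X -> K) * int)) L := [seq (u.1, u.2 + p%:Z * L) | u <- s].

Lemma cyl_shift_terms s L : cyl_terms s -> cyl_terms (shift_terms s L).
Proof. by move=> hs u h; have [v hv ->] := In_map h; exact: (hs v hv). Qed.

Lemma val_shift s L : val_terms (shift_terms s L) = val_terms s * tz (p%:Z * L).
Proof.
rewrite /val_terms big_map mulr_suml; apply: eq_bigr => u _ /=.
by rewrite zpowD // mulrA.
Qed.

(** The error is 0 because [decomposition] reproduces the ranks of the given matrices exactly, and
    each representation of K[X] it provides respects the ring operations on cylinder elements. *)
Lemma peel_approx (rho : rank_fun A) D Ms : prank rho ->
  (forall f, cyl f -> (forall i, f (Tz i x0) = 0) -> rk1 rho (io f) = 0) ->
  (forall a, a \in D -> cyl_elt a) ->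
  (forall M, List.In M Ms -> forall i j, cyl_elt (matr_mx M i j)) ->
  approx rho D Ms 0.
Proof.
move=> rhoP hnull hD hMs.
have [Q [pi [rq [rqP pis rqE pi0]]]] := null_quotient rhoP.
(* If Q is the zero ring, then rho vanishes identically. *)
have [q1|q1] := eqVneq (1 : Q) 0.
  apply: (approx_eq _ (approx_zero D Ms)) => M _; rewrite /rk_matr -rqE.
  by rewrite [map_mx _ _](_ : _ = 0) ?prk0 //; apply/matrixP => i j; rewrite !mxE -[LHS]mulr1 q1 mulr0.
have [|sg [sgP sgX sgE]] := @rank_on_orbit rho Q pi rq rqP rqE _ q1.
  by move=> f hf h; apply/pi0/hnull.
have /choice [tm htm] : forall a, exists s, cyl_elt a -> cyl_terms s /\ a = val_terms s.
  move=> a; have [[s h1 h2]|h] := pselect (cyl_elt a); first by exists s.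
  by exists [::].
(* A shift by p times the largest exponent makes all exponents nonnegative; the successor adds the
   further p required by [rank_on_orbit]. *)
pose L (M : matr A) : int := (\max_(ij : 'I_(projT1 M).1 * 'I_(projT1 M).2)
  \max_(u <- tm (matr_mx M ij.1 ij.2)) absz u.2).+1.
pose ts (M : matr A) i j := shift_terms (tm (matr_mx M i j)) (L M).
pose P (M : matr A) := flat (\matrix_(i, j) orbit_mx monomial (ts M i j)).
have tsz M i j u : List.In u (ts M i j) -> p%:Z <= u.2.
  move=> h; have [v hv ->] := In_map h; rewrite /= /L.
  have h1 := In_leq_bigmax (fun v => absz v.2) hv.
  have h2 := leq_bigmax (i, j) (F := fun ij : 'I_(projT1 M).1 * 'I_(projT1 M).2 =>
    \max_(u <- tm (matr_mx M ij.1 ij.2)) absz u.2).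
  have {h1 h2} := leq_trans h1 h2; set B := (\max_ij _)%N => hB.
  have : (absz v.2 <= p * B)%N by apply: leq_trans hB _; rewrite leq_pmull.
  by nia.
have rhoE M : List.In M Ms -> rk_matr rho M = sg _ _ (P M).
  move=> hM; have hcM i j := htm _ (hMs M hM i j).
  rewrite /P -(sgE _ _ (matr_mx M *m (tz (p%:Z * L M))%:M)) //.
  - apply/eqP; rewrite eq_le (prk_mull rhoP) andbT /rk_matr -/(matr_mx M).
    have {1}-> : matr_mx M = matr_mx M *m (tz (p%:Z * L M))%:M *m (tz (- (p%:Z * L M)))%:M.
      by rewrite -mulmxA -scalar_mxM zpowK // mulmx1.
    exact: (prk_mull rhoP).
  - by move=> i j; rewrite mulmx_scalarE val_shift; case: (hcM i j) => _ {1}->.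
  - by move=> i j; apply: cyl_shift_terms; case: (hcM i j).
  - by move=> i j; exact: tsz.
have [s hs sE] := decomposition sgP sgX [seq to_matr (P M) | M <- Ms].
suff [R aR RE] : exists2 R : rank_fun A, approx R D Ms 0 &
    forall M, List.In M Ms -> rk_matr R M = s _ _ (P M).
  apply: (approx_eq _ aR) => M hM; rewrite RE // rhoE //.
  symmetry; apply: (sE (to_matr (P M))).
  exact: (List.in_map (fun M => to_matr (P M))).
elim: hs {sE} => [|F j psi wt {}s psiX wt0 _ [R aR RE]].
  exists (fun m n M => 0); first exact: approx_zero.
  by [].
pose g := rep_coef psi.
pose r1 : rank_fun 'M[F]_j := fun m n M => field_rank (flat M).
have r1P : prank r1 by exact: prank_matrix (@field_rank_prank F).
pose r2 : rank_fun 'M['M[F]_j]_p := fun m n M => wt * r1 _ _ (flat M).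
have r2P : prank r2 by apply: prank_scale => //; exact: prank_matrix.
(* The terms [tm a] are an arbitrary choice; [phiE] shows that on cylinder elements the matrix does
   not depend on it. *)
pose phi a := orbit_mx g (tm a).
have gB := rep_coefB psi; have g1 := rep_coef1 psi; have gM := rep_coefM psiX.
have phiE a u : cyl_elt a -> cyl_terms u -> a = val_terms u -> phi a = orbit_mx g u.
  move=> ha hu e; have [h1 h2] := htm a ha.
  by apply: orbit_mx_ext => //; [exact: cyl_terms_lc | exact: cyl_terms_lc | rewrite -h2].
exists (fun m n M => r2 _ _ (map_mx phi M) + R m n M).
  rewrite -[0]addr0; apply: approx_add => //.
  exists (Model r2 phi); split=> //=.
  - exact: vnr_matrix2.
  - have c1 : cyl_terms [:: ((fun=> 1 : K), 0)] by move=> u [<-|[]]; exact: cyl_cst.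
    have v1 : 1 = val_terms [:: ((fun=> 1 : K), 0)].
      by rewrite /val_terms big_seq1 /= io1 mul1r.
    rewrite (phiE _ _ _ c1 v1) ?orbit_mx_unit ?subrr ?rk1_0 //.
    by exists [:: ((fun=> 1 : K), 0)].
  - move=> a b /hD ha /hD hb; have [ca ea] := htm a ha; have [cb eb] := htm b hb.
    have cs : cyl_terms (tm a ++ opp_terms (tm b)).
      by apply: cyl_terms_cat => //; exact: cyl_terms_opp.
    have es : a - b = val_terms (tm a ++ opp_terms (tm b)).
      by rewrite val_cat val_opp; [rewrite -ea -eb | exact: cyl_terms_lc].
    have cp : cyl_terms (mul_terms (tm a) (tm b)) by exact: cyl_terms_mul.
    have ep : a * b = val_terms (mul_terms (tm a) (tm b)).
      by rewrite val_mul; [rewrite -ea -eb | exact: cyl_terms_lc | exact: cyl_terms_lc].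
    rewrite (phiE _ _ _ cs es); last by exists (tm a ++ opp_terms (tm b)).
    rewrite (phiE _ _ _ cp ep); last by exists (mul_terms (tm a) (tm b)).
    by rewrite orbit_mx_cat orbit_mx_opp // orbit_mx_mul // !subrr !rk1_0.
  - by move=> M _; rewrite /rk_matr subrr normr0.
move=> M hM; rewrite /rk_matr -/(rk_matr R M) RE //; congr (_ + _); congr (wt * _).
rewrite -/(r1 _ _ (flat _)) -/(r1 _ _ (map_mx psi _)).
(* The shift by t^(p L) becomes multiplication by a power of the invertible matrix [psi 'X], so it
   is undone here. *)
have -> : map_mx psi (P M) = flat (map_mx phi (matr_mx M)) *m (zpow (psi 'X) (invmx (psi 'X)) (L M))%:M.
  apply/matrixP => k l; case/mxvec_indexP: k => i a; case/mxvec_indexP: l => i' b.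
  rewrite mulmx_scalarE flatE mxE flatE !mxE rmorph_sum big_map mulr_suml.
  apply: eq_big_In => u hu /=; set w := u.2 + _ - _; set w' := u.2 + _ + _ - _.
  have ew : w' = w + L M * p%:Z by rewrite /w' /w; ring.
  have -> : (p %| w')%Z = (p %| w)%Z by rewrite ew rpredDr // dvdz_mull.
  case: ifP => pw; last by rewrite rmorph0 mul0r.
  have pz : p%:Z != 0 by rewrite eqz_nat -lt0n.
  have w'0 : 0 <= w'.
    have := tsz M i i' (u.1, u.2 + p%:Z * L M); rewrite /ts /shift_terms => /(_ _)/wrap[].
      exact: (List.in_map (fun v => (v.1, v.2 + p%:Z * L M)) _ _ hu).
    by have := ltn_ord a; rewrite /w' /=; lia.
  rewrite rep_coef_nat ?divz_ge0 // ew divzDr ?dvdz_mull // mulzK //.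
  by rewrite /g /rep_coef zpowD ?mulrA //; [exact: mulmxV | exact: mulVmx].
have zK := zpowK (mulmxV psiX) (mulVmx psiX) (L M).
apply/eqP; rewrite eq_le (prk_mull r1P) andbT.
have {1}-> : flat (map_mx phi (matr_mx M)) = flat (map_mx phi (matr_mx M)) *m
    (zpow (psi 'X) (invmx (psi 'X)) (L M))%:M *m (zpow (psi 'X) (invmx (psi 'X)) (- L M))%:M.
  by rewrite -mulmxA -scalar_mxM zK mulmx1.
exact: (prk_mull r1P).
Qed.


End Periodic.

(** * Removing all itineraries of bounded period *)

Definition same_itinerary x y := forall j, c (Tz j x) = c (Tz j y).
Definition period_of (k : nat) x := forall j, c (Tz (j + k%:Z) x) = c (Tz j x).

Lemma peel (rk : rank_fun A) x0 : prank rk -> (exists2 k, (0 < k)%N & period_of k x0) ->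
  exists (V : nat -> X -> bool) (rho rk' : rank_fun A),
  [/\ prank rk' /\ prank rho, (forall m n (M : 'M_(m, n)), rk m n M = rk' m n M + rho m n M),
      (forall n, LC (V n) /\ forall y, same_itinerary y x0 -> V n y),
      conv (fun n => rk1 rk' (io (ind (V n)))) 0
    & forall D Ms, (forall a, a \in D -> cyl_elt a) ->
       (forall M, List.In M Ms -> forall i j, cyl_elt (matr_mx M i j)) -> approx rho D Ms 0].
Proof.
move=> rkP hper.
have exper : exists k, (0 < k)%N && `[< period_of k x0 >].
  by have [k k0 hk] := hper; exists k; rewrite k0; apply/asboolP.
case: (ex_minnP exper) => p /andP[p0 /asboolP hp] pmin.
have per_min (k : nat) : (0 < k < p)%N -> exists j, c (Tz (j + k%:Z) x0) != c (Tz j x0).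
  move=> /andP[k0 kp]; apply: contrapT => h.
  suff : (p <= k)%N by rewrite leqNgt kp.
  apply: pmin; rewrite k0; apply/asboolP => j; apply/eqP; apply: contrapT => /negP hj.
  by apply: h; exists j.
pose V := near_orbit x0 p.
have hV n : LC (V n) by exact/cyl_lc/cyl_near_orbit.
have [rho [rk' [rhoP rk'P split hrho hV0]]] := rank_split rkP hV (near_orbit_shift p0 hp).
exists V, rho, rk'; split=> //.
  move=> n; split=> // y hy; apply/(near_orbitP p0 hp); exists 0.
  by apply/windowP => j _; exact: hy.
move=> D Ms; apply: (peel_approx p0 hp per_min rhoP) => f hf f0.
(* A cylinder function vanishing along the orbit vanishes on V n for large n, so the sequence
   defining rho on it is eventually zero. *)
have [N hN] := cyl_orbit p0 hp hf f0.
apply: (conv_unique (hrho _ _ ((io f)%:M : 'M_1))) => e e_gt0; exists N => n Nn.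
rewrite -scalar_mxM ioM; [|exact: lc_ind|exact: cyl_lc].
rewrite (_ : (fun x => _) = fun=> 0); last first.
  apply/funext => x; rewrite /ind; case: (boolP (V n x)) => [/(hN n Nn) ->|_]; by rewrite ?mulr0 ?mul0r.
by rewrite io0 raddf0 prk0 // subrr normr0 ltW.
Qed.

Lemma rk1_ind_or (r : rank_fun A) (P S : X -> bool) : prank r -> LC P -> LC S ->
  rk1 r (io (ind (fun x => P x || S x))) <= rk1 r (io (ind P)) + rk1 r (io (ind S)).
Proof.
move=> rP hP hS; have hnS : LC (fun x => ~~ S x) by exact: (lc_map negb hS).
have -> : io (ind (fun x => P x || S x)) = io (ind P) * io (ind (fun x => ~~ S x)) + io (ind S).
  rewrite ioM; try exact: lc_ind.
  rewrite -ioD; [|apply: lcM; exact: lc_ind|exact: lc_ind].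
  congr io; apply/funext => x; rewrite /ind.
  by case: (P x); case: (S x); rewrite /= ?mulr1 ?mulr0 ?addr0 ?add0r.
apply: le_trans (rk1D rP _ _) _; rewrite lerD2r; exact: rk1_mull.
Qed.

Lemma peel_list (rk : rank_fun A) (xs : seq X) : prank rk ->
  (forall x, List.In x xs -> exists2 k, (0 < k)%N & period_of k x) ->
  exists (rho rk' : rank_fun A),
  [/\ prank rk', prank rho, (forall m n (M : 'M_(m, n)), rk m n M = rk' m n M + rho m n M),
      (forall h : real, 0 < h -> exists V : X -> bool,
         [/\ LC V, (forall x y, List.In x xs -> same_itinerary y x -> V y)
           & rk1 rk' (io (ind V)) <= h])
    & forall D Ms, (forall a, a \in D -> cyl_elt a) ->
       (forall M, List.In M Ms -> forall i j, cyl_elt (matr_mx M i j)) -> approx rho D Ms 0].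
Proof.
move=> rkP; elim: xs => [|x xs IH] hxs.
  exists (fun m n M => 0), rk; split=> //.
  - exact: prank_zero.
  - by move=> *; rewrite addr0.
  - move=> h h0; exists (fun=> false); split=> //; first exact: lc_cst.
    by rewrite (_ : ind _ = fun=> 0) ?io0 ?rk1_0 ?ltW //; apply/funext.
  - by move=> D Ms _ _; exact: approx_zero.
have [|rho1 [r1 [r1P rho1P split1 hV1 app1]]] := IH.
  by move=> y hy; apply: hxs; right.
have [V2 [rho2 [r2 [[r2P rho2P] split2 hV2 conv2 app2]]]] := peel r1P (hxs x (or_introl erefl)).
exists (fun m n M => rho1 m n M + rho2 m n M), r2; split=> //.
- exact: prank_add.
- by move=> m n M; rewrite split1 split2 -addrA [rho2 _ _ _ + _]addrC.
- move=> h h0; have h2 : 0 < h / 2 by lra.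
  have [V1 [lcV1 hV1' rV1]] := hV1 _ h2.
  have [N /(_ N (leqnn N)) hN] := conv2 _ h2.
  have [lcV2 hV2'] := hV2 N.
  exists (fun y => V1 y || V2 N y); split.
  + exact: (lc_map2 orb lcV1 lcV2).
  + move=> z y /= [<- hy|hz hy]; first by rewrite hV2' ?orbT.
    by rewrite (hV1' _ _ hz hy).
  apply: le_trans (rk1_ind_or r2P lcV1 lcV2) _.
  (* Splitting off rho2 only lowers the remainder, so the earlier bound survives. *)
  have le1 : rk1 r2 (io (ind V1)) <= h / 2.
    by apply: le_trans rV1; rewrite /rk1 split2 lerDl (prk_ge0 rho2P).
  by move: hN; rewrite subr0 => /ler_normlP[_ hN]; lra.
- move=> D Ms hD hMs; rewrite -[0]addr0.
  by apply: approx_add; [exact: app1 | exact: app2].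
Qed.

Lemma periodic_list N : exists xs : seq X,
  (forall x, List.In x xs -> exists2 k, (0 < k)%N & period_of k x) /\
  (forall y k, (0 < k <= N)%N -> period_of k y -> exists2 x, List.In x xs & same_itinerary y x).
Proof.
pose key y := [tuple c (Tz (i : nat)%:Z y) | i < N].
have [vals hvals] : exists s : seq (N.-tuple Y), forall y, key y \in s.
  apply: lc_finite; apply: (@lc_determined 'I_N _ _ (fun i y => c (Tz (i : nat)%:Z y))).
    by move=> i; exact: lc_iterz.
  by move=> x y e; apply/eq_from_tnth => i; rewrite !tnth_mktuple.
have key_eq k x y : (0 < k <= N)%N -> period_of k x -> period_of k y -> key x = key y ->
    same_itinerary x y.
  move=> /andP[k0 kN] hx hy e j.
  have [lt rE] := absz_modz j k0.
  have dj : (k %| j - (j %% k)%Z)%Z by exact: dvdz_sub_mod.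
  rewrite (per_mod hx dj) (per_mod hy dj) -rE.
  have /(congr1 (fun u => tnth u (Ordinal (leq_trans lt kN)))) := e.
  by rewrite !tnth_mktuple.
have [xs [h1 h2]] : exists xs : seq X,
    (forall x, List.In x xs -> exists2 k, (0 < k)%N & period_of k x) /\
    forall kv, kv \in [seq (k, v) | k <- index_iota 1 N.+1, v <- vals] ->
    forall y, (0 < kv.1 <= N)%N -> period_of kv.1 y -> key y = kv.2 ->
    exists2 x, List.In x xs & same_itinerary y x.
  elim: [seq (k, v) | k <- index_iota 1 N.+1, v <- vals] => [|kv l [xs [h1 h2]]].
    by exists [::].
  have [[z [hk hz ez]]|nz] := pselect (exists z, [/\ (0 < kv.1 <= N)%N, period_of kv.1 z & key z = kv.2]).
    exists (z :: xs); split.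
      move=> x [<-|/h1 //]; exists kv.1 => //; by case/andP: hk.
    move=> w; rewrite inE => /orP[/eqP -> y hy1 hy2 hy3|/h2 hw y hy1 hy2 hy3].
      by exists z; [left | apply: (key_eq kv.1) => //; rewrite hy3 ez].
    by have [x hx hxy] := hw y hy1 hy2 hy3; exists x => //; right.
  exists xs; split=> // w; rewrite inE => /orP[/eqP -> y hy1 hy2 hy3|/h2 //].
  by case: nz; exists y.
exists xs; split=> // y k hk hy; apply: (h2 (k, key y) _ y hk hy erefl).
by apply/allpairsP; exists (k, key y); split=> //=; rewrite mem_index_iota ltnS.
Qed.

(** * Markers for aperiodic points *)

(** Greedy choice: from each C only the points not yet within time N of E are added, which keeps E
    separated and puts a marker within time N of every point of C. *)
Lemma marker N (Cs : seq (X -> bool)) : (forall C, List.In C Cs -> LC C) ->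
  (forall C, List.In C Cs -> forall x (i : nat), (0 < i <= N)%N -> C x -> ~~ C (Tz i%:Z x)) ->
  exists E : X -> bool, [/\ LC E,
    (forall x (i : nat), (0 < i <= N)%N -> E x -> ~~ E (Tz i%:Z x))
  & (forall C, List.In C Cs -> forall x, C x -> exists2 z, (absz z <= N)%N & E (Tz z x))].
Proof.
elim: Cs => [|C Cs IH] lcC hC.
  by exists (fun=> false); split=> //; exact: lc_cst.
have [||E [lcE dE cE]] := IH.
- by move=> D hD; apply: lcC; right.
- by move=> D hD; apply: hC; right.
pose nearE x := [exists j : 'I_(N + N).+1, E (Tz ((j : nat)%:Z - N%:Z) x)].
have nearP x : nearE x <-> exists2 z, (absz z <= N)%N & E (Tz z x).
  split=> [/existsP [j hj]|[z hz hE]].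
    by exists ((j : nat)%:Z - N%:Z) => //; have := ltn_ord j; lia.
  have lt : (absz (z + N%:Z)%R < (N + N).+1)%N by lia.
  apply/existsP; exists (Ordinal lt) => /=.
  by have -> : (absz (z + N%:Z)%R)%:Z - N%:Z = z by lia.
have lcC0 : LC C by apply: lcC; left.
have lcN : LC nearE.
  apply: (@lc_determined 'I_(N + N).+1 _ _ (fun j x => E (Tz ((j : nat)%:Z - N%:Z) x))).
    by move=> j; exact: lc_iterz.
  by move=> x y e; apply: eq_existsb => j; exact: e.
exists (fun x => E x || (C x && ~~ nearE x)); split.
- by apply: (lc_map2 orb lcE); apply: (lc_map2 andb lcC0); exact: (lc_map negb lcN).
- move=> x i hi /orP[Ex|/andP[Cx nx]]; rewrite negb_or.
    rewrite dE //= negb_and negbK; apply/orP; right; apply/nearP.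
    by exists (- i%:Z); [lia | rewrite (iterzNK TK TinvK)].
  rewrite (negPf (hC C (or_introl erefl) x i hi Cx)) /=.
  by rewrite andbT; apply: contra nx => h; apply/nearP; exists i%:Z => //; lia.
- move=> D [<-|hD] x Dx; last first.
    by have [z hz hE] := cE D hD x Dx; exists z => //; rewrite hE.
  case: (boolP (nearE x)) => [/nearP [z hz hE]|nx]; first by exists z => //; rewrite hE.
  by exists 0 => //; rewrite Dx nx orbT.
Qed.

(** The translates of E by T^0, ..., T^N are disjoint, so [w *m v] is the scalar matrix 1_E of size
    N + 1; yet it factors through the 1 x 1 identity. *)
Lemma marker_rank (rk : rank_fun A) N (E : X -> bool) : prank rk -> LC E ->
  (forall x (i : nat), (0 < i <= N)%N -> E x -> ~~ E (Tz i%:Z x)) ->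
  N.+1%:R * rk1 rk (io (ind E)) <= rk1 rk 1.
Proof.
move=> rkP lcE dE; have lE := lc_ind lcE.
pose v : 'rV[A]_N.+1 := \row_i (tz (i : nat)%:Z * io (ind E)).
pose w : 'cV[A]_N.+1 := \col_i (io (ind E) * tz (- (i : nat)%:Z)).
have -> : N.+1%:R * rk1 rk (io (ind E)) = rk _ _ (w *m v).
  rewrite -prk_scalar //; congr (rk _ _ _); apply/matrixP => i j.
  rewrite !mxE big_ord1 !mxE mulrA -[_ * tz _ * tz _]mulrA -zpowD // -mulrA (tz_io _ lE).
  rewrite mulrA ioM //; last exact: lc_iterz.
  have [->|ij] := eqVneq i j.
    rewrite addNr oppr0 -[tz 0]/(1 : A) mulr1 mulr1n; congr io; apply/funext => x.
    by rewrite -[Tz 0 x]/x /ind -natrM mulnb andbb.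
  rewrite (_ : (fun x => _) = fun=> 0) ?io0 ?mul0r // ; apply/funext => x.
  rewrite /ind -natrM mulnb opprD opprK.
  case: (boolP (E x)) => //= Ex.
  have hi := ltn_ord i; have hj := ltn_ord j.
  have nij : (i : nat) <> j by move=> e; case/eqP: ij; apply: val_inj.
  have [lt|ge] := ltnP j i.
    have -> : (i : nat)%:Z - (j : nat)%:Z = (i - j)%N%:Z by lia.
    by rewrite (negPf (dE x (i - j)%N _ Ex)) //; lia.
  case: (boolP (E _)) => // h.
  have hji : (0 < j - i <= N)%N by lia.
  have := dE _ _ hji h; rewrite -(iterzD TK TinvK).
  have -> : (j - i)%N%:Z + ((i : nat)%:Z - (j : nat)%:Z) = 0 by lia.
  by rewrite -[Tz 0 x]/x Ex.
by apply: le_trans (prk_mull rkP _ _) _; rewrite -[w]mulmx1; exact: (prk_mulr rkP).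
Qed.


(** For each k <= N some index j shows that k is not a period of y; a window that sees all these j
    and j + k cannot match both at x and at T^k x. *)
Lemma marker_window N y : (forall k, (0 < k <= N)%N -> ~ period_of k y) ->
  exists C : X -> bool, [/\ LC C, C y
    & forall x (i : nat), (0 < i <= N)%N -> C x -> ~~ C (Tz i%:Z x)].
Proof.
move=> hy; have /choice [j hj] : forall k : nat, exists j, (0 < k <= N)%N ->
    c (Tz (j + k%:Z) y) <> c (Tz j y).
  move=> k; have [hk|_] := boolP (0 < k <= N)%N; last by exists 0.
  apply: contrapT => h; apply: (hy k hk) => i; apply: contrapT => hi.
  by apply: h; exists i.
pose m := (\max_(k < N.+1) (absz (j (k : nat)) + k))%N.
exists (fun x => window m x y); split; first exact/cyl_lc/cyl_window.
  by apply/windowP.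
move=> x i hi /windowP h; apply/negP => /windowP h'; apply: (hj i hi).
have lt : (i < N.+1)%N by case/andP: hi; rewrite ltnS.
have hm : (absz (j i) + i <= m)%N.
  by have := leq_bigmax (Ordinal lt) (F := fun k : 'I_N.+1 => (absz (j (k : nat)) + k)%N).
rewrite -h; last by lia.
rewrite (iterzD TK TinvK) h' //; first by lia.
Qed.

(** No N-separated cylinder set contains a point whose itinerary has period at most N, so V is put
    into E as a whole; the other points are covered by finitely many windows. *)
Lemma tower_exists (rk' : rank_fun A) N (V : X -> bool) : prank rk' -> LC V ->
  (forall y k, (0 < k <= N)%N -> period_of k y -> V y) ->
  exists (E : X -> bool) (H : nat),
     [/\ LC E, (forall x, exists k, (k < H)%N && E (Tz (- k.+1%:Z) x))
       & rk1 rk' (io (ind E)) <= rk1 rk' 1 / N.+1%:R + rk1 rk' (io (ind V))].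
Proof.
move=> rkP lcV hV.
have /choice [C hC] : forall y, exists C : X -> bool, [/\ LC C, C y || V y
    & forall x (i : nat), (0 < i <= N)%N -> C x -> ~~ C (Tz i%:Z x)].
  move=> y; case: (boolP (V y)) => [Vy|nV].
    by exists (fun=> false); split=> //; exact: lc_cst.
  have [|D [h1 h2 h3]] := @marker_window N y.
    by move=> k hk hp; case/negP: nV; exact: (hV y k).
  by exists D; split; rewrite ?h2.
have [l hl] : exists l : list X, forall y, exists x, List.In x l /\ (C x y || V y) = true.
  apply: compact_cover => x; last by case: (hC x).
  by apply: mopen_lc; apply: (lc_map2 orb) => //; case: (hC x).
have [||E [lcE dE cE]] := @marker N [seq C x | x <- l].
- by move=> D hD; have [x _ ->] := In_map hD; case: (hC x).
- by move=> D hD; have [x _ ->] := In_map hD; case: (hC x).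
exists (fun x => E x || V x), (N + N).+1; split.
- exact: (lc_map2 orb lcE lcV).
(* A visit is sought within time N of T^(-(N+1)) x, that is, at a time between -(2N+1) and -1; hence
   the height 2N+1. *)
- move=> x; have [y [yl]] := hl (Tz (- N.+1%:Z) x).
  case: (boolP (V _)) => [hVx _|_].
    by exists N; rewrite hVx orbT andbT ltnS leq_addr.
  rewrite orbF => hCy; have [z hz hE] := cE _ (List.in_map C _ _ yl) _ hCy.
  exists (absz (N%:Z - z)%R); apply/andP; split; first by lia.
  apply/orP; left; move: hE; rewrite -(iterzD TK TinvK).
  by have -> : - (absz (N%:Z - z)%R).+1%:Z = z - N.+1%:Z by lia.
- apply: le_trans (rk1_ind_or rkP lcE lcV) _; rewrite lerD2r.
  by rewrite ler_pdivlMr ?ltr0n // mulrC; exact: marker_rank.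
Qed.

End Label.

(** The label of x lists the values at x of all coefficients involved, so each coefficient is a
    cylinder function of radius 0. *)
Lemma label_exists (L : seq A) : exists c : X -> seq K, LC c /\ forall a, a \in L -> cyl_elt c a.
Proof.
have /choice [tm htm] : forall a, exists s, lc_terms s /\ a = val_terms s.
  by move=> a; have [s h1 h2] := terms_ex a; exists s.
have [S [hS hL]] : exists S, lc_terms S /\ forall a, a \in L -> forall u, List.In u (tm a) -> List.In u S.
  elim: L => [|a L [S [hS hL]]]; first by exists [::]; split=> // u [].
  exists (tm a ++ S); split.
    move=> u h; case: (In_cat h) => hu; [exact: (proj1 (htm a) u hu) | exact: (hS u hu)].
  move=> b; rewrite inE => /orP[/eqP -> u hu|/hL hb u /hb hu]; apply: List.in_or_app; first by left.
  by right.
have [c [hc hcS]] : exists c : X -> seq K, LC c /\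
    forall u, List.In u S -> forall x y, c x = c y -> u.1 x = u.1 y.
  elim: S hS {hL} => [|u S IH] hS; first by exists (fun=> [::]); split=> //; exact: lc_cst.
  have [|c [hc hcS]] := IH; first by move=> v hv; apply: hS; right.
  exists (fun x => u.1 x :: c x); split.
    by apply: (lc_map2 cons) => //; apply: hS; left.
  move=> v [<-|hv] x y [h1 h2] //; exact: (hcS v hv x y h2).
exists c; split=> // a aL; exists (tm a); last exact: (proj2 (htm a)).
move=> u hu; exists 0%N => x x' e; apply: (hcS u); first exact: (hL a aL u hu).
exact: (e 0 isT).
Qed.

Lemma crossed_regular (rk : rank_fun A) : prank rk -> rk1 rk 1 = 1 -> regular_rank rk.
Proof.
move=> rkP rk_1; apply: approx_regular => // D Ms e e0.
pose entries (M : matr A) := [seq matr_mx M i j | i <- enum 'I_(projT1 M).1, j <- enum 'I_(projT1 M).2].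
have [c [hc hcL]] := label_exists (D ++ flatten (map entries Ms)).
have hD a : a \in D -> cyl_elt c a by move=> aD; apply: hcL; rewrite mem_cat aD.
have hMs M : List.In M Ms -> forall i j, cyl_elt c (matr_mx M i j).
  move=> hM i j; apply: hcL; rewrite mem_cat; apply/orP; right.
  elim: (Ms) hM => // M' l IH /= [->|/IH hl]; rewrite mem_cat; last by rewrite hl orbT.
  by apply/orP; left; apply/allpairsP; exists (i, j); rewrite !mem_enum.
have [h h0 happ] := approx_towers D Ms e0.
(* One half of h pays for the marker, through 1/(N+1), and the other for the neighbourhood V of the
   itineraries of period at most N. *)
have h2 : 0 < h / 2 by lra.
have [N /ltW hN] := inv_nat_lt h2; rewrite -div1r in hN.
have [xs [hxs1 hxs2]] := periodic_list hc N.
have [rho [rk' [rk'P rhoP split hV happ']]] := peel_list hc rkP hxs1.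
have [V [lcV hVx rV]] := hV _ h2.
have [|E [H [lcE hE rE]]] := @tower_exists _ c hc rk' N V rk'P lcV.
  by move=> y k hk hy; have [x hx hyx] := hxs2 y k hk hy; exact: (hVx x y).
have app1 : approx rk' D Ms e.
  apply: happ => //; exists E, H; split=> //.
  apply: le_trans rE _.
  rewrite (splitr h); apply: lerD rV; apply: le_trans hN.
  (* The remainder has rk' of 1 at most rk of 1, which is 1. *)
  rewrite ler_pM2r ?invr_gt0 ?ltr0n // -rk_1 /rk1 split lerDl.
  exact: (prk_ge0 rhoP).
have := approx_add app1 (happ' D Ms hD hMs); rewrite addr0.
by apply: approx_eq => M _; rewrite /rk_matr -split.
Qed.

End Crossed.

Theorem theorem5p5 (X : Type) (d : X -> X -> real)
    (hd : is_metric d) (hcomp : mcompact d) (htd : totally_disconnected d)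
    (T Tinv : X -> X) (hT : homeomorphism d T Tinv)
    (K : fieldType) (A : pzRingType) (iota : (X -> K) -> A) (t tinv : A)
    (hA : is_crossed_product d T Tinv iota t tinv) :
  forall rk : rank_fun A, sylvester rk -> regular_rank rk.
Proof.
by move=> rk /sylvester_prank [rkP rk_1]; exact: (crossed_regular hcomp hT hA rkP rk_1).
Qed.
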